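(* Let $0<\sigma<1$ and $t>0$. For every Schwartz function $f$ on $\mathbb{R}^d$, $$(it\sqrt{-\Delta})^\sigma K_\sigma(it\sqrt{-\Delta})f=\frac{i^\sigma t^{2\sigma}}{2^{1+\sigma}}\int_0^\infty e^{-i\frac{t^2}{4s}}\,e^{is\Delta}f\,\frac{ds}{s^{1+\sigma}} .$$
   Context: $K_\sigma$ is the modified Bessel function $K_\sigma(z)=\frac{\pi}{2}\,\frac{I_{-\sigma}(z)-I_\sigma(z)}{\sin(\sigma\pi)}$, $|\arg z|<\pi$, where $I_{\pm\sigma}$ are the modified Bessel functions of the first kind. The left-hand operator is the Fourier multiplier with symbol $(it|\xi|)^\sigma K_\sigma(it|\xi|)$, $\xi\neq0$, where $(ir)^\sigma=i^\sigma r^\sigma$ for $r>0$ and $i^\alpha=e^{i\pi\alpha/2}$; $e^{is\Delta}$ is the Fourier multiplier with symbol $e^{-is|\xi|^2}$ (Fourier transform normalized so that $-\Delta$ has symbol $|\xi|^2$). The integral $\int_0^\infty$ is understood as the limit of $\int_\varepsilon^R$ as $\varepsilon\to0$ and $R\to\infty$, in $L^2(\mathbb{R}^d)$. *)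

(* Defs.v *)
(* MathComp / MathComp-Analysis, with the complex numbers [R[i]] of
   mathcomp-real-closed over an arbitrary [R : realType]. *)
From HB Require Import structures.
From mathcomp Require Import all_boot all_order all_algebra.
From mathcomp Require Import all_classical all_reals all_analysis.
From mathcomp Require Import complex.
Set Implicit Arguments.
Unset Strict Implicit.
Unset Printing Implicit Defensive.
Import Order.TTheory GRing.Theory Num.Theory.
Import numFieldNormedType.Exports.
Import ComplexField.Normc.

Local Open Scope classical_set_scope.
Local Open Scope complex_scope.
Local Open Scope ring_scope.

(* not the Re and Im of ssrnum, which are complex-valued *)
Local Notation Re := complex.Re.
Local Notation Im := complex.Im.

(** * Lebesgue measure on R^d

    Points of R^d are row vectors ['rV[R]_d], measurable for the product
    sigma-algebra, i.e. the one generated by the coordinates. *)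

Definition rV_display : measure_display.
Proof. exact: default_measure_display. Qed.

Section measurable_rV.
Context {R : realType} (n : nat).

Let coord (i : 'I_n) (v : 'rV[R]_n) : measurableTypeR R := v ord0 i.

Let rV_set0 : g_sigma_preimage coord set0.
Proof. exact: sigma_algebra0. Qed.

Let rV_setC A : g_sigma_preimage coord A -> g_sigma_preimage coord (~` A).
Proof. exact: sigma_algebraC. Qed.

Let rV_bigcup (F : (set 'rV[R]_n)^nat) :
  (forall i, g_sigma_preimage coord (F i)) ->
  g_sigma_preimage coord (\bigcup_i F i).
Proof. exact: sigma_algebra_bigcup. Qed.

HB.instance Definition _ := @isMeasurable.Build rV_display
  'rV[R]_n (g_sigma_preimage coord) rV_set0 rV_setC rV_bigcup.

Lemma measurable_coord (i : 'I_n) :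
  measurable_fun [set: 'rV[R]_n] (fun v : 'rV[R]_n => v ord0 i).
Proof.
move=> _ Y mY; rewrite setTI; apply: sub_sigma_algebra => /=.
rewrite -bigcup_seq/=; exists i => /=; first by rewrite mem_index_enum.
by exists Y => //; rewrite setTI.
Qed.

Lemma measurable_fun_rV d (T : measurableType d) (f : T -> 'rV[R]_n) :
  (forall i, measurable_fun [set: T] (fun x => f x ord0 i)) ->
  measurable_fun [set: T] f.
Proof.
move=> mf _ A mA; rewrite setTI.
suff H : g_sigma_preimage (fun i => coord i \o f) `<=` measurable.
  apply: H; rewrite g_sigma_preimage_comp.
  by exists A => //; rewrite setTI.
apply: smallest_sub; first exact: sigma_algebra_measurable.
rewrite -bigcup_seq/= => B [i _ [C mC <-]].
exact: mf.
Qed.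

End measurable_rV.

Section lebesgue_measure_rV.
Context {R : realType}.

(* (a, (v_0, ..., v_(n-1))) |-> (a, v_0, ..., v_(n-1)) *)
Definition cons_rV n (p : measurableTypeR R * 'rV[R]_n) : 'rV[R]_n.+1 :=
  \row_i oapp (p.2 ord0) p.1 (unlift ord0 i).

Lemma measurable_cons_rV n : measurable_fun setT (@cons_rV n).
Proof.
apply: measurable_fun_rV => i.
under eq_fun do rewrite mxE.
case: (unliftP ord0 i) => [j _|_] /=; last exact: measurable_fst.
exact: measurableT_comp (measurable_coord j) measurable_snd.
Qed.

Definition uncons_rV n (v : 'rV[R]_n.+1) : measurableTypeR R * 'rV[R]_n :=
  (v ord0 ord0, \row_i v ord0 (lift ord0 i)).

Lemma measurable_uncons_rV n : measurable_fun setT (@uncons_rV n).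
Proof.
apply/measurable_fun_pairP; split; first exact: measurable_coord.
apply: measurable_fun_rV => i /=.
under eq_fun do rewrite mxE.
exact: measurable_coord.
Qed.

Lemma cons_rVK n : cancel (@cons_rV n) (@uncons_rV n).
Proof.
case=> a v; rewrite /uncons_rV /cons_rV mxE unlift_none /=; congr pair.
by apply/rowP => i; rewrite !mxE liftK.
Qed.

Lemma uncons_rVK n : cancel (@uncons_rV n) (@cons_rV n).
Proof.
move=> v; apply/rowP => i; rewrite mxE /=.
by case: unliftP => [j ->|->] //=; rewrite mxE.
Qed.

Section cons_measure.
Variables (n : nat) (mu : {sigma_finite_measure set 'rV[R]_n -> \bar R}).

Definition cons_measure : set 'rV[R]_n.+1 -> \bar R :=
  pushforward (@lebesgue_measure R \x mu)%E (@cons_rV n).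

Let cons_measure0 : cons_measure set0 = 0%E.
Proof. by rewrite /cons_measure /pushforward preimage_set0 measure0. Qed.

Let cons_measure_ge0 A : (0 <= cons_measure A)%E.
Proof. by rewrite /cons_measure /pushforward; exact: measure_ge0. Qed.

Let cons_measure_sigma_additive : semi_sigma_additive cons_measure.
Proof.
have preim_measurable A : measurable A -> measurable (@cons_rV n @^-1` A).
  by move=> mA; rewrite -[X in measurable X]setTI; exact: measurable_cons_rV.
move=> F mF tF mUF; rewrite /cons_measure /pushforward preimage_bigcup.
apply: measure_semi_sigma_additive.
- by move=> k; exact: preim_measurable.
- apply/trivIsetP => /= i j _ _ ij; rewrite -preimage_setI.
  by move/trivIsetP : tF => /(_ _ _ _ _ ij) ->//; rewrite preimage_set0.
- by rewrite -preimage_bigcup; exact: preim_measurable.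
Qed.

HB.instance Definition _ := isMeasure.Build _ _ _ cons_measure
  cons_measure0 cons_measure_ge0 cons_measure_sigma_additive.

Let cons_measure_sigma_finite : sigma_finite setT cons_measure.
Proof.
have /sigma_finiteP[F [TF ndF Foo]] := sigma_finiteT (@lebesgue_measure R).
have /sigma_finiteP[G [TG ndG Goo]] := sigma_finiteT mu.
exists (fun k => @uncons_rV n @^-1` (F k `*` G k)).
  rewrite -preimage_bigcup (_ : \bigcup_i _ = setT) ?preimage_setT//.
  apply/seteqP; split=> // -[x y] _.
  have [i _ Fx] : (\bigcup_i F i) x by rewrite -TF.
  have [j _ Gy] : (\bigcup_i G i) y by rewrite -TG.
  exists (maxn i j) => //; split.
    by move: x Fx; exact/subsetPset/ndF/leq_maxl.
  by move: y Gy; exact/subsetPset/ndG/leq_maxr.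
move=> k; have [mF Fk] := Foo k; have [mG Gk] := Goo k.
have mFG : measurable (F k `*` G k) by exact: measurableX.
split; first by rewrite -[X in measurable X]setTI; exact: measurable_uncons_rV.
rewrite /cons_measure /pushforward -comp_preimage.
rewrite (_ : _ \o _ = id); last by apply/funext => p /=; rewrite cons_rVK.
by rewrite preimage_id product_measure1E// lte_mul_pinfty// ge0_fin_numE.
Qed.

HB.instance Definition _ := Measure_isSigmaFinite.Build _ _ _ cons_measure
  cons_measure_sigma_finite.

End cons_measure.

(* n-fold product of the one-dimensional Lebesgue measure *)
Fixpoint lebesgue_rV n : {sigma_finite_measure set 'rV[R]_n -> \bar R} :=
  if n is m.+1 then cons_measure (lebesgue_rV m) else \d_(0 : 'rV[R]_0).

End lebesgue_measure_rV.

(** * Complex-valued analysis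

    Limits, sums and integrals of complex-valued functions are taken on the real
    and imaginary parts. *)

Section complex_analysis.
Context {R : realType}.
Implicit Types (z : R[i]) (a : R).

Definition cintegral d (T : measurableType d) (mu : {measure set T -> \bar R})
    (D : set T) (f : T -> R[i]) : R[i] :=
  (\int[mu]_(x in D) Re (f x)) +i* (\int[mu]_(x in D) Im (f x)).

Definition cseries (u : nat -> R[i]) : R[i] :=
  limn (series (fun k => Re (u k))) +i*
  limn (series (fun k => Im (u k))).

Definition cexp z : R[i] :=
  (expR (Re z))%:C * (cos (Im z) +i* sin (Im z)).

(* Principal argument, with values in ]-pi, pi] (for z != 0). *)
Definition carg z : R :=
  if 0 <= Im z then acos (Re z / normc z) else - acos (Re z / normc z).

Definition clog z : R[i] := ln (normc z) +i* carg z.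

(* Principal branch of z ^ a for z != 0; on the positive imaginary axis it is
   (i r) ^ a = e^(i pi a / 2) r ^ a, see [cpow_imag] below. *)
Definition cpow z a : R[i] := cexp (a%:C * clog z).

(* Euler's integral, i.e. the Gamma function at a > 0. *)
Definition Gamma a : R :=
  \int[lebesgue_measure]_(u in `]0, +oo[) (u `^ (a - 1) * expR (- u)).

(* I_nu, for nu > -1: the arguments k + nu + 1 of Gamma are then positive. *)
Definition besselI (nu : R) z : R[i] :=
  cpow (z / 2) nu *
  cseries (fun k => (z ^+ 2 / 4) ^+ k / (k`!%:R * Gamma (k%:R + nu + 1))%:C).

(* K_sigma, for 0 < |sigma| < 1. *)
Definition besselK (sigma : R) z : R[i] :=
  (pi / 2)%:C * ((besselI (- sigma) z - besselI sigma z) /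
                 (sin (sigma * pi))%:C).

Lemma cpow_imag (r a : R) : 0 < r ->
  cpow ('i%C * r%:C) a = cexp ('i%C * (pi * a / 2)%:C) * (r `^ a)%:C.
Proof.
move=> r0.
have ir b : 'i%C * b%:C = 0 +i* b :> R[i].
  by apply/eqP; rewrite eq_complex /= mulr0 !mul0r subr0 add0r mul1r !eqxx.
have n : normc (0 +i* r) = r.
  by rewrite /normc expr0n add0r sqrtr_sqr gtr0_norm.
have cM (b c e : R) : b%:C * (c +i* e) = (b * c) +i* (b * e).
  by apply/eqP; rewrite eq_complex /= !mul0r subr0 addr0 !eqxx.
rewrite !ir /cpow /clog n /carg n /= (ltW r0) mul0r acos0 cM /cexp /=.
rewrite expR0 /powR gt_eqF// mulrC mulrA (mulrC a pi).
by congr (_ * _); rewrite mul1r.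
Qed.

End complex_analysis.

Section euclidean_analysis.
Context {R : realType} {d : nat}.
Implicit Types (x xi : 'rV[R]_d) (f g m : 'rV[R]_d -> R[i]).

Definition edot x xi : R := \sum_(j < d) x ord0 j * xi ord0 j.

(* The norm of the library on row vectors is the sup norm. *)
Definition enorm x : R := Num.sqrt (edot x x).

(* partial derivative of [u] along the coordinates listed in [js] *)
Fixpoint partials (js : seq 'I_d) (u : 'rV[R]_d -> R) : 'rV[R]_d -> R :=
  if js is j :: js' then fun x => 'D_(delta_mx ord0 j) (partials js' u) x else u.

Definition rschwartz (u : 'rV[R]_d -> R) : Prop :=
  forall js : seq 'I_d,
    [/\ continuous (partials js u),
        forall j x, derivable (partials js u) x (delta_mx ord0 j) &
        forall al : 'I_d -> nat, exists M : R, forall x,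
          `|(\prod_(j < d) x ord0 j ^+ al j) * partials js u x| <= M].

Definition schwartz f : Prop :=
  rschwartz (fun x => Re (f x)) /\ rschwartz (fun x => Im (f x)).

Definition fourier f xi : R[i] :=
  cintegral (lebesgue_rV d) setT (fun x => cexp (- 'i%C * (edot x xi)%:C) * f x).

Definition inv_fourier g x : R[i] :=
  (((2 * pi) ^+ d)^-1)%:C *
  cintegral (lebesgue_rV d) setT (fun xi => cexp ('i%C * (edot x xi)%:C) * g xi).

(* The multiplier with symbol [m], at an [f] with [m * fourier f] integrable. *)
Definition fourier_multiplier m f : 'rV[R]_d -> R[i] :=
  inv_fourier (fun xi => m xi * fourier f xi).

(* e^(i s Laplacian) *)
Definition schrodinger (s : R) : ('rV[R]_d -> R[i]) -> 'rV[R]_d -> R[i] :=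
  fourier_multiplier (fun xi => cexp (- 'i%C * (s * enorm xi ^+ 2)%:C)).

(* (i t sqrt(-Laplacian))^sigma K_sigma(i t sqrt(-Laplacian)) *)
Definition bessel_operator (sigma t : R) :
    ('rV[R]_d -> R[i]) -> 'rV[R]_d -> R[i] :=
  fourier_multiplier (fun xi =>
    cpow ('i%C * (t * enorm xi)%:C) sigma *
    besselK sigma ('i%C * (t * enorm xi)%:C)).

Definition L2 f : Prop :=
  (fun x => Re (f x)) \in Lfun (lebesgue_rV d) 2%:E /\
  (fun x => Im (f x)) \in Lfun (lebesgue_rV d) 2%:E.

Definition L2norm f : \bar R :=
  Lnorm (lebesgue_rV d) 2%:E (fun x => (normc (f x))%:E).

(* [g] is the integral of [u s] over 0 < s < +oo in L^2: the limit in L^2 of the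
   integrals over [[e, r]] as [(e, r)] tends to [(0+, +oo)]. The integrals over
   [[e, r]] are taken pointwise in [x]. *)
Definition is_L2_integral (u : R -> 'rV[R]_d -> R[i]) g : Prop :=
  let I e r := fun x => cintegral lebesgue_measure `[e, r] (fun s => u s x) in
  [/\ forall e r, 0 < e -> e <= r -> L2 (I e r),
      L2 g &
      L2norm (fun x => I p.1 p.2 x - g x)
        @[p --> filter_prod 0^'+ (pinfty_nbhs R)] --> 0%E].

End euclidean_analysis.

(* Main.v *)
From HB Require Import structures.
Require Import Defs.
From mathcomp Require Import all_boot all_order all_algebra.
From mathcomp Require Import all_classical all_reals all_analysis.
From mathcomp Require Import complex measurable_realfun.
From mathcomp Require Import ring lra.

(** On the Fourier side the theorem says that, for [xi <> 0], [c = t ^ 2 / 4] and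
    [x = |xi| ^ 2], the integrals of [e ^ (- i (c / s + x s)) * s ^ (- 1 - sigma)]
    over [e <= s <= r] converge, as [e] tends to 0 and [r] to infinity, to a
    multiple of the Bessel function; and the convergence has to be strong enough
    to give convergence in L^2 after multiplication by the transform of a Schwartz
    function.

    The integral over the half-line does not converge absolutely at 0, so the
    factor [i] in the exponent is replaced by [e ^ (i th)] with
    [0 <= th < pi / 2]. In the variable [y = ln s] this is the integral [Zint]
    over the line, which converges absolutely. Differentiating under the integral
    sign shows that, as a function of [x], it solves Bessel's equation
    ([is_cderive_Y], [is_cderive_V]); its initial values are Gamma integrals over
    a ray, computed by rotating the ray ([cintegral_rotation]). Integrating the
    equation repeatedly from 0 bounds the remainders of the power series
    expansion ([frobenius_remainder]), with constants that depend on [th] through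
    a bound on the solution only. One integration by parts near [s = 0] provides
    such a bound, and also bounds the distance to the truncated integrals
    ([truncated_dist]), uniformly in [th]. For a fixed truncation and a fixed
    number of terms one can let [th] tend to [pi / 2], and then let the number
    of terms tend to infinity: the truncated integral over [e <= s <= r] differs
    from the sum of the two series by at most a constant times
    [(1 + x) * (e ^ (1 - sigma) + r ^ (- sigma))] ([truncated_wave_limit]).
    Euler's reflection formula ([gammaE_reflection]) turns the coefficients of the
    series into those of [I_sigma] and [I_(- sigma)] ([bessel_multiplier]).

    For the return to R^d the transform of a Schwartz function is bounded by the
    square of the weight [\prod_j (1 + xi_j ^ 2) ^ (- 1)]
    ([fourier_schwartz_decay]). One power of the weight absorbs the growth
    [1 + |xi| ^ 2] and the other one is integrable. Fubini's theorem identifies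
    the truncated integrals with Fourier multipliers
    ([truncated_inv_fourier]), and Plancherel's inequality ([inv_fourier_L2]),
    obtained by inserting the weight [e ^ (- a |x|_1)] and Schur's test,
    converts the estimate of the symbols into one in L^2. *)

Set Implicit Arguments.
Unset Strict Implicit.
Unset Printing Implicit Defensive.
Import Order.TTheory GRing.Theory Num.Theory.
Import numFieldNormedType.Exports.
Local Open Scope classical_set_scope.
Local Open Scope complex_scope.
Local Open Scope ring_scope.

Import ComplexField.Normc.
Local Notation Re := complex.Re.
Local Notation Im := complex.Im.

(** * Complex arithmetic by real and imaginary parts *)

Section complex_parts.
Context {R : realType}.
Implicit Types (z w : R[i]) (a b : R).

Lemma complex_ext z w : Re z = Re w -> Im z = Im w -> z = w.
Proof. by case: z w => a b [c e] /= -> ->. Qed.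

Lemma ReD z w : Re (z + w) = Re z + Re w. Proof. by case: z w => a b []. Qed.
Lemma ImD z w : Im (z + w) = Im z + Im w. Proof. by case: z w => a b []. Qed.
Lemma ReN z : Re (- z) = - Re z. Proof. by case: z. Qed.
Lemma ImN z : Im (- z) = - Im z. Proof. by case: z. Qed.
Lemma ReM z w : Re (z * w) = Re z * Re w - Im z * Im w.
Proof. by case: z w => a b []. Qed.
Lemma ImM z w : Im (z * w) = Re z * Im w + Im z * Re w.
Proof. by case: z w => a b []. Qed.
Lemma Re_real a : Re a%:C = a. Proof. by []. Qed.
Lemma Im_real a : Im a%:C = 0. Proof. by []. Qed.

Lemma ReMr z a : Re (z * a%:C) = Re z * a.
Proof. by rewrite ReM Im_real mulr0 subr0. Qed.

Lemma ImMr z a : Im (z * a%:C) = Im z * a.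
Proof. by rewrite ImM Im_real mulr0 add0r. Qed.

Definition cpartE := (ReD, ImD, ReN, ImN, ReM, ImM, Re_real, Im_real).

Lemma normc_sqr z : normc z ^+ 2 = Re z ^+ 2 + Im z ^+ 2.
Proof. by case: z => a b /=; rewrite sqr_sqrtr// addr_ge0// sqr_ge0. Qed.

Lemma normc_ge0 z : 0 <= normc z.
Proof. by case: z => a b /=; rewrite sqrtr_ge0. Qed.

Lemma le_Re_normc z : `|Re z| <= normc z.
Proof.
rewrite -(ler_pXn2r (ltn0Sn 1)) ?nnegrE ?normc_ge0//.
by rewrite normc_sqr real_normK ?num_real// lerDl sqr_ge0.
Qed.

Lemma le_Im_normc z : `|Im z| <= normc z.
Proof.
rewrite -(ler_pXn2r (ltn0Sn 1)) ?nnegrE ?normc_ge0//.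
by rewrite normc_sqr real_normK ?num_real// lerDr sqr_ge0.
Qed.

Lemma normc_le_parts z : normc z <= `|Re z| + `|Im z|.
Proof.
rewrite -(ler_pXn2r (ltn0Sn 1)) ?nnegrE ?addr_ge0 ?normc_ge0//.
rewrite normc_sqr sqrrD !real_normK ?num_real// -addrA lerD2l addrC.
by rewrite lerDl mulrn_wge0// mulr_ge0.
Qed.

Lemma normc_real a : normc a%:C = `|a|.
Proof. by rewrite /normc /= expr0n addr0 sqrtr_sqr. Qed.

Lemma normcX z n : normc (z ^+ n) = normc z ^+ n.
Proof. by elim: n => [|n IH]; rewrite ?normc1// !exprS normcM IH. Qed.

Lemma Re_cexp z : Re (cexp z) = expR (Re z) * cos (Im z).
Proof. by rewrite /cexp cpartE /= mul0r subr0. Qed.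

Lemma Im_cexp z : Im (cexp z) = expR (Re z) * sin (Im z).
Proof. by rewrite /cexp cpartE /= mul0r addr0. Qed.

Lemma cexpD z w : cexp (z + w) = cexp z * cexp w.
Proof.
apply: complex_ext.
  by rewrite Re_cexp ReM !Re_cexp !Im_cexp ReD ImD expRD cosD; ring.
by rewrite Im_cexp ImM !Re_cexp !Im_cexp ReD ImD expRD sinD; ring.
Qed.

Lemma cexp0 : cexp 0 = 1 :> R[i].
Proof.
by apply: complex_ext; rewrite ?Re_cexp ?Im_cexp /= expR0 ?cos0 ?sin0; ring.
Qed.

Lemma normc_cexp z : normc (cexp z) = expR (Re z).
Proof.
rewrite /cexp normcM normc_real gtr0_norm ?expR_gt0//= cos2Dsin2 sqrtr1.
by rewrite mulr1.
Qed.

Lemma cexp_neq0 z : cexp z != 0.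
Proof.
apply/eqP => h; have := normc_cexp z; rewrite h normc0 => /esym/eqP.
by rewrite expR_eq0.
Qed.

Lemma imulE a : 'i%C * a%:C = 0 +i* a :> R[i].
Proof. by apply: complex_ext; rewrite cpartE /=; ring. Qed.

Lemma Nimul a : - 'i%C * a%:C = 'i%C * (- a)%:C :> R[i].
Proof. by rewrite !rmorphN mulNr mulrN. Qed.

Lemma Re_cis a : Re (cexp ('i%C * a%:C)) = cos a.
Proof. by rewrite Re_cexp imulE /= expR0 mul1r. Qed.

Lemma Im_cis a : Im (cexp ('i%C * a%:C)) = sin a.
Proof. by rewrite Im_cexp imulE /= expR0 mul1r. Qed.

Lemma normc_cis a : normc (cexp ('i%C * a%:C)) = 1.
Proof. by rewrite normc_cexp imulE /= expR0. Qed.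

Lemma cisD a b :
  cexp ('i%C * (a + b)%:C) = cexp ('i%C * a%:C) * cexp ('i%C * b%:C).
Proof. by rewrite rmorphD mulrDr cexpD. Qed.

End complex_parts.

(** * Measurability and integrals of complex-valued functions *)

Section complex_integral.
Context {R : realType}.

Definition cmeasurable d (T : measurableType d) (D : set T) (f : T -> R[i]) :=
  measurable_fun D (fun x => Re (f x)) /\ measurable_fun D (fun x => Im (f x)).

Section cmeasurable.
Context d (T : measurableType d) (D : set T).
Implicit Types f g : T -> R[i].

Lemma cmeasurable_cst (c : R[i]) : cmeasurable D (fun=> c).
Proof. by split; exact: measurable_cst. Qed.

Lemma cmeasurable_real (u : T -> R) :
  measurable_fun D u -> cmeasurable D (fun x => (u x)%:C).
Proof. by move=> mu; split => //=; exact: measurable_cst. Qed.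

Lemma cmeasurableD f g : cmeasurable D f -> cmeasurable D g ->
  cmeasurable D (fun x => f x + g x).
Proof.
move=> [rf jf] [rg jg]; split.
  by under eq_fun do rewrite ReD; exact: measurable_funD.
by under eq_fun do rewrite ImD; exact: measurable_funD.
Qed.

Lemma cmeasurableM f g : cmeasurable D f -> cmeasurable D g ->
  cmeasurable D (fun x => f x * g x).
Proof.
move=> [rf jf] [rg jg]; split.
  by under eq_fun do rewrite ReM; apply: measurable_funB; exact: measurable_funM.
by under eq_fun do rewrite ImM; apply: measurable_funD; exact: measurable_funM.
Qed.

Lemma cmeasurable_cexp f : cmeasurable D f ->
  cmeasurable D (fun x => cexp (f x)).
Proof.
move=> [rf jf]; split.
  under eq_fun do rewrite Re_cexp.
  apply: measurable_funM; apply: measurableT_comp => //.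
  by apply: continuous_measurable_fun; exact: continuous_cos.
under eq_fun do rewrite Im_cexp.
apply: measurable_funM; apply: measurableT_comp => //.
by apply: continuous_measurable_fun; exact: continuous_sin.
Qed.

Lemma cmeasurable_normc f : cmeasurable D f ->
  measurable_fun D (fun x => normc (f x)).
Proof.
move=> [rf jf].
rewrite (_ : (fun x => _) =
  (fun x => Num.sqrt (Re (f x) ^+ 2 + Im (f x) ^+ 2))); last first.
  by apply/funext => x; case: (f x).
apply: measurableT_comp.
  by apply: continuous_measurable_fun; exact: sqrt_continuous.
by apply: measurable_funD; exact: measurable_funX.
Qed.

End cmeasurable.

Lemma cmeasurable_comp d1 d2 (T1 : measurableType d1) (T2 : measurableType d2)
    (f : T2 -> R[i]) (h : T1 -> T2) : cmeasurable setT f ->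
  measurable_fun setT h -> cmeasurable setT (fun x => f (h x)).
Proof.
by move=> [rf jf] mh; split; [exact: (measurableT_comp rf mh) |
  exact: (measurableT_comp jf mh)].
Qed.

Section cintegrable.
Context d (T : measurableType d) (mu : {measure set T -> \bar R}) (D : set T)
  (mD : measurable D).
Implicit Types f g : T -> R[i].

Definition cintegrable f :=
  mu.-integrable D (fun x => (Re (f x))%:E) /\
  mu.-integrable D (fun x => (Im (f x))%:E).

Lemma le_cintegrable f (u : T -> R) : cmeasurable D f ->
  mu.-integrable D (EFin \o u) -> (forall x, D x -> normc (f x) <= u x) ->
  cintegrable f.
Proof.
move=> [rf jf] iu fu; split; apply: (le_integrable mD _ _ iu).
- exact/measurable_EFinP.
- move=> x Dx; rewrite !abse_EFin lee_fin (le_trans _ (ler_norm _))//.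
  exact: (le_trans (le_Re_normc _) (fu x Dx)).
- exact/measurable_EFinP.
- move=> x Dx; rewrite !abse_EFin lee_fin (le_trans _ (ler_norm _))//.
  exact: (le_trans (le_Im_normc _) (fu x Dx)).
Qed.

Lemma cintegrableM c f : cintegrable f -> cintegrable (fun x => c * f x).
Proof.
move=> [rf jf]; split.
- rewrite (_ : (fun x => _) = (fun x => (Re c)%:E * (Re (f x))%:E -
    (Im c)%:E * (Im (f x))%:E)%E); last by apply/funext => x; rewrite cpartE.
  by apply: integrableB => //; exact: integrableZl.
- rewrite (_ : (fun x => _) = (fun x => (Re c)%:E * (Im (f x))%:E +
    (Im c)%:E * (Re (f x))%:E)%E); last by apply/funext => x; rewrite cpartE.
  by apply: integrableD => //; exact: integrableZl.
Qed.

Lemma eq_cintegral f g : (forall x, D x -> f x = g x) ->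
  cintegral mu D f = cintegral mu D g.
Proof.
by move=> fg; apply: complex_ext; apply: eq_Rintegral => x /set_mem Dx;
  rewrite fg.
Qed.

Lemma cintegralM c f : cintegrable f ->
  cintegral mu D (fun x => c * f x) = c * cintegral mu D f.
Proof.
move=> [rf jf]; apply: complex_ext; rewrite ?(ReM, ImM) /=.
  under eq_Rintegral do rewrite ReM.
  rewrite RintegralB ?RintegralZl//.
  - by have := @integrableZl _ _ _ _ _ mD (Re c) _ rf.
  - by have := @integrableZl _ _ _ _ _ mD (Im c) _ jf.
under eq_Rintegral do rewrite ImM.
rewrite RintegralD ?RintegralZl//.
- by have := @integrableZl _ _ _ _ _ mD (Re c) _ jf.
- by have := @integrableZl _ _ _ _ _ mD (Im c) _ rf.
Qed.

Lemma cintegralD f g : cintegrable f -> cintegrable g ->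
  cintegral mu D (fun x => f x + g x) = cintegral mu D f + cintegral mu D g.
Proof.
move=> [rf jf] [rg jg]; apply: complex_ext; rewrite ?(ReD, ImD) /=.
  by under eq_Rintegral do rewrite ReD; rewrite RintegralD.
by under eq_Rintegral do rewrite ImD; rewrite RintegralD.
Qed.

Lemma cintegralB f g : cintegrable f -> cintegrable g ->
  cintegral mu D (fun x => f x - g x) = cintegral mu D f - cintegral mu D g.
Proof.
move=> hf hg; under eq_cintegral do rewrite -mulN1r.
by rewrite cintegralD ?cintegralM ?mulN1r//; exact: cintegrableM.
Qed.

(** The two parts are bounded separately, hence the factor 2. *)
Lemma normc_cintegral_le f (u : T -> R) : cintegrable f ->
  mu.-integrable D (EFin \o u) -> (forall x, D x -> normc (f x) <= u x) ->
  normc (cintegral mu D f) <= 2 * \int[mu]_(x in D) u x.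
Proof.
move=> [rf jf] iu fu; rewrite (le_trans (normc_le_parts _))//= mulr_natl mulr2n.
have nint (h : T -> R) : mu.-integrable D (EFin \o h) ->
  mu.-integrable D (EFin \o (fun x => `|h x|)).
  by move=> ih; have := integrable_abse ih.
apply: lerD.
- rewrite (le_trans (le_normr_Rintegral _ _))// le_Rintegral//; first exact: nint.
  by move=> x Dx; rewrite (le_trans (le_Re_normc _))// fu.
- rewrite (le_trans (le_normr_Rintegral _ _))// le_Rintegral//; first exact: nint.
  by move=> x Dx; rewrite (le_trans (le_Im_normc _))// fu.
Qed.

End cintegrable.

Lemma cintegral_mkcond d (T : measurableType d) (mu : {measure set T -> \bar R})
    (D : set T) (f : T -> R[i]) :
  cintegral mu D f = cintegral mu setT (fun x => f x * (\1_D x : R)%:C).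
Proof.
have E (g : T -> R) : \int[mu]_(y in D) g y = \int[mu]_y (g y * \1_D y).
  by rewrite Rintegral_mkcond patch_indic.
apply: complex_ext; rewrite [LHS]E; apply: eq_Rintegral => y _.
  by rewrite [RHS]ReMr.
by rewrite [RHS]ImMr.
Qed.

Section real_Fubini.
Context d1 d2 (T1 : measurableType d1) (T2 : measurableType d2).
Variables (m1 : {sigma_finite_measure set T1 -> \bar R})
  (m2 : {sigma_finite_measure set T2 -> \bar R}).

Lemma Rintegral_prod_bounded (F : T1 * T2 -> R) (u : T1 -> R) (v : T2 -> R) :
  measurable_fun setT F ->
  m1.-integrable setT (EFin \o u) -> m2.-integrable setT (EFin \o v) ->
  (forall x y, `|F (x, y)| <= u x * v y) ->
  (m1 \x m2)%E.-integrable setT (EFin \o F).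
Proof.
move=> mF iu iv Fuv; apply/integrable12ltyP; first exact/measurable_EFinP.
have mFE : measurable_fun setT (fun z : T1 * T2 => `|(EFin \o F) z|%E).
  by apply: measurableT_comp => //; exact/measurable_EFinP.
have mvE : measurable_fun setT (fun y => (`|v y|)%:E).
  by have /measurable_int/measurable_EFinP mv := iv;
    apply/measurable_EFinP; exact: measurableT_comp.
have muE : measurable_fun setT (fun y => (`|u y|)%:E).
  by have /measurable_int/measurable_EFinP mv := iu;
    apply/measurable_EFinP; exact: measurableT_comp.
apply: (@le_lt_trans _ _ (\int[m1]_x ((`|u x|)%:E * \int[m2]_y (`|v y|)%:E))%E).
  apply: ge0_le_integral => //.
  - by move=> x _; exact: integral_ge0.
  - by apply: (measurable_fun_fubini_tonelli_F (m2 := m2) _ mFE).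
  - exact: emeasurable_funM (measurable_cst _).
  - move=> x _; rewrite -ge0_integralZl//.
    apply: ge0_le_integral => //.
    + exact: measurableT_comp mFE (pair1_measurable x).
    + exact: emeasurable_funM (measurable_cst _) mvE.
    + move=> y _ /=; rewrite lee_fin (le_trans (Fuv x y))//.
      by rewrite (le_trans (ler_norm _))// normrM.
have /integrableP[_ hu] := iu; have /integrableP[_ hv] := iv.
rewrite ge0_integralZr//; last exact: integral_ge0.
apply: lte_mul_pinfty => //; first exact: integral_ge0.
by rewrite ge0_fin_numE//; exact: integral_ge0.
Qed.

Lemma Rintegral_swap (F : T1 * T2 -> R) :
  (m1 \x m2)%E.-integrable setT (EFin \o F) ->
  (forall x, m2.-integrable setT (fun y => (F (x, y))%:E)) ->
  (forall y, m1.-integrable setT (fun x => (F (x, y))%:E)) ->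
  \int[m1]_x (\int[m2]_y F (x, y)) = \int[m2]_y (\int[m1]_x F (x, y)).
Proof.
move=> iF i2 i1; rewrite /Rintegral; congr fine.
transitivity (\int[m1]_x \int[m2]_y (EFin \o F) (x, y))%E.
  apply: eq_integral => x _; rewrite fineK//.
  exact: (integrable_fin_num measurableT (i2 x)).
rewrite (Fubini iF); apply: eq_integral => y _; rewrite fineK//.
exact: (integrable_fin_num measurableT (i1 y)).
Qed.

End real_Fubini.

End complex_integral.

(** * Lebesgue measure on row vectors *)

Section lebesgue_rV_theory.
Context {R : realType}.
Local Notation leb := (@lebesgue_measure R).
Local Notation "'lebn' n" := (@lebesgue_rV R n) (at level 10).

Lemma cons_rV0 n a (v : 'rV[R]_n) : cons_rV (a, v) ord0 ord0 = a.
Proof. by rewrite mxE unlift_none. Qed.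

Lemma cons_rV_lift n a (v : 'rV[R]_n) j :
  cons_rV (a, v) ord0 (lift ord0 j) = v ord0 j.
Proof. by rewrite mxE liftK. Qed.

Lemma ge0_integral_rVS n (f : 'rV[R]_n.+1 -> \bar R) :
  measurable_fun setT f -> (forall x, (0 <= f x)%E) ->
  (\int[lebn n.+1]_x f x = \int[leb]_a \int[lebn n]_v f (cons_rV (a, v)))%E.
Proof.
move=> mf f0; have mc := @measurable_cons_rV R n.
have := @ge0_integral_pushforward _ _ _ _ _ _ mc (leb \x lebn n)%E setT f
  measurableT mf (fun x _ => f0 x).
rewrite preimage_setT => ->.
by rewrite (fubini_tonelli1 _ (measurableT_comp mf mc)) => [|p]; [ | exact: f0].
Qed.

Lemma integrable_rVS n (f : 'rV[R]_n.+1 -> \bar R) : measurable_fun setT f ->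
  (lebn n.+1).-integrable setT f ->
  (leb \x lebn n)%E.-integrable setT (fun p => f (cons_rV p)).
Proof.
move=> mf /integrableP[_ foo]; have mc := @measurable_cons_rV R n.
apply/integrableP; split; first exact: measurableT_comp.
have := @ge0_integral_pushforward _ _ _ _ _ _ mc (leb \x lebn n)%E setT
  (fun x => `|f x|%E) measurableT (measurableT_comp (@abse_measurable R setT) mf)
  (fun x _ => abse_ge0 _).
by rewrite preimage_setT => <-.
Qed.

Lemma integral_rVS n (f : 'rV[R]_n.+1 -> \bar R) : measurable_fun setT f ->
  (lebn n.+1).-integrable setT f ->
  (\int[lebn n.+1]_x f x = \int[leb]_a \int[lebn n]_v f (cons_rV (a, v)))%E.
Proof.
move=> mf fi; have mc := @measurable_cons_rV R n.
have fic := integrable_rVS mf fi.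
have := @integral_pushforward _ _ _ _ _ _ mc (leb \x lebn n)%E setT f mf.
rewrite preimage_setT => /(_ fic measurableT) ->.
by rewrite -(integral12_prod_meas1 fic).
Qed.

Lemma integral_rV0 (f : 'rV[R]_0 -> \bar R) : measurable_fun setT f ->
  (\int[lebn 0]_x f x = f 0%R)%E.
Proof. by move=> mf; rewrite integral_dirac// diracT mul1e. Qed.

Lemma ge0_integral_prod n (phi : R -> R) (k : R) : measurable_fun setT phi ->
  (forall y, 0 <= phi y) -> (\int[leb]_y (phi y)%:E = k%:E)%E ->
  (\int[lebn n]_x (\prod_(j < n) phi (x ord0 j))%:E = (k ^+ n)%:E)%E.
Proof.
move=> mphi phi0 phik.
have mp m : measurable_fun setT
    (fun x : 'rV[R]_m => (\prod_(j < m) phi (x ord0 j))%:E).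
  apply/measurable_EFinP; apply: measurable_prod => j _.
  exact: measurableT_comp (measurable_coord j).
have p0 m (x : 'rV[R]_m) : (0 <= (\prod_(j < m) phi (x ord0 j))%:E)%E.
  by rewrite lee_fin prodr_ge0.
elim: n => [|n IH]; first by rewrite integral_rV0// big_ord0.
rewrite ge0_integral_rVS//.
transitivity (\int[leb]_a ((phi a)%:E * (k ^+ n)%:E))%E.
  apply: eq_integral => a _; rewrite -IH -(ge0_integralZl _ measurableT (mp n)) ?lee_fin//.
  apply: eq_integral => v _; rewrite big_ord_recl cons_rV0 -EFinM.
  by under eq_bigr do rewrite cons_rV_lift.
have k0 : 0 <= k.
  by rewrite -lee_fin -phik; apply: integral_ge0 => y _; rewrite lee_fin.
rewrite (@ge0_integralZr _ _ _ leb _ measurableT (EFin \o phi)) ?phik ?exprS ?EFinM//.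
- exact/measurable_EFinP.
- by move=> y _; rewrite lee_fin.
- by rewrite lee_fin exprn_ge0.
Qed.

Lemma measurable_rV_0 n : measurable [set 0 : 'rV[R]_n.+1].
Proof.
rewrite (_ : [set 0] = \bigcap_(i in [set: 'I_n.+1])
    ((fun v : 'rV[R]_n.+1 => v ord0 i) @^-1` [set (0 : R)])); last first.
  apply/seteqP; split => [x -> i _ /=|x x0]; first by rewrite mxE.
  by apply/rowP => i; rewrite mxE; exact: x0.
apply: fin_bigcap_measurable; first exact: finite_finset.
by move=> i _; rewrite -[X in measurable X]setTI; exact: measurable_coord.
Qed.

Lemma lebesgue_rV_set0 n : (lebn n.+1 [set 0%R] = 0)%E.
Proof.
have mc := @measurable_cons_rV R n.
have m0 : measurable [set (0 : R)] by exact: measurable_set1.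
apply/eqP; rewrite eq_le measure_ge0 andbT.
apply: (@le_trans _ _ ((leb \x lebn n)%E ([set 0%R] `*` setT))).
  have m00 : measurable ([set 0] : set 'rV[R]_n.+1) by exact: measurable_rV_0.
  change ((leb \x lebn n)%E (@cons_rV R n @^-1` [set 0%R]) <=
    (leb \x lebn n)%E ([set 0%R] `*` setT))%E.
  apply: le_measure; rewrite ?inE.
  - by rewrite -[X in measurable X]setTI; exact: mc.
  - exact: measurableX.
  - by move=> [a v] /= h; split => //; rewrite -(cons_rV0 a v) h mxE.
by rewrite product_measure1E//= lebesgue_measure_set1 mul0e.
Qed.

(** ** Translation invariance *)

(** Invariance passes from nonnegative functions to all measurable ones through
    positive and negative parts; it is proved for nonnegative functions because
    Tonelli's theorem applies to them without integrability. *)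
Lemma integral_ge0_invariant d (T : measurableType d)
    (mu : {measure set T -> \bar R}) (phi : T -> T) :
  measurable_fun setT phi ->
  (forall f : T -> \bar R, measurable_fun setT f -> (forall x, 0 <= f x)%E ->
    (\int[mu]_x f (phi x) = \int[mu]_x f x)%E) ->
  forall f : T -> \bar R, measurable_fun setT f ->
    (\int[mu]_x f (phi x) = \int[mu]_x f x)%E.
Proof.
move=> mphi H f mf; rewrite integralE [RHS]integralE.
have Hp := H f^\+%E (measurable_funepos mf) (funepos_ge0 f).
have Hn := H f^\-%E (measurable_funeneg mf) (funeneg_ge0 f).
rewrite -Hp -Hn; congr (_ - _)%E; apply: eq_integral => x _.
  by rewrite !funeposE.
by rewrite !funenegE.
Qed.

Lemma integral_measure_preserving d (T : measurableType d)
    (mu : {measure set T -> \bar R}) (phi : T -> T) : measurable_fun setT phi ->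
  (forall A, measurable A -> pushforward mu phi A = mu A) ->
  forall f : T -> \bar R, measurable_fun setT f ->
    (\int[mu]_x f (phi x) = \int[mu]_x f x)%E.
Proof.
move=> mphi H; apply: integral_ge0_invariant => // f mf f0.
have := @ge0_integral_pushforward _ _ _ _ _ _ mphi mu setT f
  measurableT mf (fun x _ => f0 x).
rewrite preimage_setT => <-.
by apply: eq_measure_integral => A mA _; exact: H.
Qed.

Lemma measurable_shift (r : R) : measurable_fun setT
  ((fun x => x + r) : measurableTypeR R -> measurableTypeR R).
Proof.
have : measurable_fun setT ((fun x => x) \+ (fun=> r) : R -> R) by
  apply: measurable_funD.
by [].
Qed.

Lemma lebesgue_integral_shift (r : R) (f : R -> \bar R) :
  measurable_fun setT f ->
  (\int[leb]_x f (x + r)%R = \int[leb]_x f x)%E.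
Proof.
move: f; apply: (@integral_measure_preserving _ (measurableTypeR R) leb
  (fun x => x + r)); first exact: measurable_shift.
move=> A mA; have mr := measurable_shift r.
apply/esym/lebesgue_measure_unique => //= _ [[a b]] _ <-.
rewrite /pushforward (_ : _ @^-1` _ = `]a - r, b - r]%classic).
  by rewrite /= !lebesgue_measure_itv/= !lte_fin ltrD2r -!EFinB opprB addrA subrK.
by apply/seteqP; split => x /=; rewrite !in_itv/= ltrBlDr lerBrDr.
Qed.

Lemma lebesgue_integral_opp (f : R -> \bar R) : measurable_fun setT f ->
  (\int[leb]_x f (- x)%R = \int[leb]_x f x)%E.
Proof.
move: f; apply: (@integral_measure_preserving _ (measurableTypeR R) leb -%R);
  last exact: lebesgue_measureN.
by have : measurable_fun setT (-%R : R -> R) by [].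
Qed.

Lemma measurable_rVD n (w : 'rV[R]_n) : measurable_fun setT (fun x : 'rV[R]_n => x + w).
Proof.
apply: measurable_fun_rV => i; under eq_fun do rewrite mxE.
by apply: measurable_funD => //; exact: measurable_coord.
Qed.

(** Induction on the dimension, the coordinates being integrated one by one. *)
Lemma integral_rVD n (w : 'rV[R]_n) (f : 'rV[R]_n -> \bar R) :
  measurable_fun setT f ->
  (\int[lebn n]_x f (x + w)%R = \int[lebn n]_x f x)%E.
Proof.
move: f; apply: integral_ge0_invariant; first exact: measurable_rVD.
elim: n w => [w f mf _|n IH w f mf f0].
  by congr integral; apply/funext => x; congr f; apply/rowP => -[].
pose w' := \row_j w ord0 (lift ord0 j).
have mc := @measurable_cons_rV R n.
have consD a v : cons_rV (a, v) + w = cons_rV (a + w ord0 ord0, v + w').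
  apply/rowP => i; rewrite mxE; case: (unliftP ord0 i) => [j ->|->].
    by rewrite !cons_rV_lift !mxE.
  by rewrite !cons_rV0.
rewrite !ge0_integral_rVS//; last exact: measurableT_comp mf (measurable_rVD w).
under eq_integral do under eq_integral do rewrite consD.
have mG : measurable_fun setT (fun a => \int[lebn n]_v f (cons_rV (a, v)))%E.
  exact: (@measurable_fun_fubini_tonelli_F _ _ (measurableTypeR R) 'rV[R]_n R
    (lebn n) (fun p => f (cons_rV p)) (measurableT_comp mf mc) (fun p => f0 _)).
rewrite -[RHS](lebesgue_integral_shift (w ord0 ord0) mG).
apply: eq_integral => a _.
rewrite (IH w' (fun v => f (cons_rV (a + w ord0 ord0, v)))) => //.
exact: measurableT_comp (measurableT_comp mf mc) (pair1_measurable _).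
Qed.

(** ** Continuous functions are measurable *)

(** Rounding the coordinates down to multiples of [2^-k] takes countably many
    values, and a continuous function is the limit of its compositions with
    these roundings. *)
Lemma continuous_measurable_rV n (u : 'rV[R]_n -> R) : continuous u ->
  measurable_fun setT u.
Proof.
move=> cu.
pose rnd (k : nat) (x : 'rV[R]_n) : 'rV[int]_n :=
  \row_i Num.floor (x ord0 i * 2 ^+ k).
pose pt (k : nat) (z : 'rV[int]_n) : 'rV[R]_n :=
  \row_i ((z ord0 i)%:~R / 2 ^+ k).
apply: (@measurable_fun_cvg _ _ _ setT (fun k x => u (pt k (rnd k x)))).
- move=> k _ Y mY; rewrite setTI.
  rewrite (_ : _ @^-1` _ = \bigcup_(z : 'rV[int]_n)
      ([set x | rnd k x = z] `&` [set x | Y (u (pt k z))])); last first.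
    apply/seteqP; split => [x Yx|x [z _ [<-]]//].
    by exists (rnd k x).
  apply: countable_bigcupT_measurable; first exact: countableP.
  move=> z; have [Yz|nYz] := pselect (Y (u (pt k z))); last first.
    rewrite (_ : _ `&` _ = set0) //; apply/seteqP; split => // x [_ /=].
    by move/nYz.
  rewrite (_ : _ `&` _ = \bigcap_(i in [set: 'I_n])
      ((fun v : 'rV[R]_n => v ord0 i) @^-1`
       `[(z ord0 i)%:~R / 2 ^+ k, (z ord0 i + 1)%:~R / 2 ^+ k[)).
    apply: fin_bigcap_measurable; first exact: finite_finset.
    move=> i _; rewrite -[X in measurable X]setTI.
    by apply: measurable_coord => //; exact: measurable_itv.
  have k0 : 0 < 2 ^+ k :> R by rewrite exprn_gt0.
  apply/seteqP; split => [x [<- _] i _ /=|x xz].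
    rewrite in_itv/= !mxE ler_pdivrMr// ltr_pdivlMr//.
    exact: floor_itv.
  split=> //=; apply/rowP => i; rewrite mxE; apply/eqP.
  have /= := xz i I; rewrite in_itv/= ler_pdivrMr// ltr_pdivlMr// => h.
  by rewrite floor_eq.
- move=> x _; apply: (cvg_comp _ u _ (cu x)).
  apply/cvg_ballP => e e0; near=> k; split => // i j.
  have k0 : 0 < 2 ^+ k :> R by rewrite exprn_gt0.
  rewrite (ord1 i) !mxE /ball /= ger0_norm; last first.
    by rewrite subr_ge0 ler_pdivrMr// floor_le.
  have /andP[_] := floor_itv (x ord0 j * 2 ^+ k).
  rewrite rmorphD/= -ltr_pdivlMr// mulrDl => h.
  rewrite ltrBlDr addrC (lt_trans h)// ltrD2l.
  by near: k; exact: (near_infty_natSinv_expn_lt (PosNum e0)).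
Unshelve. all: end_near. Qed.

(** ** An integrable weight *)

(** Powers of this product measure all decay below: it is integrable by
    Tonelli's theorem, and its inverse is a polynomial, so that it bounds every
    Schwartz function. *)
Definition weight n (x : 'rV[R]_n) : R := \prod_(j < n) (1 + x ord0 j ^+ 2)^-1.

Lemma weight_gt0 n (x : 'rV[R]_n) : 0 < weight x.
Proof.
by apply: prodr_gt0 => j _; rewrite invr_gt0 ltr_pwDl// sqr_ge0.
Qed.

Lemma weight_le1 n (x : 'rV[R]_n) : weight x <= 1.
Proof.
suff /andP[] : 0 <= weight x <= 1 by [].
apply: (big_ind (fun y : R => 0 <= y <= 1)) => [|y z|j _].
- by rewrite ler01 lexx.
- by move=> /andP[y0 y1] /andP[z0 z1]; rewrite mulr_ge0//= mulr_ile1.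
- rewrite invr_ge0 addr_ge0 ?sqr_ge0//=.
  by rewrite invf_le1 ?lerDl ?sqr_ge0// ltr_pwDl// sqr_ge0.
Qed.

Lemma measurable_weight n : measurable_fun setT (@weight n).
Proof.
apply: measurable_prod => j _.
apply: (@measurableT_comp _ _ _ _ _ _ (fun y : R => (1 + y ^+ 2)^-1)) => //.
  apply: continuous_measurable_fun => y; apply: cvgV.
    by rewrite gt_eqF// ltr_pwDl// sqr_ge0.
  by apply: cvgD; [exact: cvg_cst|exact: exprn_continuous].
exact: measurable_coord.
Qed.

Lemma integral_even_FTC (f F : R -> R) (l : R) :
  (forall x, 0 <= f x) -> continuous f -> (forall x, f (- x) = f x) ->
  (forall x : R, 0 < x -> is_derive x 1 F (f x)) ->
  F x @[x --> 0^'+] --> F 0 -> F x @[x --> +oo] --> l ->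
  (\int[leb]_x (f x)%:E = (2 * (l - F 0))%:E)%E.
Proof.
move=> f0 cf evf dF F0 Fl.
rewrite ge0_symfun_integralT//; last by move=> x /=; rewrite evf.
rewrite (_ : [set x | _] = `[0, +oo[%classic); last first.
  by apply/seteqP; split => x /=; rewrite in_itv/= andbT.
rewrite (@ge0_continuous_FTC2y _ f F 0 l)//.
- exact: continuous_subspaceT.
- by move=> x x0; case: (dF x x0).
- move=> x; rewrite in_itv/= andbT => x0; rewrite derive1E.
  by case: (dF x x0).
Qed.

(** The primitive of [2 a / (a ^+ 2 + y ^+ 2)] is [2 * atan (y / a)]. *)
Lemma integral_cauchy (a : R) : 0 < a ->
  (\int[leb]_y (2 * a / (a ^+ 2 + y ^+ 2))%:E = (2 * pi)%:E)%E.
Proof.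
move=> a0.
have p0 (y : R) : 0 < a ^+ 2 + y ^+ 2.
  by rewrite ltr_pwDl ?sqr_ge0// exprn_gt0.
have -> : 2 * pi = 2 * (pi - 2 * atan (0 / a)) :> R.
  by rewrite mul0r atan0 mulr0 subr0.
have dF (y : R) : is_derive y 1 (fun z => 2 * atan (z / a)) (2 * a / (a ^+ 2 + y ^+ 2)).
  have h : is_derive y 1 (fun z => z / a) a^-1.
    by apply: is_derive_eq; rewrite scaler0 add0r /GRing.scale/= mulr1.
  have h2 := @is_derive1_comp R atan (fun z => z / a) y _ _
    (is_derive1_atan (y / a)) h.
  have h3 := is_deriveZ 2 h2; apply: is_derive_eq h3 _.
  rewrite /GRing.scale /=; field.
  by rewrite gt_eqF//= gt_eqF// addrC p0.
apply: (@integral_even_FTC (fun y => 2 * a / (a ^+ 2 + y ^+ 2))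
  (fun y => 2 * atan (y / a)) pi).
- by move=> y; rewrite mulr_ge0// ?invr_ge0 ?mulr_ge0// ltW.
- move=> y; apply: cvgM; first exact: cvg_cst.
  apply: cvgV; first by rewrite gt_eqF.
  by apply: cvgD; [exact: cvg_cst|exact: exprn_continuous].
- by move=> y; rewrite sqrrN.
- apply: cvg_at_right_filter.
  by case: (dF 0) => /derivable1_diffP/differentiable_continuous.
- rewrite (_ : pi = 2 * (pi / 2)); last by rewrite mulrC divfK.
  apply: cvgM; first exact: cvg_cst.
  apply: (cvg_comp _ _ _ (@cvgy_atan R)).
  by apply: gt0_cvgMly; [rewrite invr_gt0|exact: cvg_id].
Qed.

Lemma integrable_weight n : (lebn n).-integrable setT (EFin \o @weight n).
Proof.
have mc (x : 'rV[R]_n) : 0 <= weight x <=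
    \prod_(j < n) (2 * 1 / (1 ^+ 2 + x ord0 j ^+ 2)).
  rewrite (ltW (weight_gt0 x))/=; apply: ler_prod => j _.
  rewrite invr_ge0 addr_ge0 ?sqr_ge0//= mulr1 expr1n ler_peMl ?ler1n//.
  by rewrite invr_ge0 addr_ge0 ?sqr_ge0.
apply/integrableP; split; 
  first by apply/measurable_EFinP; exact: measurable_weight.
have mphi : measurable_fun setT (fun y : R => 2 * 1 / (1 ^+ 2 + y ^+ 2)).
  apply: continuous_measurable_fun => y; apply: cvgM; first exact: cvg_cst.
  apply: cvgV; first by rewrite gt_eqF// expr1n ltr_pwDl// sqr_ge0.
  by apply: cvgD; [exact: cvg_cst|exact: exprn_continuous].
have := @ge0_integral_prod n _ _ mphi _ (integral_cauchy ltr01).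
move=> /(_ _)/= h; apply: le_lt_trans (ltry ((2 * pi) ^+ n)).
rewrite -h; last first.
  by move=> y; rewrite mulr_ge0// invr_ge0 addr_ge0 ?sqr_ge0 ?expr1n.
apply: ge0_le_integral => //.
- apply/measurable_EFinP; apply: measurableT_comp => //.
  exact: measurable_weight.
- apply/measurable_EFinP; apply: measurable_prod => j _.
  exact: measurableT_comp mphi (measurable_coord j).
- by move=> x _ /=; have /andP[w0 wle] := mc x; rewrite lee_fin ger0_norm.
Qed.

End lebesgue_rV_theory.

(** * Decay of the Fourier transform of a Schwartz function *)

Section parametric.
Context {R : realType} (n : nat).
Local Notation lebn := (@lebesgue_rV R n).

(** Multiplying by [weight] makes the integrand integrable in both variables,
    which is what the measurability part of Fubini's theorem asks for. *)
Lemma measurable_Rintegral_rV d (T : measurableType d)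
    (m : {sigma_finite_measure set T -> \bar R}) (F : 'rV[R]_n * T -> R)
    (v : T -> R) :
  measurable_fun setT F -> m.-integrable setT (EFin \o v) ->
  (forall x y, `|F (x, y)| <= v y) ->
  measurable_fun setT (fun x => \int[m]_y F (x, y)).
Proof.
move=> mF iv Fv.
have mW : measurable_fun setT (fun p : 'rV[R]_n * T => weight p.1).
  exact: measurableT_comp (@measurable_weight R n) measurable_fst.
have iWF : (lebn \x m)%E.-integrable setT
    (EFin \o (fun p => weight p.1 * F p)).
  apply: (@Rintegral_prod_bounded _ _ _ _ _ lebn m _ (@weight R n) v) => //.
  - exact: measurable_funM.
  - exact: integrable_weight.
  - by move=> x y /=; rewrite normrM gtr0_norm ?weight_gt0// ler_pM2l ?weight_gt0.
have /= mG := measurable_fubini_F iWF.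
have iF x : m.-integrable setT (fun y => (F (x, y))%:E).
  apply: (le_integrable _ _ _ iv) => //.
    by apply/measurable_EFinP; exact: measurableT_comp mF (pair1_measurable x).
  by move=> y _ /=; rewrite lee_fin (le_trans (Fv x y))// ler_norm.
rewrite (_ : (fun x => _) = (fun x => (weight x)^-1 *
  fine (fubini_F m (EFin \o (fun p => weight p.1 * F p)) x))).
  apply: measurable_funM; last exact: measurableT_comp mG.
  under eq_fun do rewrite -prodfV; apply: measurable_prod => j _.
  under eq_fun do rewrite invrK; apply: measurable_funD => //.
  exact: measurable_funX (measurable_coord j).
apply/funext => x; rewrite /fubini_F /=.
have /= e := RintegralZl (weight x) measurableT (iF x).
by rewrite [X in _ * X]e mulrA mulVf ?mul1r// gt_eqF// weight_gt0.
Qed.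

End parametric.

Section line_derivative.
Context {R : realType} {d : nat}.
Local Notation lebn := (@lebesgue_rV R d).
Local Notation ej j := (delta_mx ord0 j : 'rV[R]_d).
Implicit Types (u v : 'rV[R]_d -> R) (x : 'rV[R]_d).

Lemma is_derive_line u (w : 'rV[R]_d) x :
  (forall y, derivable u y w) ->
  forall s : R, is_derive s 1 (fun r => u (r *: w + x)) ('D_w u (s *: w + x)).
Proof.
move=> du s.
have E : (fun h : R => h^-1 *: (((fun r : R => u (r *: w + x)) \o shift s)
    (h *: 1) - u (s *: w + x))) =
  (fun h : R => h^-1 *: ((u \o shift (s *: w + x)) (h *: w) - u (s *: w + x))).
  apply/funext => h /=; congr (_ *: (u _ - _)).
  have -> : h *: 1 = h :> R by rewrite /GRing.scale/= mulr1.
  by rewrite scalerDl addrA.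
by apply: DeriveDef; rewrite /derivable /derive E //; exact: du.
Qed.

Lemma shift_coord (r : R) j x k :
  (r *: ej j + x) ord0 k = r * (k == j)%:R + x ord0 k.
Proof. by rewrite !mxE eqxx. Qed.

(** Only the factor of the [j]-th coordinate changes, and
    [1 + y ^+ 2 <= 3 * (1 + (y + r) ^+ 2)] when [`|r| <= 1]. *)
Lemma weight_shift (r : R) j x : `|r| <= 1 -> weight (r *: ej j + x) <= 3 * weight x.
Proof.
move=> r1; rewrite /weight (bigD1 j)//= [X in _ <= 3 * X](bigD1 j)//= mulrA.
have p0 (y : R) : 0 < 1 + y ^+ 2 by rewrite ltr_pwDl// sqr_ge0.
rewrite shift_coord eqxx mulr1.
rewrite (eq_bigr (fun k => (1 + x ord0 k ^+ 2)^-1)); last first.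
  by move=> k /negbTE kj; rewrite shift_coord kj mulr0 add0r.
rewrite ler_wpM2r//; first by apply: prodr_ge0 => k _; rewrite invr_ge0 ltW.
rewrite -lef_pV2 ?posrE ?invr_gt0 ?mulr_gt0 ?invr_gt0// invfM !invrK.
rewrite ler_pdivrMl//.
have : r ^+ 2 <= 1 by rewrite -real_normK ?num_real// expr_le1.
set y := x ord0 j; have := sqr_ge0 (y + 2 * r); nra.
Qed.

Lemma is_derive_quotient_cvg (phi : R -> R) (l : R) (h : nat -> R) :
  is_derive (0 : R) 1 phi l -> (forall k, h k != 0) ->
  h k @[k --> \oo] --> (0 : R) ->
  (h k)^-1 * (phi (h k) - phi 0) @[k --> \oo] --> l.
Proof.
move=> [dphi <-] h0 hcv.
have /cvgr_dnbhsP/(_ h (conj h0 hcv)) : (fun r : R => r^-1 *: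
    ((phi \o shift 0) (r *: 1) - phi 0)) @ 0^' --> 'D_1 phi 0 by exact: dphi.
by apply: cvg_trans; apply: near_eq_cvg; apply: nearW => k;
  rewrite /= addr0 /GRing.scale/= mulr1.
Qed.

(** Integrals are translation invariant, so those of the difference quotients
    vanish; the mean value theorem dominates the quotients. *)
Lemma Rintegral_derivative0 j v (dv : 'rV[R]_d -> R) (M : R) :
  measurable_fun setT v -> measurable_fun setT dv ->
  (forall x (s : R), is_derive s 1 (fun r => v (r *: ej j + x))
                                   (dv (s *: ej j + x))) ->
  (forall x, `|v x| <= M * weight x) -> (forall x, `|dv x| <= M * weight x) ->
  \int[lebn]_x dv x = 0.
Proof.
move=> mv mdv Hd bv bdv.
pose h (k : nat) : R := k.+1%:R^-1.
have h0 k : 0 < h k by rewrite invr_gt0.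
have h1 k : h k <= 1 by rewrite invf_le1 ?ler1n.
pose q k x := (h k)^-1 * (v (h k *: ej j + x) - v x).
have iW c : lebn.-integrable setT (EFin \o (fun x => c * weight x)).
  have := @integrableZl _ _ _ lebn _ measurableT c _ (@integrable_weight R d).
  by apply: eq_integrable => // x _; rewrite EFinM.
have M0 : 0 <= M.
  have := le_trans (normr_ge0 _) (bv 0); rewrite pmulr_lge0//.
  exact: weight_gt0.
have mvs k : measurable_fun setT (fun x => v (h k *: ej j + x)).
  rewrite (_ : (fun x => _) = v \o (fun x => x + h k *: ej j)); last first.
    by apply/funext => x /=; rewrite addrC.
  exact: measurableT_comp mv (measurable_rVD _).
have mq k : measurable_fun setT (q k).
  by apply: measurable_funM => //; apply: measurable_funB.
have iv (f : 'rV[R]_d -> R) c : measurable_fun setT f ->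
    (forall x, `|f x| <= c * weight x) -> lebn.-integrable setT (EFin \o f).
  move=> mf bf; apply: (le_integrable _ _ _ (iW c)) => //.
    exact/measurable_EFinP.
  by move=> x _ /=; rewrite lee_fin (le_trans (bf x))// ler_norm.
have bq k x : `|q k x| <= 3 * M * weight x.
  have cont : {within `[0, h k], continuous (fun r : R => v (r *: ej j + x))}.
    apply: derivable_within_continuous => r _.
    by case: (Hd x r).
  have [c cin] := @MVT _ (fun r : R => v (r *: ej j + x))
    (fun r => dv (r *: ej j + x)) _ _ (h0 k) (fun r _ => Hd x r) cont.
  rewrite scale0r add0r subr0 => E.
  rewrite /q E mulrCA mulVf ?gt_eqF// mulr1.
  rewrite (le_trans (bdv _))// (mulrC 3) -mulrA ler_wpM2l// weight_shift//.
  move: cin; rewrite in_itv/= => /andP[c0 ch].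
  by rewrite gtr0_norm// (le_trans (ltW ch)).
have intq k : (\int[lebn]_x (q k x)%:E = 0)%E.
  have bvs x : `|v (h k *: ej j + x)| <= M * 3 * weight x.
    by rewrite (le_trans (bv _))// -mulrA ler_wpM2l// weight_shift// gtr0_norm.
  have e : \int[lebn]_x (q k x) = 0.
    rewrite /q RintegralZl//; last first.
      exact: (integrableB measurableT (iv _ _ (mvs k) bvs) (iv _ _ mv bv)).
    rewrite RintegralB//; [|exact: iv bvs|exact: iv bv].
    rewrite (_ : \int[lebn]_x v (h k *: ej j + x) = \int[lebn]_x v x).
      by rewrite subrr mulr0.
    rewrite /Rintegral; congr fine.
    rewrite -[RHS](@integral_rVD _ _ (h k *: ej j) (EFin \o v)).
      by apply: eq_integral => x _ /=; rewrite addrC.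
    exact/measurable_EFinP.
  have := @integrable_fin_num _ _ _ lebn setT measurableT _ (iv _ _ (mq k) (bq k)).
  by move/fineK => <-; rewrite [fine _]e.
have cvq x : q k x @[k --> \oo] --> dv x.
  have D0 : is_derive (0 : R) 1 (fun r => v (r *: ej j + x)) (dv x).
    by have := Hd x 0; rewrite scale0r add0r.
  have hn k : h k != 0 by rewrite gt_eqF.
  have := is_derive_quotient_cvg D0 hn (@cvg_harmonic R).
  by rewrite /q scale0r add0r.
have := @dominated_convergence _ _ _ lebn setT measurableT
  (fun k x => (q k x)%:E) (EFin \o dv) (EFin \o (fun x => 3 * M * weight x)).
move=> [] //.
- by move=> k; exact/measurable_EFinP.
- exact/measurable_EFinP.
- apply: aeW => x _; apply/fine_cvgP; split; first exact: nearW.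
  exact: cvq.
- by apply: aeW => x k _ /=; rewrite lee_fin.
move=> _ _ hcv; rewrite /Rintegral.
have := cvg_lim (@ereal_hausdorff R) hcv => /= <-.
by rewrite (eq_fun intq) lim_cst.
Qed.

End line_derivative.

Section fourier_decay.
Context {R : realType} {d : nat}.
Local Notation lebn := (@lebesgue_rV R d).
Local Notation ej j := (delta_mx ord0 j : 'rV[R]_d).
Implicit Types (u v : 'rV[R]_d -> R) (x xi : 'rV[R]_d).

Lemma edotC x xi : edot x xi = edot xi x.
Proof. by apply: eq_bigr => j _; rewrite mulrC. Qed.

Lemma edotDl x y xi : edot (x + y) xi = edot x xi + edot y xi.
Proof. by rewrite -big_split; apply: eq_bigr => j _; rewrite mxE mulrDl. Qed.

Lemma edot_line (r : R) j x xi :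
  edot (r *: ej j + x) xi = r * xi ord0 j + edot x xi.
Proof.
rewrite edotDl; congr (_ + _); rewrite /edot (bigD1 j)//= big1 ?addr0.
  by rewrite !mxE !eqxx mulr1.
by move=> k /negbTE kj; rewrite !mxE kj andbF mulr0 mul0r.
Qed.

Lemma measurable_edot2 dT (T : measurableType dT) (f g : T -> 'rV[R]_d) :
  measurable_fun setT f -> measurable_fun setT g ->
  measurable_fun setT (fun p => edot (f p) (g p)).
Proof.
move=> mf mg; apply: measurable_sum => j; apply: measurable_funM.
  exact: measurableT_comp (measurable_coord j) mf.
exact: measurableT_comp (measurable_coord j) mg.
Qed.

Lemma measurable_edot xi : measurable_fun setT (fun x => edot x xi).
Proof. exact: measurable_edot2. Qed.

(** The functions to which all integral transforms below are applied; both a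
    Schwartz function and its Fourier transform have parts of this kind. *)
Definition wbounded u := measurable_fun setT u /\
  exists M : R, forall x, `|u x| <= M * weight x.

Lemma integrable_cweight (c : R) :
  lebn.-integrable setT (EFin \o (fun x => c * weight x)).
Proof.
have := @integrableZl _ _ _ lebn _ measurableT c _ (@integrable_weight R d).
by apply: eq_integrable => // x _; rewrite EFinM.
Qed.

Lemma wbounded_integrable u : wbounded u -> lebn.-integrable setT (EFin \o u).
Proof.
move=> [mu [M uM]]; apply: (le_integrable _ _ _ (integrable_cweight M)) => //.
  exact/measurable_EFinP.
by move=> x _ /=; rewrite lee_fin (le_trans (uM x))// ler_norm.
Qed.

Lemma wboundedM u (c : 'rV[R]_d -> R) : measurable_fun setT c ->
  (forall x, `|c x| <= 1) -> wbounded u -> wbounded (fun x => c x * u x).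
Proof.
move=> mc c1 [mu [M uM]]; split; first exact: measurable_funM.
exists M => x; rewrite normrM (le_trans _ (uM x))//.
by rewrite -[leRHS]mul1r ler_wpM2r.
Qed.

(** The factors [1 + x_i ^+ 2] are multiplied out one at a time, each of them
    leaving two monomials. *)
Lemma schwartz_monomial u : rschwartz u -> forall js (l : seq 'I_d) al,
  exists M : R, forall x, `|\prod_(j < d) x ord0 j ^+ al j *
    \prod_(j <- l) (1 + x ord0 j ^+ 2) * partials js u x| <= M.
Proof.
move=> su js; elim=> [|i l IH] al.
  have [_ _ /(_ al) [M HM]] := su js; exists M => x.
  by rewrite big_nil mulr1.
have [M1 H1] := IH al.
have [M2 H2] := IH (fun j => al j + (j == i) * 2)%N.
exists (M1 + M2) => x; rewrite big_cons.
set P := \prod_(j < d) _; set Q := \prod_(j <- l) _.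
have -> : P * ((1 + x ord0 i ^+ 2) * Q) * partials js u x =
  P * Q * partials js u x +
  \prod_(j < d) x ord0 j ^+ (al j + (j == i) * 2) * Q * partials js u x.
  have -> : \prod_(j < d) x ord0 j ^+ (al j + (j == i) * 2) =
      P * x ord0 i ^+ 2.
    under eq_bigr do rewrite exprD.
    rewrite big_split; congr (_ * _); rewrite (bigD1 i)//= eqxx mul1n.
    by rewrite big1 ?mulr1// => j /negbTE ->; rewrite mul0n expr0.
  by ring.
exact: (le_trans (ler_normD _ _) (lerD (H1 x) (H2 x))).
Qed.

Lemma schwartz_wbounded u js : rschwartz u -> wbounded (partials js u).
Proof.
move=> su; have [cu _ _] := su js; split; first exact: continuous_measurable_rV.
have [M HM] := schwartz_monomial su js (index_enum 'I_d) (fun=> 0%N).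
exists M => x; rewrite -ler_pdivrMr ?weight_gt0//.
move: (HM x); rewrite big1 ?mul1r; last by move=> j _; rewrite expr0.
rewrite normrM; apply: le_trans; rewrite mulrC ler_wpM2r//.
rewrite /weight -prodfV; under eq_bigr do rewrite invrK.
exact: ler_norm.
Qed.

(** [energyT u] is the squared modulus of the Fourier transform of a real [u]. *)
Definition cosT u xi := \int[lebn]_x (cos (edot x xi) * u x).
Definition sinT u xi := \int[lebn]_x (sin (edot x xi) * u x).
Definition energyT u xi := cosT u xi ^+ 2 + sinT u xi ^+ 2.

Lemma sin_max (y : R) : `|sin y| <= 1.
Proof. by rewrite ler_norml sin_geN1 sin_le1. Qed.

Lemma measurable_cos_edot xi : measurable_fun setT (fun x => cos (edot x xi)).
Proof.
apply: measurableT_comp (measurable_edot xi).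
by apply: continuous_measurable_fun; exact: continuous_cos.
Qed.

Lemma measurable_sin_edot xi : measurable_fun setT (fun x => sin (edot x xi)).
Proof.
apply: measurableT_comp (measurable_edot xi).
by apply: continuous_measurable_fun; exact: continuous_sin.
Qed.

Lemma wbounded_cos u xi : wbounded u ->
  wbounded (fun x => cos (edot x xi) * u x).
Proof.
by apply: wboundedM; [exact: measurable_cos_edot|move=> x; exact: cos_max].
Qed.

Lemma wbounded_sin u xi : wbounded u ->
  wbounded (fun x => sin (edot x xi) * u x).
Proof.
by apply: wboundedM; [exact: measurable_sin_edot|move=> x; exact: sin_max].
Qed.

Lemma is_derive_cos_line xi j x (s : R) : is_derive s 1
  (fun r : R => cos (edot (r *: ej j + x) xi))
  (- (xi ord0 j * sin (edot (s *: ej j + x) xi))).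
Proof.
under eq_fun do rewrite edot_line.
have h : is_derive s 1 (fun r : R => r * xi ord0 j + edot x xi) (xi ord0 j).
  by apply: is_derive_eq; rewrite scaler0 !add0r addr0 /GRing.scale/= mulr1.
have := @is_derive1_comp R cos (fun r => r * xi ord0 j + edot x xi) s _ _
  (is_derive_cos _) h.
by move=> /is_derive_eq; apply; rewrite edot_line mulNr mulrC.
Qed.

Lemma is_derive_sin_line xi j x (s : R) : is_derive s 1
  (fun r : R => sin (edot (r *: ej j + x) xi))
  (xi ord0 j * cos (edot (s *: ej j + x) xi)).
Proof.
under eq_fun do rewrite edot_line.
have h : is_derive s 1 (fun r : R => r * xi ord0 j + edot x xi) (xi ord0 j).
  by apply: is_derive_eq; rewrite scaler0 !add0r addr0 /GRing.scale/= mulr1.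
have := @is_derive1_comp R sin (fun r => r * xi ord0 j + edot x xi) s _ _
  (is_derive_sin _) h.
by move=> /is_derive_eq; apply; rewrite edot_line mulrC.
Qed.

Section one_derivative.
Variables (u du : 'rV[R]_d -> R) (j : 'I_d) (xi : 'rV[R]_d).
Hypotheses (bu : wbounded u) (bdu : wbounded du).
Hypothesis Hdu : forall x (s : R),
  is_derive s 1 (fun r : R => u (r *: ej j + x)) (du (s *: ej j + x)).

(** Integration by parts: the derivative of [e * u] along the [j]-th axis
    integrates to zero. *)
Let derivative0 (e de : 'rV[R]_d -> R) :
  measurable_fun setT e -> measurable_fun setT de ->
  (forall x, `|e x| <= 1) -> (forall x, `|de x| <= 1) ->
  (forall x (s : R), is_derive s 1 (fun r : R => e (r *: ej j + x))
    (xi ord0 j * de (s *: ej j + x))) ->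
  \int[lebn]_x (e x * du x) = - (xi ord0 j * \int[lebn]_x (de x * u x)).
Proof.
move=> me mde e1 de1 He.
have beu := wboundedM me e1 bu; have bedu := wboundedM me e1 bdu.
have bdeu := wboundedM mde de1 bu.
pose v x := e x * u x.
pose dv x := e x * du x + xi ord0 j * (de x * u x).
have ixi : lebn.-integrable setT
    (EFin \o (fun x => xi ord0 j * (de x * u x))).
  by have := integrableZl measurableT (xi ord0 j) (wbounded_integrable bdeu).
have : \int[lebn]_x dv x = 0.
  have [_ [M1 H1]] := beu; have [_ [M2 H2]] := bedu; have [_ [M3 H3]] := bdeu.
  have W0 := fun x => ltW (@weight_gt0 R d x).
  pose M := `|M1| + `|M2| + `|xi ord0 j| * `|M3|.
  have p1 := normr_ge0 M1; have p2 := normr_ge0 M2.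
  have p3 : 0 <= `|xi ord0 j| * `|M3| by rewrite mulr_ge0.
  apply: (@Rintegral_derivative0 R d j v dv M).
  - exact: beu.1.
  - apply: measurable_funD; first exact: bedu.1.
    by apply: measurable_funM => //; exact: bdeu.1.
  - move=> x s; have h := is_deriveM (He x s) (Hdu x s).
    by apply: is_derive_eq h _; rewrite /dv /GRing.scale/=; ring.
  - move=> x; rewrite (le_trans (H1 x))// ler_wpM2r//.
    by rewrite (le_trans (ler_norm _))// /M -addrA lerDl addr_ge0.
  - move=> x; rewrite (le_trans (ler_normD _ _))//.
    rewrite [X in _ + X <= _]normrM.
    apply: (@le_trans _ _ (`|M2| * weight x + `|xi ord0 j| * (`|M3| * weight x))).
      apply: lerD.
        by rewrite (le_trans (H2 x))// ler_wpM2r// ler_norm.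
      rewrite ler_wpM2l// (le_trans (H3 x))// ler_wpM2r// ler_norm//.
    by rewrite mulrA -mulrDl ler_wpM2r// /M lerD2r lerDr.
rewrite /dv RintegralD//; last exact: wbounded_integrable.
rewrite RintegralZl//; last exact: wbounded_integrable.
by move=> /eqP; rewrite addr_eq0 => /eqP.
Qed.

(** A derivative exchanges the two transforms up to the factor [xi_j], with a
    sign that the squares do not see. *)
Lemma energyT_derivative :
  energyT du xi = xi ord0 j ^+ 2 * energyT u xi.
Proof.
have mc := measurable_cos_edot xi; have ms := measurable_sin_edot xi.
have e1 : cosT du xi = xi ord0 j * sinT u xi.
  have mNs : measurable_fun setT (fun x => - sin (edot x xi)).
    exact: measurableT_comp.
  have Ns1 x : `|- sin (edot x xi)| <= 1 by rewrite normrN sin_max.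
  have h x (s : R) : is_derive s 1 (fun r : R => cos (edot (r *: ej j + x) xi))
      (xi ord0 j * - sin (edot (s *: ej j + x) xi)).
    by rewrite mulrN; exact: is_derive_cos_line.
  have := derivative0 mc mNs (fun x => cos_max _) Ns1 h.
  under [in X in _ = X -> _]eq_Rintegral do rewrite mulNr -mulN1r.
  rewrite RintegralZl//; last exact/wbounded_integrable/wbounded_sin.
  by rewrite mulN1r mulrN opprK.
have e2 : sinT du xi = - (xi ord0 j * cosT u xi).
  exact: (derivative0 ms mc (fun x => sin_max _) (fun x => cos_max _)
    (fun x s => is_derive_sin_line xi j x s)).
by rewrite /energyT e1 e2; ring.
Qed.

End one_derivative.

Lemma energyT_partials u js xi : rschwartz u ->
  energyT (partials js u) xi = (\prod_(j <- js) xi ord0 j ^+ 2) * energyT u xi.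
Proof.
move=> su; elim: js => [|j js IH]; first by rewrite big_nil mul1r.
rewrite big_cons -mulrA -IH.
apply: energyT_derivative; try exact: schwartz_wbounded.
move=> x s; apply: (@is_derive_line R d (partials js u) (ej j) x) => y.
by have [_ h _] := su js; exact: h.
Qed.

Lemma energyT_bounded u : wbounded u ->
  exists K, forall xi, energyT u xi <= K.
Proof.
move=> bu; have iu := wbounded_integrable bu.
have iau : lebn.-integrable setT (EFin \o (fun x => `|u x|)).
  by have := integrable_abse iu.
exists (2 * (\int[lebn]_x `|u x|) ^+ 2) => xi.
rewrite mulr_natl mulr2n /energyT.
have I0 : 0 <= \int[lebn]_x `|u x| by exact: Rintegral_ge0.
have bound c : lebn.-integrable setT (EFin \o (fun x => c x * u x)) ->
  (forall x, `|c x| <= 1) ->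
  (\int[lebn]_x (c x * u x)) ^+ 2 <= (\int[lebn]_x `|u x|) ^+ 2.
  move=> ic c1; rewrite -[X in X <= _]real_normK ?num_real//.
  rewrite ler_sqr ?nnegrE// (le_trans (le_normr_Rintegral _ _))//.
  apply: le_Rintegral => //; first by have := integrable_abse ic.
  by move=> x _; rewrite normrM -[leRHS]mul1r ler_wpM2r.
apply: lerD; apply: bound.
- exact/wbounded_integrable/wbounded_cos.
- by move=> x; exact: cos_max.
- exact/wbounded_integrable/wbounded_sin.
- by move=> x; exact: sin_max.
Qed.

(** Multiplying by [xi_j ^+ 2] is differentiating, and the transforms of all
    derivatives are bounded. *)
Lemma energyT_decay u : rschwartz u ->
  exists K, forall xi, energyT u xi <= K * weight xi ^+ 4.
Proof.
move=> su.
have H l : forall js, exists K, forall xi : 'rV[R]_d,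
    \prod_(j <- l) (1 + xi ord0 j ^+ 2) *
    (\prod_(j <- js) xi ord0 j ^+ 2 * energyT u xi) <= K.
  elim: l => [|i l IH] js.
    have [K HK] := energyT_bounded (schwartz_wbounded js su).
    by exists K => xi; rewrite big_nil mul1r -energyT_partials.
  have [K1 H1] := IH js; have [K2 H2] := IH (i :: js).
  exists (K1 + K2) => xi; apply: le_trans (lerD (H1 xi) (H2 xi)).
  by rewrite !big_cons le_eqVlt; apply/orP; left; apply/eqP; ring.
pose l := index_enum 'I_d.
(* each copy of [l] contributes one factor [weight]; four are taken since
   [energyT] is the square of the modulus, of which decay of order 2 is wanted *)
have [K HK] := H (l ++ l ++ l ++ l) [::].
exists K => xi; move: (HK xi); rewrite !big_cat/= big_nil mul1r.
have w0 := weight_gt0 xi.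
have -> : \prod_(j <- l) (1 + xi ord0 j ^+ 2) = (weight xi)^-1.
  by rewrite /weight -prodfV; under [RHS]eq_bigr do rewrite invrK.
rewrite -ler_pdivrMr ?exprn_gt0//; apply: le_trans.
by rewrite mulrC !exprS expr0 mulr1 !invfM !mulrA.
Qed.

End fourier_decay.

Section fourier_parts.
Context {R : realType} {d : nat}.
Local Notation lebn := (@lebesgue_rV R d).
Implicit Types (u : 'rV[R]_d -> R) (f h : 'rV[R]_d -> R[i]) (x xi : 'rV[R]_d).

Lemma measurable_cosT u : wbounded u -> measurable_fun setT (cosT u).
Proof.
move=> bu; have iu := integrable_abse (wbounded_integrable bu).
apply: (@measurable_Rintegral_rV R d _ _ lebn
  (fun p => cos (edot p.2 p.1) * u p.2) (fun x => `|u x|)).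
- apply: measurable_funM; last exact: measurableT_comp bu.1 measurable_snd.
  apply: measurableT_comp; last exact: measurable_edot2.
  by apply: continuous_measurable_fun; exact: continuous_cos.
- exact: iu.
- by move=> xi x /=; rewrite normrM -[leRHS]mul1r ler_wpM2r// cos_max.
Qed.

Lemma measurable_sinT u : wbounded u -> measurable_fun setT (sinT u).
Proof.
move=> bu; have iu := integrable_abse (wbounded_integrable bu).
apply: (@measurable_Rintegral_rV R d _ _ lebn
  (fun p => sin (edot p.2 p.1) * u p.2) (fun x => `|u x|)).
- apply: measurable_funM; last exact: measurableT_comp bu.1 measurable_snd.
  apply: measurableT_comp; last exact: measurable_edot2.
  by apply: continuous_measurable_fun; exact: continuous_sin.
- exact: iu.
- by move=> xi x /=; rewrite normrM -[leRHS]mul1r ler_wpM2r// sin_max.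
Qed.

Definition cwbounded f := wbounded (fun x => Re (f x)) /\
  wbounded (fun x => Im (f x)).

Lemma cwboundedP f (M : R) : cmeasurable setT f ->
  (forall x, normc (f x) <= M * weight x) -> cwbounded f.
Proof.
move=> [rf jf] H; split; split => //; exists M => x.
  exact: le_trans (le_Re_normc _) (H x).
exact: le_trans (le_Im_normc _) (H x).
Qed.

Lemma schwartz_cwbounded f : schwartz f -> cwbounded f.
Proof. by move=> [rf jf]; split; exact: (@schwartz_wbounded R d _ [::]). Qed.

Lemma cwbounded_cintegrable f : cwbounded f -> cintegrable lebn setT f.
Proof. by move=> [rf jf]; split; exact: wbounded_integrable. Qed.

Lemma cintegral_cos_sin f (s : R) xi : cwbounded f ->
  cintegral lebn setT (fun x => (cos (edot x xi) +i* (s * sin (edot x xi))) * f x)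
  = (cosT (fun x => Re (f x)) xi - s * sinT (fun x => Im (f x)) xi) +i*
    (cosT (fun x => Im (f x)) xi + s * sinT (fun x => Re (f x)) xi).
Proof.
move=> [rf jf]; have E c (r : R) w : (c +i* (s * r)) * w =
    (c * Re w - s * (r * Im w)) +i* (c * Im w + s * (r * Re w)) :> R[i].
  by apply: complex_ext; rewrite cpartE /=; ring.
apply: complex_ext => /=.
  under eq_Rintegral do rewrite E /=.
  have i1 := wbounded_integrable (wbounded_cos xi rf).
  have i2 := wbounded_integrable (wbounded_sin xi jf).
  rewrite RintegralB ?RintegralZl//.
  by have := integrableZl measurableT s i2.
under eq_Rintegral do rewrite E /=.
have i1 := wbounded_integrable (wbounded_cos xi jf).
have i2 := wbounded_integrable (wbounded_sin xi rf).
rewrite RintegralD ?RintegralZl//.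
by have := integrableZl measurableT s i2.
Qed.

Lemma fourierE f xi : cwbounded f -> fourier f xi =
  (cosT (fun x => Re (f x)) xi + sinT (fun x => Im (f x)) xi) +i*
  (cosT (fun x => Im (f x)) xi - sinT (fun x => Re (f x)) xi).
Proof.
move=> bf; have := cintegral_cos_sin (-1) xi bf.
rewrite !mulN1r opprK => <-; apply: eq_cintegral => x _; congr (_ * _).
rewrite Nimul; apply: complex_ext; rewrite ?Re_cis ?Im_cis /= ?cosN ?sinN//.
by rewrite mulN1r.
Qed.

Lemma inv_fourierE h x : cwbounded h -> inv_fourier h x =
  (((2 * pi) ^+ d)^-1)%:C *
  ((cosT (fun xi => Re (h xi)) x - sinT (fun xi => Im (h xi)) x) +i*
   (cosT (fun xi => Im (h xi)) x + sinT (fun xi => Re (h xi)) x)).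
Proof.
move=> bh; congr (_ * _); have := cintegral_cos_sin 1 x bh.
rewrite !mul1r => <-; apply: eq_cintegral => xi _; congr (_ * _).
by apply: complex_ext; rewrite ?Re_cis ?Im_cis /= ?mul1r edotC.
Qed.

Lemma cmeasurable_fourier f : cwbounded f -> cmeasurable setT (fourier f).
Proof.
move=> bf; have [rf jf] := bf.
rewrite (funext (fun xi => fourierE xi bf)).
split => /=.
  by apply: measurable_funD; [exact: measurable_cosT|exact: measurable_sinT].
by apply: measurable_funB; [exact: measurable_cosT|exact: measurable_sinT].
Qed.

Lemma cmeasurable_inv_fourier h : cwbounded h ->
  cmeasurable setT (inv_fourier h).
Proof.
move=> bh; have [rh jh] := bh.
rewrite (funext (fun x => inv_fourierE x bh)).
apply: (cmeasurableM (cmeasurable_cst _ _)).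
split => /=.
  by apply: measurable_funB; [exact: measurable_cosT|exact: measurable_sinT].
by apply: measurable_funD; [exact: measurable_cosT|exact: measurable_sinT].
Qed.

Lemma inv_fourier_energy h x : cwbounded h -> normc (inv_fourier h x) ^+ 2 <=
  2 * (energyT (fun xi => Re (h xi)) x + energyT (fun xi => Im (h xi)) x).
Proof.
move=> bh; rewrite inv_fourierE// normcM exprMn normc_real.
have c1 : `|((2 * pi) ^+ d)^-1| ^+ 2 <= 1 :> R.
  have p2 : 1 <= 2 * pi :> R.
    by have := @pi_ge2 R; lra.
  rewrite expr_le1//.
  rewrite ger0_norm ?invr_ge0 ?exprn_ge0 ?(le_trans ler01)//.
  by rewrite invf_le1 ?exprn_ege1// exprn_gt0// (lt_le_trans ltr01).
rewrite -[leRHS]mul1r ler_pM ?sqr_ge0//.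
rewrite normc_sqr /= /energyT.
set a := cosT _ _; set b := sinT _ _; set c := cosT _ _; set e := sinT _ _.
have := sqr_ge0 (a + b); have := sqr_ge0 (c - e); nra.
Qed.

Lemma fourier_schwartz_decay f : schwartz f ->
  exists K : R, forall xi, normc (fourier f xi) <= K * weight xi ^+ 2.
Proof.
move=> sf; have bf := schwartz_cwbounded sf; case: sf => rf jf.
have [K1 H1] := energyT_decay rf; have [K2 H2] := energyT_decay jf.
exists (Num.sqrt (2 * (`|K1| + `|K2|))) => xi.
have w0 := weight_gt0 xi.
have B0 : 0 <= Num.sqrt (2 * (`|K1| + `|K2|)) * weight xi ^+ 2.
  by rewrite mulr_ge0 ?sqrtr_ge0 ?exprn_ge0// ltW.
rewrite -ler_sqr ?nnegrE ?normc_ge0//.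
have X0 : 0 <= 2 * (`|K1| + `|K2|) by rewrite mulr_ge0 ?addr_ge0.
rewrite exprMn (sqr_sqrtr X0) fourierE// normc_sqr /= -[_ ^+ 2 ^+ 2]exprM.
have h1 : energyT (fun x => Re (f x)) xi <= `|K1| * weight xi ^+ 4.
  by rewrite (le_trans (H1 xi))// ler_wpM2r ?ler_norm// exprn_ge0// ltW.
have h2 : energyT (fun x => Im (f x)) xi <= `|K2| * weight xi ^+ 4.
  by rewrite (le_trans (H2 xi))// ler_wpM2r ?ler_norm// exprn_ge0// ltW.
move: h1 h2; rewrite /energyT.
set a := cosT _ _; set b := sinT _ _; set c := sinT _ _; set e := cosT _ _.
set w := weight xi ^+ 4; set k1 := `|K1|; set k2 := `|K2| => h1 h2.
have := sqr_ge0 (a - c); have := sqr_ge0 (e + b); nra.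
Qed.

End fourier_parts.

(** * Fourier transform of an exponential weight *)

Section exponential_weight.
Context {R : realType}.
Local Notation leb := (@lebesgue_measure R).
Local Notation "'lebn' n" := (@lebesgue_rV R n) (at level 10).

Lemma measurable_continuous (f : R -> R) : continuous f -> measurable_fun setT f.
Proof. exact: continuous_measurable_fun. Qed.

Lemma continuous_expabs (a : R) : continuous (fun y : R => expR (- (a * `|y|))).
Proof.
move=> y; apply: (cvg_comp _ expR _ (@continuous_expR R _)).
by apply: cvgN; apply: cvgM; [exact: cvg_cst|exact: norm_continuous].
Qed.

Lemma continuous_cosM (z : R) : continuous (fun y : R => cos (y * z)).
Proof.
move=> y; apply: (cvg_comp _ cos _ (@continuous_cos R _)).
by apply: cvgM; [exact: cvg_id|exact: cvg_cst].
Qed.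

Lemma cvgy_expNM (a : R) : 0 < a -> expR (- (a * y)) @[y --> +oo] --> (0 : R).
Proof.
move=> a0; apply: (@cvg_comp _ _ _ (fun y => a * y) (fun y => expR (- y)) _
  (pinfty_nbhs R)); last exact: cvgr_expR.
by apply: gt0_cvgMry => //; exact: cvg_id.
Qed.

Lemma integral_expabs (a : R) : 0 < a ->
  (\int[leb]_y (expR (- (a * `|y|)))%:E = (2 / a)%:E)%E.
Proof.
move=> a0.
have dF (y : R) : is_derive y 1 (fun z : R => - (expR (- (a * z)) / a))
    (expR (- (a * y))).
  have h : is_derive y 1 (fun z : R => - (a * z)) (- a).
    by apply: is_derive_eq; rewrite /GRing.scale/=; ring.
  have h2 := @is_derive1_comp R expR (fun z => - (a * z)) y _ _
    (is_derive_expR _) h.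
  have h3 := is_deriveN (is_deriveM h2 (is_derive_cst (a^-1) y 1)).
  apply: is_derive_eq h3 _; rewrite /GRing.scale/= mulr0 add0r.
  by rewrite mulrN mulrN opprK mulrCA mulVf ?mulr1// gt_eqF.
have -> : 2 / a = 2 * (0 - - (expR (- (a * 0)) / a)).
  by rewrite mulr0 oppr0 expR0 sub0r opprK mul1r.
apply: (@integral_even_FTC R (fun y => expR (- (a * `|y|)))
  (fun z => - (expR (- (a * z)) / a)) 0).
- by move=> y; exact: expR_ge0.
- exact: continuous_expabs.
- by move=> y; rewrite normrN.
- by move=> y y0; rewrite gtr0_norm//; exact: dF.
- apply: cvg_at_right_filter.
  by case: (dF 0) => /derivable1_diffP/differentiable_continuous.
- rewrite -oppr0 -(mul0r a^-1); apply: cvgN.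
  by apply: cvgM; [exact: cvgy_expNM|exact: cvg_cst].
Qed.

Lemma integrable_expabs (a : R) : 0 < a ->
  leb.-integrable setT (EFin \o (fun y : R => expR (- (a * `|y|)))).
Proof.
move=> a0; apply/integrableP; split.
  apply/measurable_EFinP; apply: measurable_continuous.
  exact: continuous_expabs.
apply: (@le_lt_trans _ _ (2 / a)%:E); last exact: ltry.
rewrite -(integral_expabs a0) le_eqVlt; apply/orP; left; apply/eqP.
by apply: eq_integral => y _; rewrite /= gtr0_norm// expR_gt0.
Qed.

Lemma integrable_expabsM (a : R) (g : R -> R) : 0 < a -> continuous g ->
  (forall y, `|g y| <= 1) ->
  leb.-integrable setT (EFin \o (fun y : R => expR (- (a * `|y|)) * g y)).
Proof.
move=> a0 cg g1; apply: (le_integrable _ _ _ (integrable_expabs a0)) => //.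
  apply/measurable_EFinP; apply: measurable_funM.
    by apply: measurable_continuous; exact: continuous_expabs.
  exact: measurable_continuous.
by move=> y _ /=; rewrite lee_fin normrM -[leRHS]mulr1 ler_wpM2l.
Qed.

(** Adding [1] to the cosine makes the integrand nonnegative, so that the
    fundamental theorem applies up to infinity. *)
Lemma integral_expabs_cos (a z : R) : 0 < a ->
  \int[leb]_y (expR (- (a * `|y|)) * cos (y * z)) = 2 * a / (a ^+ 2 + z ^+ 2).
Proof.
move=> a0; have D0 : 0 < a ^+ 2 + z ^+ 2.
  by rewrite ltr_pwDl ?sqr_ge0// exprn_gt0.
pose F (y : R) := expR (- (a * y)) *
  ((z * sin (y * z) - a * cos (y * z)) / (a ^+ 2 + z ^+ 2) - a^-1).
have dF (y : R) : is_derive y 1 F (expR (- (a * y)) * (1 + cos (y * z))).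
  have h : is_derive y 1 (fun y : R => - (a * y)) (- a).
    by apply: is_derive_eq; rewrite /GRing.scale/=; ring.
  have h2 := @is_derive1_comp R expR (fun z => - (a * z)) y _ _
    (is_derive_expR _) h.
  have k : is_derive y 1 (fun y : R => y * z) z.
    by apply: is_derive_eq; rewrite /GRing.scale/=; ring.
  have ks := @is_derive1_comp R sin (fun y => y * z) y _ _ (is_derive_sin _) k.
  have kc := @is_derive1_comp R cos (fun y => y * z) y _ _ (is_derive_cos _) k.
  have h3 := is_deriveM h2 (is_deriveB (is_deriveM (is_deriveB
    (is_deriveM (is_derive_cst z y 1) ks) (is_deriveM (is_derive_cst a y 1) kc))
    (is_derive_cst ((a ^+ 2 + z ^+ 2)^-1) y 1)) (is_derive_cst (a^-1) y 1)).
  apply: is_derive_eq h3 _; rewrite /GRing.scale/= !fctE/=.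
  by field; rewrite !gt_eqF.
have I : (\int[leb]_y (expR (- (a * `|y|)) * (1 + cos (y * z)))%:E =
    (2 * (0 - F 0))%:E)%E.
  apply: (@integral_even_FTC R (fun y => expR (- (a * `|y|)) * (1 + cos (y * z)))
    F 0).
  - move=> t; apply: mulr_ge0; first exact: expR_ge0.
    by have := cos_max (t * z); rewrite ler_norml => /andP[]; lra.
  - move=> y; apply: cvgM; first exact: continuous_expabs.
    by apply: cvgD; [exact: cvg_cst|exact: continuous_cosM].
  - by move=> y; rewrite normrN mulNr cosN.
  - by move=> y y0; rewrite gtr0_norm//; exact: dF.
  - apply: cvg_at_right_filter.
    by case: (dF 0) => /derivable1_diffP/differentiable_continuous.
  - pose C := (`|z| + a) / (a ^+ 2 + z ^+ 2) + a^-1.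
    apply: (@squeeze_cvgr _ _ _ _ (fun y => - (expR (- (a * y)) * C))
      (fun y => expR (- (a * y)) * C)).
    + apply: nearW => y; rewrite -ler_norml /F normrM gtr0_norm ?expR_gt0//.
      rewrite ler_wpM2l ?expR_ge0// (le_trans (ler_normB _ _))//.
      rewrite (gtr0_norm (x := a^-1)) ?invr_gt0// /C lerD2r normrM.
      rewrite (gtr0_norm (x := (_ + _)^-1)) ?invr_gt0//.
      rewrite ler_wpM2r ?invr_ge0 ?(ltW D0)//.
      rewrite (le_trans (ler_normB _ _))// !normrM (gtr0_norm a0).
      by apply: lerD; rewrite ler_piMr ?normr_ge0 ?sin_max ?cos_max// ltW.
    + rewrite -oppr0 -(mul0r C); apply: cvgN.
      by apply: cvgM; [exact: cvgy_expNM|exact: cvg_cst].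
    + rewrite -(mul0r C).
      by apply: cvgM; [exact: cvgy_expNM|exact: cvg_cst].
have i1 := integrable_expabs a0.
have i2 := integrable_expabsM a0 (@continuous_cosM z) (fun y => cos_max _).
have : \int[leb]_y (expR (- (a * `|y|)) + expR (- (a * `|y|)) * cos (y * z)) =
    2 * (0 - F 0).
  rewrite /Rintegral -[RHS]/(fine (2 * (0 - F 0))%:E) -I; congr fine.
  by apply: eq_integral => y _; rewrite mulrDr mulr1.
rewrite RintegralD//.
rewrite {1}/Rintegral integral_expabs//= => /eqP.
move=> /eqP h.
have : \int[leb]_y (expR (- (a * `|y|)) * cos (y * z)) = 2 * (0 - F 0) - 2 / a.
  by rewrite -h addrC addKr.
move=> ->; rewrite /F mulr0 oppr0 expR0 mul0r sin0 cos0.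
by field; rewrite !gt_eqF.
Qed.

Lemma integral_expabs_sin (a z : R) : 0 < a ->
  \int[leb]_y (expR (- (a * `|y|)) * sin (y * z)) = 0.
Proof.
move=> a0; set I := (X in X = _).
have cs : continuous (fun y : R => sin (y * z)).
  move=> y; apply: (cvg_comp _ sin _ (@continuous_sin R _)).
  by apply: cvgM; [exact: cvg_id|exact: cvg_cst].
have i := integrable_expabsM a0 cs (fun y => sin_max _).
suff : I = - I by move=> /eqP; rewrite -addr_eq0 -mulr2n mulrn_eq0 => /eqP.
rewrite -mulN1r /I -RintegralZl//.
have mf := measurable_int _ i.
rewrite {1}/Rintegral -(lebesgue_integral_opp mf) /Rintegral; congr fine.
by apply: eq_integral => y _ /=; rewrite normrN mulNr sinN mulrN mulN1r.
Qed.

(** The Fourier transform of [expw a] is [cauchyw a], whose integral does not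
    depend on [a]. *)
Definition expw n (a : R) (x : 'rV[R]_n) := \prod_(j < n) expR (- (a * `|x ord0 j|)).

Definition cauchyw n (a : R) (x : 'rV[R]_n) :=
  \prod_(j < n) (2 * a / (a ^+ 2 + x ord0 j ^+ 2)).

Lemma expw_gt0 n a (x : 'rV[R]_n) : 0 < expw a x.
Proof. by apply: prodr_gt0 => j _; exact: expR_gt0. Qed.

Lemma measurable_expw n a : measurable_fun setT (@expw n a).
Proof.
apply: measurable_prod => j _.
exact: measurableT_comp (measurable_continuous (@continuous_expabs a))
  (measurable_coord j).
Qed.

Lemma integrable_expw n a : 0 < a -> (lebn n).-integrable setT (EFin \o @expw n a).
Proof.
move=> a0; apply/integrableP; split.
  by apply/measurable_EFinP; exact: measurable_expw.
apply: (@le_lt_trans _ _ ((2 / a) ^+ n)%:E); last exact: ltry.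
rewrite -(@ge0_integral_prod R n _ _ _ _ (integral_expabs a0)).
- rewrite le_eqVlt; apply/orP; left; apply/eqP; apply: eq_integral => x _.
  by rewrite /= gtr0_norm// expw_gt0.
- exact: measurable_continuous (@continuous_expabs a).
- by move=> y; exact: expR_ge0.
Qed.

Lemma integrable_expwM n a (g : 'rV[R]_n -> R) : 0 < a -> measurable_fun setT g ->
  (forall y, `|g y| <= 1) ->
  (lebn n).-integrable setT (EFin \o (fun x => expw a x * g x)).
Proof.
move=> a0 mg g1; apply: (le_integrable _ _ _ (integrable_expw n a0)) => //.
  apply/measurable_EFinP; apply: measurable_funM => //; exact: measurable_expw.
by move=> y _ /=; rewrite lee_fin normrM -[leRHS]mulr1 ler_wpM2l.
Qed.

Lemma Rintegral_rVS n (f : 'rV[R]_n.+1 -> R) :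
  (lebn n.+1).-integrable setT (EFin \o f) ->
  (forall a, (lebn n).-integrable setT (fun v => (f (cons_rV (a, v)))%:E)) ->
  \int[lebn n.+1]_x f x = \int[leb]_a \int[lebn n]_v f (cons_rV (a, v)).
Proof.
move=> fi fi2; rewrite /Rintegral; congr fine.
rewrite (integral_rVS (measurable_int _ fi) fi).
apply: eq_integral => a _; rewrite fineK//.
exact: (integrable_fin_num measurableT (fi2 a)).
Qed.

Lemma expwS n a b (v : 'rV[R]_n) :
  expw a (cons_rV (b, v)) = expR (- (a * `|b|)) * expw a v.
Proof.
rewrite /expw big_ord_recl cons_rV0; congr (_ * _).
by apply: eq_bigr => j _; rewrite cons_rV_lift.
Qed.

Definition tail_rV n (z : 'rV[R]_n.+1) : 'rV[R]_n := \row_j z ord0 (lift ord0 j).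

Lemma edotS n b (v : 'rV[R]_n) z :
  edot (cons_rV (b, v)) z = b * z ord0 ord0 + edot v (tail_rV z).
Proof.
rewrite /edot big_ord_recl cons_rV0; congr (_ + _).
by apply: eq_bigr => j _; rewrite cons_rV_lift mxE.
Qed.

Lemma integral_expw n a (z : 'rV[R]_n) : 0 < a ->
  \int[lebn n]_x (expw a x * cos (edot x z)) = cauchyw a z /\
  \int[lebn n]_x (expw a x * sin (edot x z)) = 0.
Proof.
move=> a0; have iwc m (y : 'rV[R]_m) :=
  integrable_expwM a0 (measurable_cos_edot y) (fun=> cos_max _).
have iws m (y : 'rV[R]_m) :=
  integrable_expwM a0 (measurable_sin_edot y) (fun=> sin_max _).
elim: n z => [z|n IH z].
  rewrite /Rintegral !integral_rV0; [|exact: measurable_int (iws _ _)|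
    exact: measurable_int (iwc _ _)].
  by rewrite /expw /cauchyw /edot /= !big_ord0 cos0 sin0 mulr1 mulr0.
have [IHc IHs] := IH (tail_rV z).
have ic2 c := integrableZl measurableT c (iwc _ (tail_rV z)).
have is2 c := integrableZl measurableT c (iws _ (tail_rV z)).
split.
  have E b v : expw a (cons_rV (b, v)) * cos (edot (cons_rV (b, v)) z) =
    expR (- (a * `|b|)) * cos (b * z ord0 ord0) *
      (expw a v * cos (edot v (tail_rV z))) -
    expR (- (a * `|b|)) * sin (b * z ord0 ord0) *
      (expw a v * sin (edot v (tail_rV z))).
    by rewrite expwS edotS cosD; ring.
  rewrite Rintegral_rVS//; last first.
    move=> b; under eq_fun do rewrite E.
    exact: (integrableB measurableT (ic2 _) (is2 _)).
  rewrite /cauchyw big_ord_recl -(integral_expabs_cos (z ord0 ord0) a0).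
  have -> : \prod_(i < n) (2 * a / (a ^+ 2 + z ord0 (lift ord0 i) ^+ 2)) =
      cauchyw a (tail_rV z).
    by apply: eq_bigr => j _; rewrite mxE.
  rewrite -RintegralZr//; last first.
    exact: integrable_expabsM a0 (@continuous_cosM _) (fun=> cos_max _).
  apply: eq_Rintegral => b _; under eq_Rintegral do rewrite E.
  rewrite RintegralB//; [|exact: ic2|exact: is2].
  by rewrite !RintegralZl// IHc IHs mulr0 subr0.
have E b v : expw a (cons_rV (b, v)) * sin (edot (cons_rV (b, v)) z) =
  expR (- (a * `|b|)) * sin (b * z ord0 ord0) *
    (expw a v * cos (edot v (tail_rV z))) +
  expR (- (a * `|b|)) * cos (b * z ord0 ord0) *
    (expw a v * sin (edot v (tail_rV z))).
  by rewrite expwS edotS sinD; ring.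
rewrite Rintegral_rVS//; last first.
  move=> b; under eq_fun do rewrite E.
  exact: (integrableD measurableT (ic2 _) (is2 _)).
rewrite -[RHS](mul0r (cauchyw a (tail_rV z))) -(integral_expabs_sin (z ord0 ord0) a0).
rewrite -RintegralZr//; last first.
  apply: integrable_expabsM => // [y|y]; last exact: sin_max.
  apply: (cvg_comp _ sin _ (@continuous_sin R _)).
  by apply: cvgM; [exact: cvg_id|exact: cvg_cst].
apply: eq_Rintegral => b _; under eq_Rintegral do rewrite E.
rewrite RintegralD//; [|exact: ic2|exact: is2].
by rewrite !RintegralZl// IHc IHs mulr0 addr0.
Qed.

End exponential_weight.

(** * The Fourier transform is bounded on L^2 *)

(** The product of two sigma-finite measures under a name of its own, so that
    its sigma-finiteness is found by inference. *)
Section sigma_finite_product.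
Context {R : realType} d1 d2 (T1 : measurableType d1) (T2 : measurableType d2).
Variables (m1 : {sigma_finite_measure set T1 -> \bar R})
  (m2 : {sigma_finite_measure set T2 -> \bar R}).

Definition sf_product : set (T1 * T2) -> \bar R := (m1 \x m2)%E.

HB.instance Definition _ := Measure.on sf_product.

Let sf_product_sigma_finite : sigma_finite setT sf_product.
Proof.
have /sigma_finiteP[F [TF ndF Foo]] := sigma_finiteT m1.
have /sigma_finiteP[G [TG ndG Goo]] := sigma_finiteT m2.
exists (fun k => F k `*` G k).
  apply/seteqP; split=> // -[x y] _.
  have [i _ Fx] : (\bigcup_i F i) x by rewrite -TF.
  have [j _ Gy] : (\bigcup_i G i) y by rewrite -TG.
  exists (maxn i j) => //; split.
    by move: x Fx; exact/subsetPset/ndF/leq_maxl.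
  by move: y Gy; exact/subsetPset/ndG/leq_maxr.
move=> k; have [mF Fk] := Foo k; have [mG Gk] := Goo k.
split; first exact: measurableX.
by rewrite /sf_product product_measure1E// lte_mul_pinfty// ge0_fin_numE.
Qed.

HB.instance Definition _ := Measure_isSigmaFinite.Build _ _ _ sf_product
  sf_product_sigma_finite.

End sigma_finite_product.

Section L2_bound.
Context {R : realType} {n : nat}.
Local Notation lebn := (@lebesgue_rV R n).
Implicit Types (u : 'rV[R]_n -> R) (x xi : 'rV[R]_n).

Lemma cauchyw_ge0 a x : 0 < a -> 0 <= cauchyw a x.
Proof.
move=> a0; apply: prodr_ge0 => j _.
by rewrite mulr_ge0 ?invr_ge0 ?addr_ge0 ?sqr_ge0// mulr_ge0// ltW.
Qed.

Lemma measurable_cauchy1 (a : R) : 0 < a ->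
  measurable_fun setT (fun y : R => 2 * a / (a ^+ 2 + y ^+ 2)).
Proof.
move=> a0; apply: continuous_measurable_fun => y; apply: cvgM; first exact: cvg_cst.
apply: cvgV; first by rewrite gt_eqF// ltr_pwDl ?sqr_ge0// exprn_gt0.
by apply: cvgD; [exact: cvg_cst|exact: exprn_continuous].
Qed.

Lemma measurable_cauchyw a : 0 < a -> measurable_fun setT (@cauchyw R n a).
Proof.
move=> a0; apply: measurable_prod => j _.
exact: measurableT_comp (measurable_cauchy1 a0) (measurable_coord j).
Qed.

Lemma integral_cauchyw a : 0 < a ->
  (\int[lebn]_x (cauchyw a x)%:E = ((2 * pi) ^+ n)%:E)%E.
Proof.
move=> a0.
apply: (@ge0_integral_prod R n (fun y => 2 * a / (a ^+ 2 + y ^+ 2)) (2 * pi)).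
  exact: measurable_cauchy1.
  by move=> y; rewrite mulr_ge0 ?invr_ge0 ?addr_ge0 ?sqr_ge0// mulr_ge0// ltW.
exact: integral_cauchy.
Qed.

Lemma integral_cauchyw_shift a x : 0 < a ->
  (\int[lebn]_y (cauchyw a (y - x))%:E = ((2 * pi) ^+ n)%:E)%E.
Proof.
move=> a0; rewrite -(integral_cauchyw a0).
have := @integral_rVD R n (- x) (EFin \o cauchyw a); apply.
by apply/measurable_EFinP; exact: measurable_cauchyw.
Qed.

Lemma cauchywB a x y : cauchyw a (x - y) = cauchyw a (y - x) :> R.
Proof. by apply: eq_bigr => j _; rewrite !mxE -[in RHS]opprB sqrrN. Qed.

Variables (u : 'rV[R]_n -> R) (a : R).
Hypotheses (bu : wbounded u) (a0 : 0 < a).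

Local Notation PP := (lebn \x lebn)%E.

Let G (p : 'rV[R]_n * 'rV[R]_n) := u p.1 * u p.2.

Let mu1 : measurable_fun setT (fun p : 'rV[R]_n * 'rV[R]_n => u p.1).
Proof. exact: measurableT_comp bu.1 measurable_fst. Qed.

Let mu2 : measurable_fun setT (fun p : 'rV[R]_n * 'rV[R]_n => u p.2).
Proof. exact: measurableT_comp bu.1 measurable_snd. Qed.

Let mG : measurable_fun setT G.
Proof. exact: measurable_funM. Qed.

Let iau : lebn.-integrable setT (EFin \o (fun x => `|u x|)).
Proof. by have := integrable_abse (wbounded_integrable bu). Qed.

Let iG : PP.-integrable setT (EFin \o G).
Proof.
apply: (@Rintegral_prod_bounded R _ _ _ _ lebn lebn G _ _ mG iau iau).
by move=> x y; rewrite normrM.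
Qed.

Let mcosB x : measurable_fun setT
  (fun p : 'rV[R]_n * 'rV[R]_n => cos (edot x (p.1 - p.2))).
Proof.
apply: measurableT_comp.
  by apply: continuous_measurable_fun; exact: continuous_cos.
apply: measurable_edot2 => //; apply: measurable_fun_rV => j.
under eq_fun do rewrite !mxE; apply: measurable_funB.
  exact: measurableT_comp (measurable_coord j) measurable_fst.
exact: measurableT_comp (measurable_coord j) measurable_snd.
Qed.

Let edotBr x xi y : edot x (xi - y) = edot xi x - edot y x.
Proof. by rewrite edotC -scaleN1r edotDl /edot -sumrN; congr (_ + _);
  apply: eq_bigr => j _; rewrite mxE mulN1r mulNr. Qed.

(** Multiplied out, the squares of the two transforms add up to the cosine of a
    difference. *)
Lemma energyT_double x :
  energyT u x = \int[PP]_p (cos (edot x (p.1 - p.2)) * G p).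
Proof.
have iF : PP.-integrable setT
    (EFin \o (fun p => cos (edot x (p.1 - p.2)) * G p)).
  apply: (le_integrable _ _ _ iG) => //.
    by apply/measurable_EFinP; exact: measurable_funM.
  by move=> p _ /=; rewrite lee_fin normrM -[leRHS]mul1r ler_wpM2r// cos_max.
rewrite /Rintegral -(integral12_prod_meas1 iF) /fubini_F/=.
have ic := wbounded_integrable (wbounded_cos x bu).
have iS := wbounded_integrable (wbounded_sin x bu).
have E xi : (\int[lebn]_y (cos (edot x (xi - y)) * G (xi, y))%:E =
  (cos (edot xi x) * u xi * cosT u x + sin (edot xi x) * u xi * sinT u x)%:E)%E.
  have i1 := integrableZl measurableT (cos (edot xi x) * u xi) ic.
  have i2 := integrableZl measurableT (sin (edot xi x) * u xi) iS.
  transitivity (\int[lebn]_y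
    ((cos (edot xi x) * u xi)%:E * (cos (edot y x) * u y)%:E +
     (sin (edot xi x) * u xi)%:E * (sin (edot y x) * u y)%:E))%E.
    apply: eq_integral => y _; rewrite -!EFinM -EFinD; congr EFin.
    by rewrite edotBr cosB /G /=; ring.
  rewrite integralD// !integralZl// EFinD !EFinM; congr (_ * _ + _ * _)%E.
    by rewrite fineK//; exact: (integrable_fin_num measurableT ic).
  by rewrite fineK//; exact: (integrable_fin_num measurableT iS).
under eq_integral do rewrite E.
have i1 := integrableZl measurableT (cosT u x) ic.
have i2 := integrableZl measurableT (sinT u x) iS.
rewrite -[fine _]/(\int[lebn]_xi (cos (edot xi x) * u xi * cosT u x +
  sin (edot xi x) * u xi * sinT u x)).
under eq_Rintegral do rewrite ![_ * cosT u x]mulrC ![_ * sinT u x]mulrC.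
rewrite RintegralD//.
by rewrite !RintegralZl.
Qed.

Lemma energyT_ge0 x : 0 <= energyT u x.
Proof. by rewrite addr_ge0 ?sqr_ge0. Qed.

Lemma measurable_energyT : measurable_fun setT (energyT u).
Proof.
by apply: measurable_funD; apply: measurable_funX;
  [exact: measurable_cosT|exact: measurable_sinT].
Qed.

(** The weight makes the integrand integrable in [x] as well, so that [x] can be
    integrated first. *)
Lemma weighted_energyT :
  \int[lebn]_x (expw a x * energyT u x) =
  \int[PP]_p (cauchyw a (p.1 - p.2) * G p).
Proof.
pose F (q : 'rV[R]_n * ('rV[R]_n * 'rV[R]_n)) :=
  expw a q.1 * cos (edot q.1 (q.2.1 - q.2.2)) * G q.2.
have mB : measurable_fun setT
    (fun q : 'rV[R]_n * ('rV[R]_n * 'rV[R]_n) => q.2.1 - q.2.2).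
  apply: measurable_fun_rV => j; under eq_fun do rewrite !mxE.
  apply: measurable_funB.
    apply: measurableT_comp (measurable_coord j) _.
    exact: measurableT_comp measurable_fst measurable_snd.
  apply: measurableT_comp (measurable_coord j) _.
  exact: measurableT_comp measurable_snd measurable_snd.
have mF : measurable_fun setT F.
  apply: measurable_funM; last exact: measurableT_comp mG measurable_snd.
  apply: measurable_funM.
    exact: measurableT_comp (@measurable_expw R n a) measurable_fst.
  apply: measurableT_comp; last exact: measurable_edot2.
  by apply: continuous_measurable_fun; exact: continuous_cos.
have iw := integrable_expw n a0.
have iaG : PP.-integrable setT (EFin \o (fun p => `|G p|)).
  by have := integrable_abse iG.
have bF x p : `|F (x, p)| <= expw a x * `|G p|.
  rewrite /F /= !normrM (gtr0_norm (expw_gt0 _ _)) -normrM ler_wpM2r//.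
  by rewrite ler_piMr ?cos_max// ltW// expw_gt0.
have iF := @Rintegral_prod_bounded R _ _ _ _ lebn (sf_product lebn lebn)
  F _ _ mF iw iaG bF.
have i2 x : PP.-integrable setT (fun p => (F (x, p))%:E).
  have := integrableZl measurableT (expw a x) iaG.
  apply: le_integrable => //.
    by apply/measurable_EFinP; exact: measurableT_comp mF (pair1_measurable x).
  by move=> p _ /=; rewrite lee_fin (le_trans (bF x p))// ler_norm.
have i1 p : lebn.-integrable setT (fun x => (F (x, p))%:E).
  have := integrableZl measurableT `|G p| iw.
  apply: le_integrable => //.
    by apply/measurable_EFinP; exact: measurableT_comp mF (pair2_measurable p).
  by move=> x _ /=; rewrite lee_fin (le_trans (bF x p))// mulrC ler_norm.
have := Rintegral_swap iF i2 i1.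
rewrite (_ : \int[lebn]_x _ = \int[lebn]_x (expw a x * energyT u x)).
  move=> ->; apply: eq_Rintegral => p _; rewrite /F /=.
  have [<- _] := integral_expw (p.1 - p.2) a0.
  rewrite -RintegralZr//; last first.
    exact: integrable_expwM a0 (measurable_cos_edot _) (fun=> cos_max _).
apply: eq_Rintegral => x _; rewrite energyT_double -RintegralZl//.
  by apply: eq_Rintegral => p _; rewrite /F /= mulrA.
apply: (le_integrable _ _ _ iG) => //.
  by apply/measurable_EFinP; exact: measurable_funM.
by move=> p _ /=; rewrite lee_fin normrM -[leRHS]mul1r ler_wpM2r// cos_max.
Qed.

End L2_bound.

Section L2_inequality.
Context {R : realType} {n : nat}.
Local Notation lebn := (@lebesgue_rV R n).
Local Notation PP := (lebn \x lebn)%E.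
Implicit Types (u : 'rV[R]_n -> R) (x xi : 'rV[R]_n).

Lemma wbounded_sqr_integrable u : wbounded u ->
  lebn.-integrable setT (EFin \o (fun x => u x ^+ 2)).
Proof.
move=> [mu [M uM]].
apply: (le_integrable _ _ _ (integrable_cweight (M ^+ 2))) => //.
  by apply/measurable_EFinP; exact: measurable_funX.
move=> x _ /=; rewrite lee_fin (le_trans _ (ler_norm _))// normrX.
have w0 := weight_gt0 x; have w1 := weight_le1 x.
apply: (@le_trans _ _ ((M * weight x) ^+ 2)).
  by rewrite ler_sqr ?nnegrE// (le_trans (normr_ge0 _) (uM x)).
by rewrite exprMn ler_wpM2l ?sqr_ge0// expr2 ler_piMr// ltW.
Qed.

Section fixed_exponent.
Variables (u : 'rV[R]_n -> R) (a : R).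
Hypotheses (bu : wbounded u) (a0 : 0 < a).

Let mB : measurable_fun setT (fun p : 'rV[R]_n * 'rV[R]_n => cauchyw a (p.1 - p.2)).
Proof.
apply: measurableT_comp (measurable_cauchyw a0) _.
apply: measurable_fun_rV => j; under eq_fun do rewrite !mxE.
apply: measurable_funB.
  exact: measurableT_comp (measurable_coord j) measurable_fst.
exact: measurableT_comp (measurable_coord j) measurable_snd.
Qed.

Let U := \int[lebn]_x (u x ^+ 2).

Let UE : (\int[lebn]_x ((2 * pi) ^+ n * u x ^+ 2)%:E = ((2 * pi) ^+ n * U)%:E)%E.
Proof.
have iu := wbounded_sqr_integrable bu.
under eq_integral do rewrite EFinM.
rewrite integralZl//.
rewrite EFinM; congr (_ * _)%E; rewrite fineK//.
exact: (integrable_fin_num measurableT iu).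
Qed.

Let schur1 : (\int[PP]_p (cauchyw a (p.1 - p.2) * u p.1 ^+ 2)%:E =
  ((2 * pi) ^+ n * U)%:E)%E.
Proof.
have m1 : measurable_fun setT
    (fun p : 'rV[R]_n * 'rV[R]_n => (cauchyw a (p.1 - p.2) * u p.1 ^+ 2)%:E).
  apply/measurable_EFinP; apply: measurable_funM => //; apply: measurable_funX.
  exact: measurableT_comp bu.1 measurable_fst.
rewrite fubini_tonelli1//; last first.
  by move=> p; rewrite lee_fin mulr_ge0 ?sqr_ge0 ?cauchyw_ge0.
rewrite -UE; apply: eq_integral => x _; rewrite /fubini_F/=.
under eq_integral do rewrite EFinM cauchywB.
rewrite ge0_integralZr//; last first.
- by rewrite lee_fin sqr_ge0.
- by move=> y _; rewrite lee_fin cauchyw_ge0.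
- apply/measurable_EFinP; apply: measurableT_comp (measurable_cauchyw a0) _.
  exact: measurable_rVD.
by rewrite integral_cauchyw_shift.
Qed.

Let schur2 : (\int[PP]_p (cauchyw a (p.1 - p.2) * u p.2 ^+ 2)%:E =
  ((2 * pi) ^+ n * U)%:E)%E.
Proof.
have m1 : measurable_fun setT
    (fun p : 'rV[R]_n * 'rV[R]_n => (cauchyw a (p.1 - p.2) * u p.2 ^+ 2)%:E).
  apply/measurable_EFinP; apply: measurable_funM => //; apply: measurable_funX.
  exact: measurableT_comp bu.1 measurable_snd.
rewrite fubini_tonelli2//; last first.
  by move=> p; rewrite lee_fin mulr_ge0 ?sqr_ge0 ?cauchyw_ge0.
rewrite -UE; apply: eq_integral => x _; rewrite /fubini_G/=.
under eq_integral do rewrite EFinM.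
rewrite ge0_integralZr//; last first.
- by rewrite lee_fin sqr_ge0.
- by move=> y _; rewrite lee_fin cauchyw_ge0.
- apply/measurable_EFinP; apply: measurableT_comp (measurable_cauchyw a0) _.
  exact: measurable_rVD.
by rewrite integral_cauchyw_shift.
Qed.

(** Schur's test: the kernel has the same integral in each variable. *)
Lemma weighted_energyT_le :
  \int[lebn]_x (expw a x * energyT u x) <= (2 * pi) ^+ n * U.
Proof.
pose S (p : 'rV[R]_n * 'rV[R]_n) :=
  cauchyw a (p.1 - p.2) * u p.1 ^+ 2 + cauchyw a (p.1 - p.2) * u p.2 ^+ 2.
have m1 : measurable_fun setT
    (fun p : 'rV[R]_n * 'rV[R]_n => cauchyw a (p.1 - p.2) * u p.1 ^+ 2).
  apply: measurable_funM => //; apply: measurable_funX.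
  exact: measurableT_comp bu.1 measurable_fst.
have m2 : measurable_fun setT
    (fun p : 'rV[R]_n * 'rV[R]_n => cauchyw a (p.1 - p.2) * u p.2 ^+ 2).
  apply: measurable_funM => //; apply: measurable_funX.
  exact: measurableT_comp bu.1 measurable_snd.
have c0 p (x : 'rV[R]_n) : 0 <= cauchyw a p * u x ^+ 2.
  by rewrite mulr_ge0 ?sqr_ge0 ?cauchyw_ge0.
have SE : (\int[PP]_p (S p)%:E = (2 * ((2 * pi) ^+ n * U))%:E)%E.
  under eq_integral do rewrite EFinD.
  rewrite ge0_integralD//.
  - by rewrite schur1 schur2 -EFinD; congr EFin; ring.
  - by move=> p _; rewrite lee_fin.
  - exact/measurable_EFinP.
  - by move=> p _; rewrite lee_fin.
  - exact/measurable_EFinP.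
have iS : PP.-integrable setT (EFin \o S).
  apply/integrableP; split; first by apply/measurable_EFinP; exact: measurable_funD.
  apply: (@le_lt_trans _ _ (2 * ((2 * pi) ^+ n * U))%:E); last exact: ltry.
  rewrite -SE le_eqVlt; apply/orP; left; apply/eqP.
  by apply: eq_integral => p _; rewrite /= ger0_norm// addr_ge0.
have iS2 : PP.-integrable setT (EFin \o (fun p => 2^-1 * S p)).
  by have := integrableZl measurableT (2^-1) iS.
have KG p : `|cauchyw a (p.1 - p.2) * (u p.1 * u p.2)| <= 2^-1 * S p.
  rewrite normrM ger0_norm ?cauchyw_ge0// /S -mulrDr mulrCA.
  rewrite ler_wpM2l ?cauchyw_ge0// ler_pdivlMl// normrM.
  rewrite -(real_normK (num_real (u p.1))) -(real_normK (num_real (u p.2))).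
  by have := sqr_ge0 (`|u p.1| - `|u p.2|); nra.
rewrite (weighted_energyT bu a0).
apply: (@le_trans _ _ (\int[PP]_p (2^-1 * S p))).
  apply: le_Rintegral => //; last by move=> p _; rewrite (le_trans (ler_norm _)).
  apply: (le_integrable _ _ _ iS2) => //.
    apply/measurable_EFinP; apply: measurable_funM => //; apply: measurable_funM.
      exact: measurableT_comp bu.1 measurable_fst.
    exact: measurableT_comp bu.1 measurable_snd.
  by move=> p _ /=; rewrite lee_fin (le_trans (KG p))// ler_norm.
by rewrite RintegralZl// {1}/Rintegral SE /= mulrA mulVf ?mul1r.
Qed.

End fixed_exponent.

(** The weights [expw a] increase to 1 as [a] decreases to 0. *)
Lemma energyT_L2 u : wbounded u -> (\int[lebn]_x (energyT u x)%:E <=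
  ((2 * pi) ^+ n * \int[lebn]_x (u x ^+ 2))%:E)%E.
Proof.
move=> bu; pose a (k : nat) : R := k.+1%:R^-1.
have a0 k : 0 < a k by rewrite invr_gt0.
have ac : a k @[k --> \oo] --> (0 : R) by exact: cvg_harmonic.
pose g (k : nat) x := (expw (a k) x * energyT u x)%:E.
have mg k : measurable_fun setT (g k).
  apply/measurable_EFinP; apply: measurable_funM; first exact: measurable_expw.
  exact: measurable_energyT.
have g0 k x : setT x -> (0 <= g k x)%E.
  by move=> _; rewrite lee_fin mulr_ge0 ?energyT_ge0// ltW// expw_gt0.
have gnd x : setT x -> {homo g^~ x : k m / (k <= m)%N >-> (k <= m)%E}.
  move=> _ k m km; rewrite lee_fin ler_wpM2r ?energyT_ge0//.
  apply: ler_prod => j _; rewrite expR_ge0/= ler_expR lerN2 ler_wpM2r//.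
  by rewrite /a lef_pV2 ?posrE// ler_nat.
have gcv x : g k x @[k --> \oo] --> (energyT u x)%:E.
  apply/fine_cvgP; split; first exact: nearW.
  rewrite -[X in _ --> X]mul1r; apply: cvgM; last exact: cvg_cst.
  have -> : 1 = \prod_(j < n) expR (- (0 * `|x ord0 j|)) :> R.
    by rewrite big1// => j _; rewrite mul0r oppr0 expR0.
  have H (l : seq 'I_n) (f : 'I_n -> nat -> R) (L : 'I_n -> R) :
      (forall j, f j k @[k --> \oo] --> L j) ->
      \prod_(j <- l) f j k @[k --> \oo] --> \prod_(j <- l) L j.
    move=> fL; elim: l => [|j l IH].
      by under eq_fun do rewrite big_nil; rewrite big_nil; exact: cvg_cst.
    under eq_fun do rewrite big_cons; rewrite big_cons.
    by apply: cvgM; [exact: fL|exact: IH].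
  apply: (H _ (fun j k => expR (- (a k * `|x ord0 j|)))
    (fun j => expR (- (0 * `|x ord0 j|)))) => j.
  apply: (cvg_comp _ expR _ (@continuous_expR R _)).
  by apply: cvgN; apply: cvgM; [exact: ac|exact: cvg_cst].
have := monotone_convergence lebn measurableT mg g0 gnd.
have -> : (\int[lebn]_x limn (g^~ x) = \int[lebn]_x (energyT u x)%:E)%E.
  by apply: eq_integral => x _; exact/cvg_lim/gcv.
move=> ->; apply: lime_le.
  apply: ereal_nondecreasing_is_cvgn => k m km.
  by apply: ge0_le_integral => // [x _|x _]; [exact: g0|exact: gnd].
apply: nearW => k.
have ig : lebn.-integrable setT (EFin \o (fun x => expw (a k) x * energyT u x)).
  have [K HK] := energyT_bounded bu.
  have := integrableZl measurableT K (@integrable_expw R n _ (a0 k)).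
  apply: le_integrable => //; first exact: (mg k).
  move=> x _ /=; rewrite lee_fin (le_trans _ (ler_norm _))//.
  rewrite ger0_norm ?mulr_ge0 ?energyT_ge0 ?(ltW (expw_gt0 _ _))//.
  by rewrite mulrC ler_wpM2r ?HK// ltW// expw_gt0.
have := weighted_energyT_le bu (a0 k).
rewrite -lee_fin; apply: le_trans.
by rewrite /Rintegral fineK//; exact: (integrable_fin_num measurableT ig).
Qed.

(** Plancherel's inequality for the real and for the imaginary part; the factor
    2 comes from adding the two. *)
Lemma inv_fourier_L2 (h : 'rV[R]_n -> R[i]) : cwbounded h ->
  (\int[lebn]_x (normc (inv_fourier h x) ^+ 2)%:E <=
   (2 * (2 * pi) ^+ n * \int[lebn]_x (normc (h x) ^+ 2))%:E)%E.
Proof.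
move=> bh; have [br bi] := bh.
have mE1 := measurable_energyT br; have mE2 := measurable_energyT bi.
apply: (@le_trans _ _ (\int[lebn]_x (2%:E *
  ((energyT (fun xi => Re (h xi)) x)%:E + (energyT (fun xi => Im (h xi)) x)%:E)))%E).
  apply: ge0_le_integral => //.
  - by move=> x _; rewrite lee_fin sqr_ge0.
  - apply/measurable_EFinP; apply: measurable_funX; apply: cmeasurable_normc.
    exact: cmeasurable_inv_fourier.
  - by apply: emeasurable_funM => //; apply: emeasurable_funD; exact/measurable_EFinP.
  - by move=> x _; rewrite -EFinD -EFinM lee_fin; exact: inv_fourier_energy.
rewrite ge0_integralZl//; last 2 first.
- by apply: emeasurable_funD; exact/measurable_EFinP.
- by move=> x _; rewrite -EFinD lee_fin addr_ge0 ?energyT_ge0.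
rewrite ge0_integralD//; last 4 first.
- by move=> x _; rewrite lee_fin energyT_ge0.
- exact/measurable_EFinP.
- by move=> x _; rewrite lee_fin energyT_ge0.
- exact/measurable_EFinP.
rewrite -mulrA EFinM lee_wpmul2l//.
under eq_Rintegral do rewrite normc_sqr.
rewrite RintegralD//; [|exact: wbounded_sqr_integrable|exact: wbounded_sqr_integrable].
by rewrite mulrDr EFinD leeD//; exact: energyT_L2.
Qed.

End L2_inequality.

(** * Calculus of complex-valued functions of a real variable *)

Section cderive.
Context {R : realType}.
Implicit Types (f g : R -> R[i]) (x : R) (l m : R[i]).

Definition is_cderive f x l :=
  is_derive x 1 (fun y => Re (f y)) (Re l) /\
  is_derive x 1 (fun y => Im (f y)) (Im l).

Lemma is_derive_ext (f : R -> R) x (l m : R) :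
  is_derive x 1 f l -> l = m -> is_derive x 1 f m.
Proof. by move=> h <-. Qed.

Lemma is_cderive_ext f x l m : is_cderive f x l -> l = m -> is_cderive f x m.
Proof. by move=> h <-. Qed.

Lemma is_cderive_cst c x : is_cderive (fun=> c) x 0.
Proof. by split; exact: is_derive_cst. Qed.

Lemma is_cderive_real (u : R -> R) x (l : R) :
  is_derive x 1 u l -> is_cderive (fun y => (u y)%:C) x l%:C.
Proof. by move=> h; split => //=; exact: is_derive_cst. Qed.

Lemma is_cderiveD f g x l m : is_cderive f x l -> is_cderive g x m ->
  is_cderive (fun y => f y + g y) x (l + m).
Proof.
move=> [rf jf] [rg jg]; split.
  under eq_fun do rewrite ReD.
  by apply: is_derive_ext (is_deriveD rf rg) _; rewrite ReD.
under eq_fun do rewrite ImD.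
by apply: is_derive_ext (is_deriveD jf jg) _; rewrite ImD.
Qed.

Lemma is_cderiveM f g x l m : is_cderive f x l -> is_cderive g x m ->
  is_cderive (fun y => f y * g y) x (l * g x + f x * m).
Proof.
move=> [rf jf] [rg jg]; split.
  under eq_fun do rewrite ReM.
  apply: is_derive_ext (is_deriveB (is_deriveM rf rg) (is_deriveM jf jg)) _.
  by rewrite !cpartE /GRing.scale/=; ring.
under eq_fun do rewrite ImM.
apply: is_derive_ext (is_deriveD (is_deriveM rf jg) (is_deriveM jf rg)) _.
by rewrite !cpartE /GRing.scale/=; ring.
Qed.

Lemma is_cderiveZ c f x l : is_cderive f x l -> is_cderive (fun y => c * f y) x (c * l).
Proof.
move=> h; apply: is_cderive_ext (is_cderiveM (is_cderive_cst c x) h) _.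
by rewrite mul0r add0r.
Qed.

Lemma is_cderiveN f x l : is_cderive f x l -> is_cderive (fun y => - f y) x (- l).
Proof.
move=> h; under eq_fun do rewrite -mulN1r.
by rewrite -[- l]mulN1r; exact: is_cderiveZ.
Qed.

Lemma is_cderive_cexp f x l : is_cderive f x l ->
  is_cderive (fun y => cexp (f y)) x (l * cexp (f x)).
Proof.
move=> [rf jf].
have he := @is_derive1_comp R expR (fun y => Re (f y)) x _ _ (is_derive_expR _) rf.
have hc := @is_derive1_comp R cos (fun y => Im (f y)) x _ _ (is_derive_cos _) jf.
have hs := @is_derive1_comp R sin (fun y => Im (f y)) x _ _ (is_derive_sin _) jf.
split.
  under eq_fun do rewrite Re_cexp.
  apply: is_derive_ext (is_deriveM he hc) _.
  by rewrite ReM Re_cexp Im_cexp /GRing.scale/=; ring.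
under eq_fun do rewrite Im_cexp.
apply: is_derive_ext (is_deriveM he hs) _.
by rewrite ImM Re_cexp Im_cexp /GRing.scale/=; ring.
Qed.

Lemma Re_invc (z : R[i]) : Re z^-1 = Re z / (Re z ^+ 2 + Im z ^+ 2).
Proof. by case: z. Qed.

Lemma Im_invc (z : R[i]) : Im z^-1 = - Im z / (Re z ^+ 2 + Im z ^+ 2).
Proof. by case: z => a b; rewrite mulNr. Qed.

Lemma parts_neq0 (z : R[i]) : z != 0 -> Re z ^+ 2 + Im z ^+ 2 != 0.
Proof.
rewrite -normc_sqr expf_eq0/=; apply: contra => /eqP h.
by apply/eqP; exact: eq0_normc.
Qed.

Lemma is_cderiveV f x l : f x != 0 -> is_cderive f x l ->
  is_cderive (fun y => (f y)^-1) x (- l / f x ^+ 2).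
Proof.
move=> f0 [rf jf]; have N0 := parts_neq0 f0.
have hn := is_deriveD (is_deriveM rf rf) (is_deriveM jf jf).
have Ne : (fun y => Re (f y) ^+ 2 + Im (f y) ^+ 2) =
  ((fun y => Re (f y)) * (fun y => Re (f y)) +
   (fun y => Im (f y)) * (fun y => Im (f y)))%R by [].
rewrite -Ne in hn; have hv := is_deriveV (f := fun y => Re (f y) ^+ 2 + Im (f y) ^+ 2) N0 hn.
have E : Re (f x ^+ 2)^-1 = (Re (f x) ^+ 2 - Im (f x) ^+ 2) /
    (Re (f x) ^+ 2 + Im (f x) ^+ 2) ^+ 2 /\
    Im (f x ^+ 2)^-1 = - (Re (f x) * Im (f x) *+ 2) /
    (Re (f x) ^+ 2 + Im (f x) ^+ 2) ^+ 2.
  rewrite expr2 invfM ReM ImM Re_invc Im_invc; split; field; exact: N0.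
case: E => Er Ei; split.
  under eq_fun do rewrite Re_invc.
  apply: is_derive_ext (is_deriveM rf hv) _.
  by rewrite ReM ReN ImN Er Ei /GRing.scale/=; field.
under eq_fun do rewrite Im_invc.
apply: is_derive_ext (is_deriveM (is_deriveN jf) hv) _.
by rewrite ImM ReN ImN Er Ei !fctE /GRing.scale/=; field.
Qed.

Lemma is_derive0_cst (f : R -> R) (a b : R) :
  (forall x, a < x < b -> is_derive x 1 f 0) ->
  forall x y, a < x < b -> a < y < b -> f x = f y.
Proof.
move=> df.
have H x y : a < x < b -> a < y < b -> x < y -> f x = f y.
  move=> /andP[ax xb] /andP[ay yb] xy.
  have sub r : r \in `[x, y] -> a < r < b.
    rewrite in_itv/= => /andP[xr ry].
    by rewrite (lt_le_trans ax)//= (le_lt_trans ry).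
  have cf : {within `[x, y], continuous f}.
    by apply: derivable_within_continuous => r /sub /df [].
  have [r _] := @MVT _ f (fun=> 0) _ _ xy (fun r h => df r (sub r (subset_itv_oo_cc h))) cf.
  by rewrite mul0r => /eqP; rewrite subr_eq0 => /eqP.
move=> x y hx hy; have [xy|yx|->//] := ltgtP x y; first exact: H.
by apply/esym/H.
Qed.

Lemma is_cderive0_cst f (a b : R) :
  (forall x, a < x < b -> is_cderive f x 0) ->
  forall x y, a < x < b -> a < y < b -> f x = f y.
Proof.
move=> df x y hx hy; apply: complex_ext.
  exact: (@is_derive0_cst (fun r => Re (f r)) a b (fun r h => (df r h).1)).
exact: (@is_derive0_cst (fun r => Im (f r)) a b (fun r h => (df r h).2)).
Qed.

Section under_integral.
Context d (Y : measurableType d) (mu : {measure set Y -> \bar R}).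

Lemma is_derive_under_integral (f f' : R -> Y -> R) (G : Y -> R) (a u v : R) :
  u < a < v ->
  (forall x, u < x < v -> mu.-integrable setT (EFin \o f x)) ->
  (forall x y, u < x < v -> is_derive x 1 (f ^~ y) (f' x y)) ->
  mu.-integrable setT (EFin \o G) ->
  (forall x y, u < x < v -> `|f' x y| <= G y) ->
  is_derive a 1 (fun x => \int[mu]_y f x y) (\int[mu]_y f' a y).
Proof.
move=> auv intf df intG bG.
have d1 x y : u < x < v -> partial1of2 f x y = f' x y.
  by move=> xuv; rewrite partial1of2E; case: (df x y xuv).
have Iuv x : `]u, v[%classic x -> u < x < v by rewrite /= in_itv.
have Ia : `]u, v[%classic a by rewrite /= in_itv.
have G0 y : 0 <= G y := le_trans (normr_ge0 _) (bG a y auv).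
have h1 x : `]u, v[%classic x -> mu.-integrable setT (EFin \o f x).
  by move=> /Iuv; exact: intf.
have h2 x y : `]u, v[%classic x -> setT y -> derivable (f ^~ y) x 1.
  by move=> /Iuv xuv _; case: (df x y xuv).
have h3 x y : `]u, v[%classic x -> setT y -> `|partial1of2 f x y| <= G y.
  by move=> /Iuv xuv _; rewrite d1// bG.
apply: DeriveDef.
  exact: (derivable_under_integral measurableT Ia h1 h2 G0 intG h3).
rewrite -derive1E.
rewrite (differentiation_under_integral measurableT Ia h1 h2 G0 intG h3).
by apply: eq_Rintegral => y _; rewrite d1.
Qed.

Lemma is_cderive_under_integral (f f' : R -> Y -> R[i]) (G : Y -> R) (a u v : R) :
  u < a < v ->
  (forall x, u < x < v -> cintegrable mu setT (f x)) ->
  (forall x y, u < x < v -> is_cderive (f ^~ y) x (f' x y)) ->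
  mu.-integrable setT (EFin \o G) ->
  (forall x y, u < x < v -> normc (f' x y) <= G y) ->
  is_cderive (fun x => cintegral mu setT (f x)) a (cintegral mu setT (f' a)).
Proof.
move=> auv intf df intG bG; split.
  apply: (@is_derive_under_integral (fun x y => Re (f x y))
    (fun x y => Re (f' x y)) G a u v) => //.
  - by move=> x xuv; case: (intf x xuv).
  - by move=> x y xuv; case: (df x y xuv).
  - by move=> x y xuv; rewrite (le_trans (le_Re_normc _))// bG.
apply: (@is_derive_under_integral (fun x y => Im (f x y))
  (fun x y => Im (f' x y)) G a u v) => //.
- by move=> x xuv; case: (intf x xuv).
- by move=> x y xuv; case: (df x y xuv).
- by move=> x y xuv; rewrite (le_trans (le_Im_normc _))// bG.
Qed.

End under_integral.

End cderive.

(** * Rotating the ray of integration *)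

Section exponential_integrals.
Context {R : realType}.
Local Notation leb := (@lebesgue_measure R).

(** The integrand of [K] in the variable [y = ln s]. *)
Definition ee (u v a y : R) := expR (a * y - (u * expR (- y) + v * expR y)).

Lemma continuous_expRM (a : R) : continuous (fun y : R => expR (a * y)).
Proof.
move=> y; apply: (cvg_comp _ expR _ (@continuous_expR R _)).
by apply: cvgM; [exact: cvg_cst|exact: cvg_id].
Qed.

Lemma continuous_expRN : continuous (fun y : R => expR (- y)).
Proof.
move=> y; apply: (cvg_comp _ expR _ (@continuous_expR R _)).
by apply: cvgN; exact: cvg_id.
Qed.

Lemma continuous_ee u v a : continuous (ee u v a).
Proof.
move=> y; apply: (cvg_comp _ expR _ (@continuous_expR R _)).
apply: cvgB; first by apply: cvgM; [exact: cvg_cst|exact: cvg_id].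
apply: cvgD; apply: cvgM; [exact: cvg_cst|exact: continuous_expRN|
  exact: cvg_cst|exact: continuous_expR].
Qed.

Lemma ee_gt0 u v a y : 0 < ee u v a y. Proof. exact: expR_gt0. Qed.

Lemma eeN u v a y : ee u v a (- y) = ee v u (- a) y.
Proof. by rewrite /ee opprK mulrN mulNr (addrC (u * _)). Qed.

Lemma linear_le_exp (v N : R) : 0 < v -> 0 < N ->
  exists c, forall y, N * y - c <= v * expR y.
Proof.
move=> v0 N0; pose L := ln (N / v); exists (N * (L - 1)) => y.
have NL : N = v * expR L by rewrite lnK ?posrE ?divr_gt0// mulrCA divff ?mulr1// gt_eqF.
have := expR_ge1Dx (y - L) => h.
apply: (@le_trans _ _ (N * expR (y - L))).
  by rewrite -mulrBr ler_pM2l// (le_trans _ h)// opprB addrCA.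
by rewrite {1}NL -mulrA -expRD addrCA subrr addr0.
Qed.

Lemma ee_half_bound u v a : 0 <= u -> 0 <= v -> 0 < v \/ a < 0 ->
  exists2 b, 0 < b & exists c, forall y, 0 <= y -> ee u v a y <= expR (c - b * y).
Proof.
move=> u0 v0 [v1|a0].
  exists 1 => //; have N0 : 0 < `|a| + 1 by rewrite ltr_wpDl.
  have [c Hc] := linear_le_exp v1 N0; exists c => y y0.
  rewrite ler_expR; have := Hc y; have := ler_norm a.
  have : 0 <= u * expR (- y) by rewrite mulr_ge0// expR_ge0.
  nra.
exists (- a); first by rewrite oppr_gt0.
exists 0 => y y0; rewrite ler_expR mulNr opprK add0r gerBl.
by rewrite addr_ge0// mulr_ge0// expR_ge0.
Qed.

Lemma integrable_ee u v a : 0 <= u -> 0 <= v -> 0 < v \/ a < 0 ->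
  0 < u \/ 0 < a -> leb.-integrable setT (EFin \o ee u v a).
Proof.
move=> u0 v0 hv hu.
have [b1 b10 [c1 H1]] := ee_half_bound u0 v0 hv.
have hu' : 0 < u \/ - a < 0 by rewrite oppr_lt0.
have [b2 b20 [c2 H2]] := ee_half_bound v0 u0 hu'.
pose b := Num.min b1 b2; have b0 : 0 < b by rewrite lt_min b10.
pose C := expR c1 + expR c2.
have iC : leb.-integrable setT (EFin \o (fun y : R => C * expR (- (b * `|y|)))).
  by have := integrableZl measurableT C (integrable_expabs b0).
apply: (le_integrable _ _ _ iC) => //.
  by apply/measurable_EFinP; apply: measurable_continuous; exact: continuous_ee.
move=> y _ /=; rewrite lee_fin gtr0_norm ?ee_gt0// (le_trans _ (ler_norm _))//.
have e1 := expR_ge0 c1; have e2 := expR_ge0 c2.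
have [y0|y0] := leP 0 y.
  rewrite ger0_norm// (le_trans (H1 y y0))// expRD ler_pM ?expR_ge0//.
    by rewrite /C lerDl.
  by rewrite ler_expR lerN2 ler_wpM2r// ge_min lexx.
have yN : 0 <= - y by rewrite oppr_ge0 ltW.
rewrite ltr0_norm// -{1}(opprK y) eeN (le_trans (H2 _ yN))// expRD.
rewrite ler_pM ?expR_ge0//; first by rewrite /C lerDr.
by rewrite ler_expR lerN2 ler_wpM2r// ge_min lexx orbT.
Qed.

Lemma Rintegral_shift (u : R) (f : R -> R) : measurable_fun setT f ->
  \int[leb]_y f (y + u) = \int[leb]_y f y.
Proof.
move=> mf; rewrite /Rintegral; congr fine.
by rewrite -(@lebesgue_integral_shift R u (EFin \o f))//; exact/measurable_EFinP.
Qed.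

Lemma cintegral_shift (u : R) (f : R -> R[i]) : cmeasurable setT f ->
  cintegral leb setT (fun y => f (y + u)) = cintegral leb setT f.
Proof. by move=> [rf jf]; apply: complex_ext; exact: Rintegral_shift. Qed.

Lemma cintegral_opp (f : R -> R[i]) : cmeasurable setT f ->
  cintegral leb setT (fun y => f (- y)) = cintegral leb setT f.
Proof.
move=> [rf jf]; apply: complex_ext; rewrite /= /Rintegral; congr fine.
  by rewrite -(@lebesgue_integral_opp R (fun y => (Re (f y))%:E))//;
    exact/measurable_EFinP.
by rewrite -(@lebesgue_integral_opp R (fun y => (Im (f y))%:E))//;
  exact/measurable_EFinP.
Qed.

Lemma measurable_shift_fun (u : R) (f : R -> R[i]) : cmeasurable setT f ->
  cmeasurable setT (fun y : R => f (y + u)).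
Proof. by move=> mf; apply: (cmeasurable_comp mf); exact: measurable_shift. Qed.

Lemma is_cderive_cmeasurable (f f' : R -> R[i]) :
  (forall y, is_cderive f y (f' y)) -> cmeasurable setT f.
Proof.
move=> df; split; apply: measurable_continuous => y;
  apply/differentiable_continuous/derivable1_diffP.
  by case: (df y) => -[].
by case: (df y) => _ [].
Qed.

Lemma is_cderive_unique (f : R -> R[i]) x l m :
  is_cderive f x l -> is_cderive f x m -> l = m.
Proof.
move=> [[_ r1] [_ j1]] [[_ r2] [_ j2]]; apply: complex_ext.
  by rewrite -r1 r2.
by rewrite -j1 j2.
Qed.

Lemma cmeasurable_expRM (a : R) : cmeasurable setT (fun y : R => (expR (a * y))%:C).
Proof.
apply: cmeasurable_real; apply: measurable_continuous; exact: continuous_expRM.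
Qed.

(** The integral of [k (y + u) * e ^ (a y)] is [e ^ (- a u)] times that of
    [k y * e ^ (a y)]; the claim is the derivative of this identity at [0]. *)
Lemma cintegral_shift_derivative (k k' : R -> R[i]) (a : R) (G : R -> R) :
  (forall y, is_cderive k y (k' y)) -> cmeasurable setT k ->
  leb.-integrable setT (EFin \o G) ->
  (forall y u, -1 < u < 1 -> normc (k (y + u)) * expR (a * y) <= G y) ->
  (forall y u, -1 < u < 1 -> normc (k' (y + u)) * expR (a * y) <= G y) ->
  cintegral leb setT (fun y => k' y * (expR (a * y))%:C) =
  (- a)%:C * cintegral leb setT (fun y => k y * (expR (a * y))%:C).
Proof.
move=> dk mk iG bk bk'.
pose F (u : R) := cintegral leb setT (fun y => k (y + u) * (expR (a * y))%:C).
pose F0 := cintegral leb setT (fun y => k y * (expR (a * y))%:C).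
have nE (z : R[i]) y : normc (z * (expR (a * y))%:C) = normc z * expR (a * y).
  by rewrite normcM normc_real gtr0_norm ?expR_gt0.
have intk u : -1 < u < 1 ->
    cintegrable leb setT (fun y => k (y + u) * (expR (a * y))%:C).
  move=> u1; apply: (le_cintegrable measurableT _ iG).
    by apply: cmeasurableM; [exact: measurable_shift_fun|exact: cmeasurable_expRM].
  by move=> y _; rewrite nE bk.
have i0 : cintegrable leb setT (fun y => k y * (expR (a * y))%:C).
  have h1 : -1 < (0 : R) < 1 by rewrite ltrN10 ltr01.
  have := intk 0 h1.
  by under eq_fun do rewrite addr0.
have FE u : F u = (expR (- (a * u)))%:C * F0.
  rewrite -cintegralM//.
  rewrite -(@cintegral_shift u (fun y => (expR (- (a * u)))%:C *
    (k y * (expR (a * y))%:C))).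
    apply: eq_cintegral => y _; rewrite mulrCA; congr (_ * _).
    by rewrite -rmorphM/= -expRD; congr (expR _)%:C; ring.
  apply: cmeasurableM; first exact: cmeasurable_cst.
  by apply: cmeasurableM; [by []|exact: cmeasurable_expRM].
have d1 : is_cderive F 0 (cintegral leb setT
    (fun y => k' (y + 0) * (expR (a * y))%:C)).
  apply: (@is_cderive_under_integral R _ _ leb
    (fun u y => k (y + u) * (expR (a * y))%:C)
    (fun u y => k' (y + u) * (expR (a * y))%:C) G 0 (-1) 1) => //.
  - by rewrite ltrN10 ltr01.
  - move=> u y _; have := dk (y + u) => -[rk jk].
    have hs : is_derive u 1 (fun v : R => y + v) 1.
      by apply: is_derive_ext (is_deriveD (is_derive_cst y u 1) (is_derive_id u 1)) _;
        rewrite add0r.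
    have h : is_cderive (fun v => k (y + v)) u (k' (y + u)).
      split.
        have := @is_derive1_comp R (fun z => Re (k z)) (fun v => y + v) u _ _ rk hs.
        by rewrite mulr1.
      have := @is_derive1_comp R (fun z => Im (k z)) (fun v => y + v) u _ _ jk hs.
      by rewrite mulr1.
    apply: is_cderive_ext (is_cderiveM h (is_cderive_cst _ u)) _.
    by rewrite mulr0 addr0.
  - by move=> u y u1; rewrite nE bk'.
have d2 : is_cderive F 0 ((- a)%:C * F0).
  rewrite (funext FE).
  have h : is_derive (0 : R) 1 (fun u => - (a * u)) (- a).
    by apply: is_derive_eq; rewrite /GRing.scale/=; ring.
  have h2 := @is_derive1_comp R expR (fun u => - (a * u)) 0 _ _
    (is_derive_expR _) h.
  apply: is_cderive_ext (is_cderiveM (is_cderive_real h2) (is_cderive_cst F0 0)) _.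
  by rewrite !mulr0 addr0 oppr0 expR0 mul1r.
rewrite -(is_cderive_unique d1 d2).
by apply: eq_cintegral => y _; rewrite addr0.
Qed.

(** With [k th y = h (e ^ (y + i th))] for a holomorphic [h], the hypothesis on
    the derivatives is the Cauchy-Riemann equation, and the conclusion says that
    the integral of [h z * z ^ (a - 1)] is the same over all rays. *)
Lemma cintegral_rotation (k k' : R -> R -> R[i]) (a T : R) (G : R -> R) :
  (forall th y, - T < th < T -> is_cderive (k ^~ y) th ('i%C * k' th y)) ->
  (forall th y, - T < th < T -> is_cderive (k th) y (k' th y)) ->
  (forall th, - T < th < T -> cmeasurable setT (k th)) ->
  (forall th, - T < th < T -> cmeasurable setT (k' th)) ->
  leb.-integrable setT (EFin \o G) ->
  (forall th y u, - T < th < T -> -1 < u < 1 ->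
    normc (k th (y + u)) * expR (a * y) <= G y) ->
  (forall th y u, - T < th < T -> -1 < u < 1 ->
    normc (k' th (y + u)) * expR (a * y) <= G y) ->
  forall th, - T < th < T ->
  cintegral leb setT (fun y => k th y * (expR (a * y))%:C) =
  cexp ('i%C * (- (a * th))%:C) *
  cintegral leb setT (fun y => k 0 y * (expR (a * y))%:C).
Proof.
move=> dth dy mk mk' iG bk bk' th thT.
have h1 : -1 < (0 : R) < 1 by rewrite ltrN10 ltr01.
have T0 : 0 < T.
  by move: thT => /andP[h2 h3]; have := lt_trans h2 h3; lra.
pose Phi (r : R) := cintegral leb setT (fun y => k r y * (expR (a * y))%:C).
have nE (z : R[i]) y : normc (z * (expR (a * y))%:C) = normc z * expR (a * y).
  by rewrite normcM normc_real gtr0_norm ?expR_gt0.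
have dPhi r : - T < r < T -> is_cderive Phi r ('i%C * ((- a)%:C * Phi r)).
  move=> rT.
  rewrite -(@cintegral_shift_derivative (k r) (k' r) a G)//; last 4 first.
  - by move=> y; exact: dy.
  - exact: mk.
  - by move=> y u; exact: bk.
  - by move=> y u; exact: bk'.
  have ik x : - T < x < T ->
      cintegrable leb setT (fun y => k x y * (expR (a * y))%:C).
    move=> xT; apply: (le_cintegrable measurableT _ iG).
      by apply: cmeasurableM; [by apply: mk|exact: cmeasurable_expRM].
    by move=> y _; rewrite nE; have := bk x y 0 xT h1; rewrite addr0.
  have := @is_cderive_under_integral R _ _ leb
    (fun x y => k x y * (expR (a * y))%:C)
    (fun x y => 'i%C * k' x y * (expR (a * y))%:C) G r (- T) T rT ik.
  have h y x : - T < x < T -> is_cderive (fun x => k x y * (expR (a * y))%:C) x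
      ('i%C * k' x y * (expR (a * y))%:C).
    move=> xT.
    apply: is_cderive_ext (is_cderiveM (dth x y xT) (is_cderive_cst _ x)) _.
    by rewrite mulr0 addr0.
  move=> /(_ (fun x y => h y x) iG) h3.
  apply: is_cderive_ext (h3 _) _.
    move=> x y xT; rewrite nE normcM {1}/normc /= expr0n expr1n add0r sqrtr1 mul1r.
    by have := bk' x y 0 xT h1; rewrite addr0.
  rewrite -cintegralM//.
    by apply: eq_cintegral => y _; rewrite mulrA.
  apply: (le_cintegrable measurableT _ iG).
    by apply: cmeasurableM; [by apply: mk'|exact: cmeasurable_expRM].
  by move=> y _; rewrite nE; have := bk' r y 0 rT h1; rewrite addr0.
pose Q (r : R) := cexp ('i%C * (a * r)%:C) * Phi r.
have dQ r : - T < r < T -> is_cderive Q r 0.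
  move=> rT; have h : is_derive r 1 (fun r => a * r) a.
    by apply: is_derive_eq; rewrite /GRing.scale/=; ring.
  have h2 := is_cderive_cexp (is_cderiveZ 'i%C (is_cderive_real h)).
  apply: is_cderive_ext (is_cderiveM h2 (dPhi r rT)) _.
  by rewrite rmorphN; ring.
have T0' : - T < 0 < T by rewrite oppr_lt0 T0.
have Q0 : Q 0 = Phi 0 by rewrite /Q mulr0 rmorph0 mulr0 cexp0 mul1r.
rewrite -/(Phi 0) -Q0 -(is_cderive0_cst dQ thT T0') /Q.
by rewrite mulrA -cisD addNr rmorph0 mulr0 cexp0 mul1r.
Qed.

End exponential_integrals.

(** * The Gamma function *)

Section gamma.
Context {R : realType}.
Local Notation leb := (@lebesgue_measure R).

Lemma integral_exp_itv (G : R -> R) (a b : R) :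
  (forall x : R, 0 < x -> {for x, continuous G}) -> a <= b ->
  (\int[leb]_(x in `[expR a, expR b]) (G x)%:E =
   \int[leb]_(y in `[a, b]) (G (expR y) * expR y)%:E)%E.
Proof.
move=> cG ab.
have De : derive1 (expR : R -> R) = expR.
  by apply/funext => x; rewrite derive1E; case: (is_derive_expR x).
rewrite (@integration_by_substitution_increasing R expR G a b)// ?De//.
- by move=> x y _ _; rewrite ltr_expR.
- by move=> x _; exact: continuous_expR.
- by apply/cvg_ex; exists (expR a); apply: cvg_at_right_filter; exact: continuous_expR.
- by apply/cvg_ex; exists (expR b); apply: cvg_at_left_filter; exact: continuous_expR.
- split.
  + by move=> x _; exact: derivable_expR.
  + by apply: cvg_at_right_filter; exact: continuous_expR.
  + by apply: cvg_at_left_filter; exact: continuous_expR.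
- apply: continuous_in_subspaceT => x /set_mem /=; rewrite in_itv/= => /andP[h _].
  by apply: cG; rewrite (lt_le_trans (expR_gt0 _) h).
Qed.

Lemma integral_exp_line (G : R -> R) : (forall x : R, 0 < x -> {for x, continuous G}) ->
  (forall x, 0 < x -> 0 <= G x) ->
  (\int[leb]_(x in `]0%R, +oo[) (G x)%:E =
   \int[leb]_y (G (expR y) * expR y)%:E)%E.
Proof.
move=> cG G0.
pose A (n : nat) : set R := `[expR (- n%:R), expR n%:R]%classic.
pose B (n : nat) : set R := `[- n%:R, n%:R]%classic.
have UA : `]0, +oo[%classic = \bigcup_n A n.
  apply/seteqP; split => [x /=|x [n _] /=].
    rewrite in_itv/= andbT => x0.
    exists (Num.trunc `|ln x|).+1 => //; rewrite /A /= in_itv/=.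
    have := truncnS_gt `|ln x| => /ltW; rewrite ler_norml => /andP[h1 h2].
    by apply/andP; split; rewrite -ler_ln ?posrE ?expR_gt0// expRK.
  rewrite !in_itv/= andbT => /andP[h _].
  by rewrite (lt_le_trans (expR_gt0 _) h).
have UB : setT = \bigcup_n B n by rewrite /B (@bigcup_itvT R true false).
have mg (g : R -> R) (D : set R) : measurable D ->
    (forall x, D x -> {for x, continuous g}) -> measurable_fun D (EFin \o g).
  move=> mD cg; apply/measurable_EFinP.
  apply: subspace_continuous_measurable_fun => //.
  by apply: continuous_in_subspaceT => x /set_mem; exact: cg.
have cA : (\int[leb]_(x in A n) (G x)%:E @[n --> \oo] -->
    \int[leb]_(x in \bigcup_n A n) (G x)%:E)%E.
  apply: ge0_nondecreasing_set_cvg_integral => //.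
  - move=> n m nm; apply/subsetPset => x; rewrite /A /= !in_itv/= => /andP[h1 h2].
    rewrite (le_trans _ h1) ?ler_expR ?lerN2 ?ler_nat//=.
    by rewrite (le_trans h2)// ler_expR ler_nat.
  - by move=> n; exact: measurable_itv.
  - move=> n; apply: mg; first exact: measurable_itv.
    move=> x; rewrite /A /= in_itv/= => /andP[h _]; apply: cG.
    by rewrite (lt_le_trans (expR_gt0 _) h).
  - move=> n x; rewrite /A /= in_itv/= => /andP[h _]; rewrite lee_fin G0//.
    by rewrite (lt_le_trans (expR_gt0 _) h).
have cB : (\int[leb]_(y in B n) (G (expR y) * expR y)%:E @[n --> \oo] -->
    \int[leb]_(y in \bigcup_n B n) (G (expR y) * expR y)%:E)%E.
  apply: ge0_nondecreasing_set_cvg_integral => //.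
  - move=> n m nm; apply/subsetPset => x; rewrite /B /= !in_itv/= => /andP[h1 h2].
    rewrite (le_trans _ h1) ?lerN2 ?ler_nat//=.
    by rewrite (le_trans h2)// ler_nat.
  - by move=> n; exact: measurable_itv.
  - move=> n; apply: (mg (fun y => G (expR y) * expR y)); first exact: measurable_itv.
    move=> x _; apply: cvgM; last exact: continuous_expR.
    apply: (@continuous_comp _ _ _ expR G x); first exact: continuous_expR.
    by apply: cG; exact: expR_gt0.
  - by move=> n x _; rewrite lee_fin mulr_ge0 ?expR_ge0// G0// expR_gt0.
rewrite UA -(cvg_lim (@ereal_hausdorff R) cA) [in RHS]UB.
rewrite -(cvg_lim (@ereal_hausdorff R) cB); congr (limn _); apply/funext => n.
by rewrite /A /B integral_exp_itv// ge0_cp// lerN10.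
Qed.

(** Euler's integral after the substitution [u = e ^ y]. *)
Definition gammaE (a : R) := \int[leb]_y ee 0 1 a y.

Lemma ee01 a y : ee 0 1 a y = expR (a * y - expR y) :> R.
Proof. by rewrite /ee mul0r mul1r add0r. Qed.

Lemma continuous_powR (a x : R) : 0 < x -> {for x, continuous (fun z : R => z `^ a)}.
Proof.
move=> x0; apply/differentiable_continuous/derivable1_diffP.
by apply: derivable_powR; rewrite in_itv/= x0.
Qed.

Lemma Gamma_gammaE a : Gamma a = gammaE a.
Proof.
rewrite /Gamma /gammaE /Rintegral; congr fine.
rewrite (integral_exp_line (G := fun u => u `^ (a - 1) * expR (- u))).
- apply: eq_integral => y _; rewrite ee01 -expRM -!expRD; congr (expR _)%:E.
  by ring.
- move=> x x0; apply: cvgM; first exact: continuous_powR.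
  exact: continuous_expRN.
- by move=> x x0; rewrite mulr_ge0 ?powR_ge0 ?expR_ge0.
Qed.

(** The point of modulus [e ^ y] on the ray of argument [th]. *)
Definition ray (th y : R) : R[i] := cexp ('i%C * th%:C) * (expR y)%:C.

Lemma is_cderive_ray_th th y :
  is_cderive (ray ^~ y) th ('i%C * ray th y).
Proof.
have h := is_cderiveZ 'i%C (is_cderive_real (is_derive_id th 1)).
apply: is_cderive_ext (is_cderiveM (is_cderive_cexp h) (is_cderive_cst _ th)) _.
by rewrite mulr0 addr0 /ray mulr1 mulrA.
Qed.

Lemma is_cderive_ray_y th y : is_cderive (ray th) y (ray th y).
Proof.
exact: is_cderiveZ (is_cderive_real (is_derive_expR y)).
Qed.

Lemma Re_ray th y : Re (ray th y) = cos th * expR y.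
Proof. by rewrite /ray ReM Re_cis /= mulr0 subr0. Qed.

Lemma Im_ray th y : Im (ray th y) = sin th * expR y.
Proof. by rewrite /ray ImM Re_cis Im_cis /= mulr0 add0r. Qed.

Lemma normc_ray th y : normc (ray th y) = expR y.
Proof. by rewrite /ray normcM normc_cis mul1r normc_real gtr0_norm ?expR_gt0. Qed.

Lemma cmeasurable_ray th : cmeasurable setT (ray th).
Proof.
apply: cmeasurableM; first exact: cmeasurable_cst.
by apply: cmeasurable_real; apply: measurable_continuous; exact: continuous_expR.
Qed.

Lemma cos_le_abs (th T : R) : - T < th < T -> T <= pi -> cos T <= cos th.
Proof.
move=> /andP[h1 h2] Tpi; rewrite -(cos_norm th).
have a : `|th| < T by rewrite ltr_norml h1.
rewrite ltW// ltr_cos// in_itv/= ?normr_ge0/= ?(le_trans (ltW a))//.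
by rewrite (le_trans _ (ltW a)).
Qed.

Lemma expR_shift_ge (y u : R) : -1 < u < 1 -> expR (-1) * expR y <= expR (y + u).
Proof. by move=> /andP[h _]; rewrite -expRD ler_expR addrC lerD2l ltW. Qed.

Lemma expR_shift_le (y u : R) : -1 < u < 1 -> expR (y + u) <= expR 1 * expR y.
Proof. by move=> /andP[_ h]; rewrite -expRD ler_expR addrC lerD2r ltW. Qed.

(** The function [z |-> e ^ (- z)] on the ray of argument [th]. *)
Lemma gamma_rotation (a T : R) : 0 < a -> 0 < T < pi / 2 -> forall th, - T < th < T ->
  cintegral leb setT (fun y => cexp (- ray th y) * (expR (a * y))%:C) =
  cexp ('i%C * (- (a * th))%:C) * (gammaE a)%:C.
Proof.
move=> a0 /andP[T0 Tpi] th thT.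
have pipos := pi_gt0 R.
have Tp : T <= pi by lra.
pose c := cos T * expR (-1).
have cT : 0 < cos T by apply: cos_gt0_pihalf; lra.
have c0 : 0 < c by rewrite mulr_gt0 ?expR_gt0.
pose G y := ee 0 c a y + expR 1 * ee 0 c (a + 1) y.
have iG : leb.-integrable setT (EFin \o G).
  have i1 : leb.-integrable setT (EFin \o ee 0 c a).
    by apply: integrable_ee => //; [exact: ltW|left|right].
  have i2 : leb.-integrable setT (EFin \o ee 0 c (a + 1)).
    apply: integrable_ee => //; [exact: ltW|by left|right].
    by rewrite addr_gt0.
  exact: (integrableD measurableT i1 (integrableZl measurableT (expR 1) i2)).
have bk th' y u : - T < th' < T -> -1 < u < 1 ->
    normc (cexp (- ray th' (y + u))) <= expR (- (c * expR y)).
  move=> tT u1; rewrite normc_cexp ler_expR ReN Re_ray lerN2 /c -mulrA.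
  apply: ler_pM; [exact: ltW|by rewrite mulr_ge0 ?expR_ge0|exact: cos_le_abs|].
  exact: expR_shift_ge.
have eeE b y : expR (- (c * expR y)) * expR (b * y) = ee 0 c b y.
  by rewrite /ee mul0r add0r -expRD addrC.
have mk th' : cmeasurable setT (fun y => cexp (- ray th' y)).
  apply: cmeasurable_cexp; under eq_fun do rewrite -mulN1r.
  by apply: cmeasurableM; [exact: cmeasurable_cst|exact: cmeasurable_ray].
have := @cintegral_rotation R (fun th y => cexp (- ray th y))
  (fun th y => - ray th y * cexp (- ray th y)) a T G.
move=> /(_ _ _ _ _ iG _ _ th thT) -> //.
- congr (_ * _); apply: complex_ext.
    change (\int[leb]_y Re (cexp (- ray 0 y) * (expR (a * y))%:C) = gammaE a).
    apply: eq_Rintegral => y _; rewrite ReM Im_real mulr0 subr0 Re_cexp.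
    rewrite ImN Im_ray sin0 mul0r oppr0 cos0 mulr1 ReN Re_ray cos0 mul1r Re_real.
    by rewrite -expRD ee01 addrC.
  change (\int[leb]_y Im (cexp (- ray 0 y) * (expR (a * y))%:C) = 0).
  rewrite (_ : (fun y => _) = cst 0) ?Rintegral_cst ?mul0r//.
  apply/funext => y; rewrite ImM Im_cexp Im_real mulr0 add0r ImN Im_ray sin0.
  by rewrite mul0r oppr0 sin0 mulr0 mul0r.
- move=> th' y _; have h := is_cderive_cexp (is_cderiveN (is_cderive_ray_th th' y)).
  by apply: is_cderive_ext h _; ring.
- by move=> th' y _; exact: is_cderive_cexp (is_cderiveN (is_cderive_ray_y th' y)).
- move=> th' _; apply: cmeasurableM => //; under eq_fun do rewrite -mulN1r.
  by apply: cmeasurableM; [exact: cmeasurable_cst|exact: cmeasurable_ray].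
- move=> th' y u tT u1; rewrite /G -(eeE a).
  rewrite (@le_trans _ _ (expR (- (c * expR y)) * expR (a * y)))//.
    by rewrite ler_wpM2r ?expR_ge0// bk.
  by rewrite lerDl mulr_ge0 ?expR_ge0// ltW// ee_gt0.
- move=> th' y u tT u1; rewrite normcM normcN normc_ray.
  rewrite (@le_trans _ _ (expR 1 * ee 0 c (a + 1) y))//; last first.
    by rewrite /G lerDr ltW// ee_gt0.
  rewrite -eeE mulrDl mul1r [expR (a * y + y)]expRD.
  rewrite (_ : expR 1 * _ = (expR 1 * expR y) * expR (- (c * expR y)) * expR (a * y)); last by ring.
  rewrite ler_wpM2r ?expR_ge0//.
  by apply: ler_pM; rewrite ?expR_ge0 ?normc_ge0 ?expR_shift_le ?bk.
Qed.

End gamma.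

(** * Euler's reflection formula *)

Section reflection.
Context {R : realType}.
Local Notation leb := (@lebesgue_measure R).

Lemma integrable_gammaE (a : R) : 0 < a -> leb.-integrable setT (EFin \o ee 0 1 a).
Proof. by move=> a0; apply: integrable_ee => //; [left|right]. Qed.

Lemma integral_gammaE (a : R) : 0 < a ->
  (\int[leb]_y (ee 0 1 a y)%:E = (gammaE a)%:E)%E.
Proof.
move=> a0; rewrite /gammaE /Rintegral fineK//.
exact: (integrable_fin_num measurableT (integrable_gammaE a0)).
Qed.

(** Integration by parts, in the form of the derivative of the translations of
    [e ^ (a y - e ^ y)]. *)
Lemma gammaE_succ (a : R) : 0 < a -> gammaE (a + 1) = a * gammaE a.
Proof.
move=> a0; pose k (y : R) : R[i] := (expR (- expR y))%:C.
pose k' (y : R) : R[i] := (- (expR y * expR (- expR y)))%:C.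
pose c := expR (-1) : R.
have c0 : 0 < c by exact: expR_gt0.
pose G y := ee 0 c a y + expR 1 * ee 0 c (a + 1) y.
have iG : leb.-integrable setT (EFin \o G).
  have i1 : leb.-integrable setT (EFin \o ee 0 c a).
    by apply: integrable_ee => //; [exact: ltW|left|right].
  have i2 : leb.-integrable setT (EFin \o ee 0 c (a + 1)).
    apply: integrable_ee => //; [exact: ltW|by left|right].
    by rewrite addr_gt0.
  exact: (integrableD measurableT i1 (integrableZl measurableT (expR 1) i2)).
have eeE b y : expR (- (c * expR y)) * expR (b * y) = ee 0 c b y.
  by rewrite /ee mul0r add0r -expRD addrC.
have mk : cmeasurable setT k.
  apply: cmeasurable_real; apply: measurable_continuous => y.
  apply: (cvg_comp _ expR _ (@continuous_expR R _)).
  by apply: cvgN; exact: continuous_expR.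
have dk y : is_cderive k y (k' y).
  apply: is_cderive_real.
  have h := is_deriveN (is_derive_expR y).
  have := @is_derive1_comp R expR (fun y => - expR y) y _ _ (is_derive_expR _) h.
  by move=> /is_derive_ext; apply; rewrite mulrN mulrC.
have bk y u : -1 < u < 1 -> expR (- expR (y + u)) <= expR (- (c * expR y)).
  by move=> u1; rewrite ler_expR lerN2 expR_shift_ge.
have h1 y u : -1 < u < 1 -> normc (k (y + u)) * expR (a * y) <= G y.
  move=> u1; rewrite normc_real gtr0_norm ?expR_gt0// /G -(eeE a).
  rewrite (@le_trans _ _ (expR (- (c * expR y)) * expR (a * y)))//.
    by rewrite ler_wpM2r ?expR_ge0// bk.
  by rewrite lerDl mulr_ge0 ?expR_ge0// ltW// ee_gt0.
have h2 y u : -1 < u < 1 -> normc (k' (y + u)) * expR (a * y) <= G y.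
  move=> u1; rewrite normc_real normrN gtr0_norm ?mulr_gt0 ?expR_gt0//.
  rewrite (@le_trans _ _ (expR 1 * ee 0 c (a + 1) y))//; last first.
    by rewrite /G lerDr ltW// ee_gt0.
  rewrite -eeE mulrDl mul1r [expR (a * y + y)]expRD.
  rewrite (_ : expR 1 * _ = (expR 1 * expR y) * expR (- (c * expR y)) * expR (a * y)); last by ring.
  rewrite ler_wpM2r ?expR_ge0//.
  by apply: ler_pM; rewrite ?expR_ge0 ?expR_shift_le ?bk.
have e := congr1 (@complex.Re R) (cintegral_shift_derivative dk mk iG h1 h2).
have e1 : Re (cintegral leb setT (fun y => k' y * (expR (a * y))%:C)) =
    - gammaE (a + 1).
  change (\int[leb]_y Re (k' y * (expR (a * y))%:C) = - gammaE (a + 1)).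
  rewrite -mulN1r /gammaE -RintegralZl//; last by apply: integrable_gammaE; rewrite addr_gt0.
  apply: eq_Rintegral => y _; rewrite ReM Re_real Im_real mulr0 subr0 Re_real ee01.
  by rewrite mulN1r mulNr -!expRD; congr (- expR _); ring.
have e2 : Re (cintegral leb setT (fun y => k y * (expR (a * y))%:C)) = gammaE a.
  change (\int[leb]_y Re (k y * (expR (a * y))%:C) = gammaE a).
  apply: eq_Rintegral => y _; rewrite ReM Re_real Im_real mulr0 subr0 Re_real ee01.
  by rewrite -!expRD; congr expR; ring.
have := etrans (esym e1) e.
by rewrite ReM Re_real Im_real mul0r subr0 e2 mulNr => /oppr_inj.
Qed.

Lemma gammaE1 : gammaE 1 = 1 :> R.
Proof.
rewrite /gammaE /Rintegral.
transitivity (fine (\int[leb]_(x in `]0%R, +oo[) (expR (- x))%:E)%E).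
  congr fine; rewrite (@integral_exp_line R (fun x => expR (- x))).
  - by apply: eq_integral => y _; rewrite ee01 mul1r -expRD; congr (expR _)%:E; ring.
  - by move=> x _; exact: continuous_expRN.
  - by move=> x _; exact: expR_ge0.
rewrite integral_itv_obnd_cbnd; last first.
  apply/measurable_EFinP; apply: measurable_funTS; apply: measurable_continuous.
  exact: continuous_expRN.
have dF (x : R) : is_derive x 1 (fun x : R => - expR (- x)) (expR (- x)).
  have h : is_derive x 1 (fun x : R => - x) (-1).
    exact: is_deriveN (is_derive_id x 1).
  have h2 := is_deriveN (@is_derive1_comp R expR (fun z => - z) x _ _ (is_derive_expR _) h).
  by apply: is_derive_ext h2 _; rewrite mulrN1 opprK.
rewrite (@ge0_continuous_FTC2y _ _ (fun x : R => - expR (- x)) 0 0).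
- by rewrite /= oppr0 expR0 sub0r opprK.
- by move=> x _; exact: expR_ge0.
- by apply: continuous_subspaceT; exact: continuous_expRN.
- by rewrite -oppr0; apply: cvgN; exact: cvgr_expR.
- by move=> x _; case: (dF x).
- by apply: cvg_at_right_filter; case: (dF 0) => /derivable1_diffP/differentiable_continuous.
- by move=> x _; rewrite derive1E; case: (dF x).
Qed.

(** Euler's beta integral at [(s, 1 - s)]. *)
Definition betaE (s : R) := \int[leb]_y (expR (s * y) / (1 + expR y)).

Lemma expD1_gt0 (y : R) : 0 < 1 + expR y.
Proof. by rewrite addr_gt0// expR_gt0. Qed.

Lemma continuous_beta (s : R) : continuous (fun y : R => expR (s * y) / (1 + expR y)).
Proof.
move=> y; apply: cvgM; first exact: continuous_expRM.
apply: cvgV; first by rewrite gt_eqF// expD1_gt0.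
by apply: cvgD; [exact: cvg_cst|exact: continuous_expR].
Qed.

Lemma beta_bound (s : R) y : 0 < s < 1 ->
  expR (s * y) / (1 + expR y) <= expR (- (Num.min s (1 - s) * `|y|)).
Proof.
move=> /andP[s0 s1]; rewrite ler_pdivrMr ?expD1_gt0// mulrDr mulr1 -expRD.
have [y0|y0] := leP 0 y.
  rewrite (@le_trans _ _ (expR (- (Num.min s (1 - s) * y) + y)))//.
    rewrite ler_expR; have : Num.min s (1 - s) <= 1 - s by rewrite ge_min lexx orbT.
    nra.
  by rewrite ger0_norm// lerDr expR_ge0.
rewrite ltr0_norm// (@le_trans _ _ (expR (- (Num.min s (1 - s) * - y))))//.
  rewrite ler_expR; have : Num.min s (1 - s) <= s by rewrite ge_min lexx.
  nra.
by rewrite lerDl expR_ge0.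
Qed.

Lemma integrable_beta (s : R) : 0 < s < 1 ->
  leb.-integrable setT (EFin \o (fun y : R => expR (s * y) / (1 + expR y))).
Proof.
move=> s01; have b0 : 0 < Num.min s (1 - s).
  by rewrite lt_min subr_gt0; case/andP: s01 => -> ->.
apply: (le_integrable _ _ _ (integrable_expabs b0)) => //.
  by apply/measurable_EFinP; apply: measurable_continuous; exact: continuous_beta.
move=> y _ /=; rewrite lee_fin [X in _ <= X]gtr0_norm ?expR_gt0//.
by rewrite ger0_norm ?divr_ge0 ?expR_ge0 ?beta_bound// ltW// expD1_gt0.
Qed.

Lemma integral_exp_scaled (b : R) : 0 < b ->
  (\int[leb]_z (expR (z - b * expR z))%:E = (b^-1)%:E)%E.
Proof.
move=> b0; have cg (v : R) : continuous (fun z : R => expR (z - v * expR z)).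
  move=> z; have := @continuous_ee R 0 v 1 z.
  by rewrite (_ : ee 0 v 1 = fun z : R => expR (z - v * expR z))//;
    apply/funext => x; rewrite /ee mul0r mul1r add0r.
rewrite -(@lebesgue_integral_shift R (- ln b)); last first.
  by apply/measurable_EFinP; apply: measurable_continuous; exact: cg.
transitivity (\int[leb]_z ((b^-1)%:E * (ee 0 1 1 z)%:E))%E.
  apply: eq_integral => z _; rewrite -EFinM; congr EFin.
  have E : expR (z - ln b) = expR z / b by rewrite expRB lnK ?posrE.
  rewrite E ee01 mul1r.
  have -> : b * (expR z / b) = expR z by rewrite mulrCA divff ?mulr1// gt_eqF.
  by rewrite [LHS]expRB E [in RHS]expRB -mulrA mulrCA.
rewrite ge0_integralZl//; last 3 first.
- exact: measurable_int (integrable_gammaE ltr01).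
- by move=> z _; rewrite lee_fin ltW// ee_gt0.
- by rewrite lee_fin invr_ge0 ltW.
by rewrite integral_gammaE// gammaE1 mule1.
Qed.

(** Multiply the two integrals out and substitute [y + z] for [y]. *)
Lemma gammaE_betaE (s : R) : 0 < s < 1 -> gammaE s * gammaE (1 - s) = betaE s.
Proof.
move=> s01; have /andP[s0 s1] := s01; have s1' : 0 < 1 - s by rewrite subr_gt0.
pose f (p : R * R) := expR (s * p.1) * expR (p.2 - (1 + expR p.1) * expR p.2).
have mE : measurable_fun setT (@expR R) by [].
have mf : measurable_fun setT (EFin \o (f : measurableTypeR R * measurableTypeR R -> R)).
  pose T2 := (measurableTypeR R * measurableTypeR R)%type.
  have e1 : measurable_fun setT (fun p : T2 => expR p.1).
    exact: measurableT_comp mE measurable_fst.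
  have e2 : measurable_fun setT (fun p : T2 => expR p.2).
    exact: measurableT_comp mE measurable_snd.
  apply/measurable_EFinP; apply: measurable_funM.
    exact: measurableT_comp (measurable_continuous (@continuous_expRM R s))
      measurable_fst.
  have h : measurable_fun setT (fun p : T2 => p.2 - (1 + expR p.1) * expR p.2).
    apply: measurable_funB; first exact: measurable_snd.
    by apply: measurable_funM => //; apply: measurable_funD.
  exact: measurableT_comp mE h.
have f0 p : (0 <= (EFin \o f) p)%E by rewrite lee_fin mulr_ge0 ?expR_ge0.
have := @fubini_tonelli _ _ (measurableTypeR R) (measurableTypeR R) R leb leb _ mf f0.
rewrite /fubini_F /fubini_G /=.
under [in X in X = _ -> _]eq_integral => y _.
  under eq_integral do rewrite /f /= EFinM.
  have mz : measurable_fun setT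
      (fun z : R => (expR (z - (1 + expR y) * expR z))%:E).
    apply/measurable_EFinP; apply: measurable_continuous => z.
    have := @continuous_ee R 0 (1 + expR y) 1 z.
    rewrite (_ : ee 0 _ 1 = fun z : R => expR (z - (1 + expR y) * expR z))//.
    by apply/funext => x; rewrite /ee mul0r mul1r add0r.
  rewrite ge0_integralZl; [|by []|exact: mz|
    by move=> z _; rewrite lee_fin expR_ge0|by rewrite lee_fin expR_ge0].
  rewrite integral_exp_scaled ?expD1_gt0// -EFinM.
  over.
under [in X in _ = X -> _]eq_integral => z _.
  rewrite (_ : (\int[leb]_y (f (y, z))%:E)%E = (ee 0 1 (1 - s) z * gammaE s)%:E).
    over.
  rewrite EFinM -(integral_gammaE s0) -ge0_integralZl; [|by []|
    exact: measurable_int (integrable_gammaE s0)|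
    by move=> y _; rewrite lee_fin ltW// ee_gt0|
    by rewrite lee_fin ltW// ee_gt0].
  rewrite -(@lebesgue_integral_shift R z
    (fun y => (ee 0 1 (1 - s) z)%:E * (ee 0 1 s y)%:E)%E); last first.
    apply: emeasurable_funM => //; exact: measurable_int (integrable_gammaE s0).
  apply: eq_integral => y _; rewrite -EFinM; congr EFin.
  rewrite /f !ee01 /= -!expRD; congr expR; rewrite expRD; ring.
move=> h; rewrite /betaE /Rintegral h.
under eq_integral do rewrite mulrC EFinM.
rewrite ge0_integralZl; [|by []|
  exact: measurable_int (integrable_gammaE s1')|
  by move=> y _; rewrite lee_fin ltW// ee_gt0|
  by rewrite lee_fin; apply: Rintegral_ge0 => y _; rewrite ltW// ee_gt0].
by rewrite integral_gammaE//.
Qed.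

(** The primitive is [2 * atan (e ^ (y / 2))]. *)
Lemma betaE_half : betaE 2^-1 = pi.
Proof.
have sqrE (y : R) : expR (2^-1 * y) ^+ 2 = expR y.
  by rewrite -expRM_natl; congr expR; field.
have dF (y : R) : is_derive y 1 (fun y : R => 2 * atan (expR (2^-1 * y)))
    (expR (2^-1 * y) / (1 + expR y)).
  have h : is_derive y 1 (fun y : R => 2^-1 * y) 2^-1.
    by apply: is_derive_eq; rewrite /GRing.scale/=; ring.
  have h2 := @is_derive1_comp R expR (fun z => 2^-1 * z) y _ _ (is_derive_expR _) h.
  have h3 := @is_derive1_comp R atan (fun z => expR (2^-1 * z)) y _ _
    (is_derive1_atan _) h2.
  apply: is_derive_ext (is_deriveZ 2 h3) _.
  rewrite sqrE /GRing.scale/=; field.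
  by rewrite gt_eqF// expD1_gt0.
rewrite /betaE /Rintegral (@integral_even_FTC R
  (fun y => expR (2^-1 * y) / (1 + expR y)) (fun y => 2 * atan (expR (2^-1 * y))) pi).
- by rewrite /= mulr0 expR0 atan1; field.
- by move=> y; rewrite divr_ge0 ?expR_ge0// ltW// expD1_gt0.
- exact: continuous_beta.
- move=> y; rewrite !mulrN !expRN.
  rewrite -(sqrE y).
  have e0 := expR_gt0 (2^-1 * y); field.
  by rewrite !gt_eqF//= addr_gt0// exprn_gt0.
- by apply: cvg_at_right_filter; case: (dF 0) => /derivable1_diffP/differentiable_continuous.
- rewrite (_ : pi = 2 * (pi / 2)); last by rewrite mulrC divfK.
  apply: cvgM; first exact: cvg_cst.
  apply: (cvg_comp _ _ _ (@cvgy_atan R)).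
  apply: (@ger_cvgy _ _ _ _ (fun y : R => 2^-1 * y)).
    by apply: nearW => y; rewrite (le_trans _ (expR_ge1Dx _))// lerDr.
  by apply: gt0_cvgMry; [rewrite invr_gt0|exact: cvg_id].
Qed.

(** [sin th] times this kernel is minus the imaginary part of [1 / (1 + z)], for
    [z] the point of argument [th] and modulus [e ^ y]. *)
Definition beta_kernel (th y : R) := expR y / (1 + 2 * cos th * expR y + expR y ^+ 2).

(** Bounds [1 + z] away from 0 uniformly on a sector that avoids the negative
    half-line. *)
Lemma ray_norm_sqr (c r : R) :
  1 + 2 * c * r + r ^+ 2 = (1 + c) / 2 * (1 + r) ^+ 2 + (1 - c) / 2 * (1 - r) ^+ 2.
Proof. by field. Qed.

Lemma ray_denom_gt0 (th r : R) : - pi < th < pi -> 0 < r ->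
  0 < 1 + 2 * cos th * r + r ^+ 2.
Proof.
move=> /andP[h1 h2] r0; rewrite ray_norm_sqr.
have c1 : -1 < cos th.
  rewrite -cospi -(cos_norm th); have a : `|th| < pi by rewrite ltr_norml h1.
  by rewrite ltr_cos// in_itv/= ?normr_ge0 ?pi_ge0 ?lexx// ltW.
have c2 := cos_le1 th.
rewrite ltr_pwDl//; last by rewrite mulr_ge0 ?sqr_ge0//; lra.
by rewrite mulr_gt0 ?exprn_gt0//; lra.
Qed.

Lemma normc_ray1 (th y : R) :
  normc (1 + ray th y) ^+ 2 = 1 + 2 * cos th * expR y + expR y ^+ 2 :> R.
Proof.
rewrite normc_sqr ReD ImD Re_ray Im_ray /= add0r.
have := cos2Dsin2 th; set c := cos th; set s := sin th; set r := expR y => h.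
transitivity (1 + 2 * c * r + r ^+ 2 * (c ^+ 2 + s ^+ 2)); first by ring.
by rewrite h mulr1.
Qed.

Lemma ray1_neq0 (th y : R) : - pi < th < pi -> 1 + ray th y != 0.
Proof.
move=> thp; apply/eqP => h; have := normc_ray1 th y.
rewrite h normc0 expr0n /= => /esym/eqP.
by rewrite gt_eqF// ray_denom_gt0// expR_gt0.
Qed.

Lemma beta_kernel_ge0 (th y : R) : - pi < th < pi -> 0 <= beta_kernel th y.
Proof.
by move=> thp; rewrite divr_ge0 ?expR_ge0// ltW// ray_denom_gt0// expR_gt0.
Qed.

Lemma continuous_beta_kernel (s th : R) : - pi < th < pi ->
  continuous (fun y : R => expR (s * y) * beta_kernel th y).
Proof.
move=> thp y; apply: cvgM; first exact: continuous_expRM.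
apply: cvgM; first exact: continuous_expR.
apply: cvgV; first by rewrite gt_eqF// ray_denom_gt0// expR_gt0.
apply: cvgD.
  apply: cvgD; first exact: cvg_cst.
  by apply: cvgM; [exact: cvg_cst|exact: continuous_expR].
apply: (cvg_comp _ (fun z : R => z ^+ 2) (@continuous_expR R y)).
exact: exprn_continuous.
Qed.

Lemma integrable_beta_kernel (s th : R) : 0 < s < 1 -> - pi < th < pi ->
  leb.-integrable setT (EFin \o (fun y : R => expR (s * y) * beta_kernel th y)).
Proof.
move=> s01 thp; have c0 : 0 < 1 + cos th.
  move: thp => /andP[h1 h2].
  have : -1 < cos th; last by lra.
  rewrite -cospi -(cos_norm th); have a : `|th| < pi by rewrite ltr_norml h1.
  by rewrite ltr_cos// in_itv/= ?normr_ge0 ?pi_ge0 ?lexx// ltW.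
pose c := 2 / (1 + cos th).
have ic : leb.-integrable setT (EFin \o (fun y => c * (expR (s * y) / (1 + expR y)))).
  by have := integrableZl measurableT c (integrable_beta s01).
apply: (le_integrable _ _ _ ic) => //.
  apply/measurable_EFinP; apply: measurable_continuous.
  exact: continuous_beta_kernel.
move=> y _ /=; rewrite lee_fin (le_trans _ (ler_norm _))//.
have k0 : 0 <= expR (s * y) * beta_kernel th y.
  by rewrite mulr_ge0 ?expR_ge0 ?beta_kernel_ge0.
rewrite (ger0_norm k0).
have -> : c * (expR (s * y) / (1 + expR y)) = expR (s * y) * (c / (1 + expR y)).
  by ring.
apply: ler_wpM2l; first exact: expR_ge0.
have e0 := expR_gt0 y; have D0 := ray_denom_gt0 thp e0.
rewrite /beta_kernel ler_pdivrMr// mulrAC ler_pdivlMr ?expD1_gt0//.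
rewrite ray_norm_sqr /c -(ler_pM2r c0).
have -> : 2 / (1 + cos th) * ((1 + cos th) / 2 * (1 + expR y) ^+ 2 +
    (1 - cos th) / 2 * (1 - expR y) ^+ 2) * (1 + cos th) =
  (1 + cos th) * (1 + expR y) ^+ 2 + (1 - cos th) * (1 - expR y) ^+ 2.
  by field; rewrite gt_eqF.
have q1 : 0 <= (1 - cos th) * (1 - expR y) ^+ 2.
  by rewrite mulr_ge0 ?sqr_ge0// subr_ge0 cos_le1.
rewrite (@le_trans _ _ ((1 + cos th) * (1 + expR y) ^+ 2))//; last by rewrite lerDl.
rewrite mulrC ler_pM2l// expr2 ler_wpM2r ?lerDr// ltW// expD1_gt0.
Qed.

(** The integral of [1 / (1 + z)] does not change, up to a phase, when the ray is
    rotated by [th]; the claim compares imaginary parts. *)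
Lemma beta_rotation (s th : R) : 0 < s < 1 -> 0 < th < pi ->
  betaE s * sin (s * th) =
  sin th * \int[leb]_y (expR (s * y) * beta_kernel th y).
Proof.
move=> s01 /andP[th0 thpi]; have /andP[s0 s1] := s01.
have [T thT Tpi] : exists2 T, th < T & T < pi.
  by exists ((th + pi) / 2); lra.
have T0 : 0 < T by exact: lt_trans th0 thT.
pose m := (1 + cos T) / 2.
have cT : -1 < cos T.
  by rewrite -cospi ltr_cos// in_itv/= ?pi_ge0 ?lexx// ltW//= ltW.
have m0 : 0 < m by rewrite /m; lra.
have m1 : m <= 1 by rewrite /m; have := cos_le1 T; lra.
have Tp (x : R) : - T < x < T -> - pi < x < pi by lra.
pose c := m * expR (-1).
have c0 : 0 < c by rewrite mulr_gt0 ?expR_gt0.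
pose G y := (m * c)^-1 * (expR (s * y) / (1 + expR y)).
have iG : leb.-integrable setT (EFin \o G).
  by have := integrableZl measurableT ((m * c)^-1) (integrable_beta s01).
have lowm (x y : R) : - T < x < T -> m * (1 + expR y) <= normc (1 + ray x y).
  move=> xT; have e0 := expR_gt0 y.
  have l0 : 0 <= m * (1 + expR y) by rewrite mulr_ge0 ?(ltW m0)// ltW// expD1_gt0.
  rewrite -ler_sqr ?nnegrE ?normc_ge0//.
  rewrite normc_ray1 ray_norm_sqr.
  have cc := cos_le_abs xT (ltW Tpi); have c1 := cos_le1 x.
  have q1 := sqr_ge0 (1 - expR y); have q2 := sqr_ge0 (1 + expR y).
  apply: (@le_trans _ _ (m * (1 + expR y) ^+ 2)).
    by rewrite exprMn ler_wpM2r// expr2 ler_piMl// ltW.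
  apply: (@le_trans _ _ ((1 + cos x) / 2 * (1 + expR y) ^+ 2)).
    by rewrite ler_wpM2r// /m; lra.
  by rewrite lerDl mulr_ge0//; lra.
have lowc (x y u : R) (xT : - T < x < T) (u1 : -1 < u < 1) :
    c * (1 + expR y) <= normc (1 + ray x (y + u)).
  rewrite (le_trans _ (lowm x (y + u) xT))// /c -mulrA.
  rewrite ler_wpM2l ?(ltW m0)// mulrDr mulr1; apply: lerD.
    by rewrite -[leRHS]expR0 ler_expR lerN10.
  exact: expR_shift_ge.
have Gbound (x y u r : R) : - T < x < T -> -1 < u < 1 ->
    r <= m^-1 * (normc (1 + ray x (y + u)))^-1 -> r * expR (s * y) <= G y.
  move=> xT u1 hr.
  have -> : G y = ((m * c)^-1 / (1 + expR y)) * expR (s * y) by rewrite /G; ring.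
  rewrite ler_wpM2r ?expR_ge0//.
  have -> : (m * c)^-1 / (1 + expR y) = m^-1 * (c * (1 + expR y))^-1.
    by rewrite (invfM m c) (invfM c) mulrA.
  apply: le_trans hr _; apply: ler_wpM2l; first by rewrite invr_ge0 ltW.
  have h := lowc x y u xT u1.
  have p0 : 0 < c * (1 + expR y) by rewrite mulr_gt0 ?expD1_gt0.
  by rewrite lef_pV2 ?posrE// (lt_le_trans p0).
pose k (x y : R) := (1 + ray x y)^-1.
pose k' (x y : R) := - ray x y / (1 + ray x y) ^+ 2.
have dky (x y : R) : - T < x < T -> is_cderive (k x) y (k' x y).
  move=> xT; have h := is_cderiveD (is_cderive_cst 1 y) (is_cderive_ray_y x y).
  apply: is_cderive_ext (is_cderiveV (ray1_neq0 y (Tp x xT)) h) _.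
  by rewrite add0r.
have dkx (x y : R) : - T < x < T -> is_cderive (k ^~ y) x ('i%C * k' x y).
  move=> xT; have h := is_cderiveD (is_cderive_cst 1 x) (is_cderive_ray_th x y).
  apply: is_cderive_ext
    (@is_cderiveV R (fun x => 1 + ray x y) x _ (ray1_neq0 y (Tp x xT)) h) _.
  by rewrite add0r /k'; ring.
have mk (x : R) : - T < x < T -> cmeasurable setT (k x).
  by move=> xT; apply: (@is_cderive_cmeasurable R _ (k' x)) => y; exact: dky.
have mk' (x : R) : - T < x < T -> cmeasurable setT (k' x).
  move=> xT; rewrite (_ : k' x = fun y => (-1 * ray x y) * (k x y * k x y)).
    apply: cmeasurableM; last by apply: cmeasurableM; exact: mk.
    by apply: cmeasurableM; [exact: cmeasurable_cst|exact: cmeasurable_ray].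
  by apply/funext => y; rewrite /k' /k expr2 invfM mulN1r.
have bk (x y u : R) : - T < x < T -> -1 < u < 1 ->
    normc (k x (y + u)) * expR (s * y) <= G y.
  move=> xT u1; apply: (Gbound x y u) => //.
  rewrite normcV -[leLHS]mul1r ler_wpM2r ?invr_ge0 ?normc_ge0//.
  by rewrite -[leLHS]invr1 lef_pV2 ?posrE.
have bk' (x y u : R) : - T < x < T -> -1 < u < 1 ->
    normc (k' x (y + u)) * expR (s * y) <= G y.
  move=> xT u1; apply: (Gbound x y u) => //.
  rewrite normcM normcN normc_ray normcV normcX expr2 invfM mulrA.
  rewrite ler_wpM2r ?invr_ge0 ?normc_ge0//.
  have n0 : 0 < normc (1 + ray x (y + u)).
    rewrite (lt_le_trans _ (lowc x y u xT u1))// mulr_gt0 ?expD1_gt0//.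
  rewrite ler_pdivrMr// ler_pdivlMl// (le_trans _ (lowm x (y + u) xT))//.
  by rewrite ler_wpM2l ?(ltW m0)// lerDr.
have thT' : - T < th < T by lra.
have e := congr1 (@complex.Im R)
  (cintegral_rotation dkx dky mk mk' iG bk bk' thT').
have e1 : Im (cintegral leb setT (fun y => k th y * (expR (s * y))%:C)) =
    - (sin th * \int[leb]_y (expR (s * y) * beta_kernel th y)).
  change (\int[leb]_y Im (k th y * (expR (s * y))%:C) =
    - (sin th * \int[leb]_y (expR (s * y) * beta_kernel th y))).
  rewrite -mulNr -RintegralZl//.
    apply: eq_Rintegral => y _; rewrite ImM Im_real mulr0 add0r Re_real /k.
    rewrite Im_invc -normc_sqr normc_ray1 ImD Im_ray /= add0r /beta_kernel.
    by ring.
  by apply: integrable_beta_kernel => //; apply: Tp; lra.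
have e2 : cintegral leb setT (fun y => k 0 y * (expR (s * y))%:C) = (betaE s)%:C.
  have kE y : k 0 y * (expR (s * y))%:C = (expR (s * y) / (1 + expR y))%:C.
    have -> : k 0 y = ((1 + expR y)^-1)%:C.
      rewrite /k /ray rmorph0 mulr0 cexp0 mul1r -[X in X + _]/((1 : R)%:C).
      by rewrite -rmorphD/= fmorphV.
    by rewrite -rmorphM/= mulrC.
  apply: complex_ext.
    change (\int[leb]_y Re (k 0 y * (expR (s * y))%:C) = betaE s).
    by apply: eq_Rintegral => y _; rewrite kE.
  change (\int[leb]_y Im (k 0 y * (expR (s * y))%:C) = 0).
  rewrite (_ : (fun y => _) = cst 0) ?Rintegral_cst ?mul0r//.
  by apply/funext => y; rewrite kE.
have := etrans (esym e1) e; rewrite e2 ImM Re_cis Im_cis Im_real Re_real mulr0 add0r sinN.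
by rewrite mulNr => /oppr_inj ->; rewrite mulrC.
Qed.

End reflection.

Section reflection_limit.
Context {R : realType}.
Local Notation leb := (@lebesgue_measure R).

Lemma integrable_opp (g : R -> R) : leb.-integrable setT (EFin \o g) ->
  leb.-integrable setT (EFin \o (fun y => g (- y))).
Proof.
move=> ig; have mg := measurable_int _ ig.
have mN : measurable_fun setT (-%R : R -> R) by [].
apply/integrableP; split.
  exact: (measurableT_comp mg mN).
have /integrableP[_] := ig; apply: le_lt_trans.
have mag : measurable_fun setT (fun y => `|(EFin \o g) y|%E).
  exact: measurableT_comp mg.
by rewrite -(lebesgue_integral_opp mag).
Qed.

Lemma beta_kernelN (th y : R) : - pi < th < pi ->
  beta_kernel th (- y) = beta_kernel th y.
Proof.
move=> thp; rewrite /beta_kernel expRN.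
have r0 := expR_gt0 y; have D := ray_denom_gt0 thp r0.
have -> : 1 + 2 * cos th * (expR y)^-1 + (expR y)^-1 ^+ 2 =
    (1 + 2 * cos th * expR y + expR y ^+ 2) / expR y ^+ 2.
  by field; rewrite gt_eqF.
by field; rewrite !gt_eqF.
Qed.

Lemma cosh_kernel_ge0 (s y : R) : 0 <= expR (s * y) + expR (- (s * y)) - 2.
Proof.
have e0 := expR_gt0 (s * y); rewrite expRN.
have -> : expR (s * y) + (expR (s * y))^-1 - 2 =
    (expR (s * y))^-1 * (expR (s * y) - 1) ^+ 2.
  by field; rewrite gt_eqF.
by rewrite mulr_ge0 ?sqr_ge0// invr_ge0 ltW.
Qed.

(** With [a = e ^ (- s y)] and [b = e ^ (- (1 - s) y)] the claim for [y >= 0]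
    reduces to [(1 - a) ^+ 2 <= (1 - a b) ^+ 2]. *)
Lemma cosh_kernel_le (s th y : R) : 0 < s < 1 -> - pi < th < pi ->
  (expR (s * y) + expR (- (s * y)) - 2) * beta_kernel th y <=
  expR (- ((1 - s) * `|y|)).
Proof.
move=> s01 thp.
have H z : 0 <= z ->
    (expR (s * z) + expR (- (s * z)) - 2) * beta_kernel th z <=
    expR (- ((1 - s) * z)).
  move=> z0; have /andP[s0 s1] := s01.
  have r0 := expR_gt0 z; have D0 := ray_denom_gt0 thp r0.
  rewrite mulrA ler_pdivrMr//.
  pose a := expR (- (s * z)); pose b := expR (- ((1 - s) * z)).
  have a0 : 0 < a by exact: expR_gt0.
  have b0 : 0 < b by exact: expR_gt0.
  have a1 : a <= 1 by rewrite /a -[leRHS]expR0 ler_expR oppr_le0 mulr_ge0// ltW.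
  have b1 : b <= 1.
    by rewrite /b -[leRHS]expR0 ler_expR oppr_le0 mulr_ge0// subr_ge0 ltW.
  have rE : expR z = (a * b)^-1.
    by rewrite /a /b -expRD -expRN; congr expR; ring.
  have sE : expR (s * z) = a^-1 by rewrite /a -expRN opprK.
  rewrite -/a -/b.
  apply: (@le_trans _ _ (b * (1 - expR z) ^+ 2)); last first.
    rewrite ler_wpM2l ?(ltW b0)// ray_norm_sqr.
    have q1 := sqr_ge0 (1 - expR z); have q2 := sqr_ge0 (1 + expR z).
    have c1 := cos_geN1 th; have c2 := cos_le1 th.
    set c := cos th in c1 c2 *; set r := expR z in q1 q2 r0 *.
    have -> : (1 + c) / 2 * (1 + r) ^+ 2 + (1 - c) / 2 * (1 - r) ^+ 2 =
      (1 - r) ^+ 2 + (1 + c) * 2 * r by field.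
    by rewrite lerDl !mulr_ge0//; lra.
  rewrite sE rE.
  have -> : (a^-1 + a - 2) / (a * b) = (a ^+ 2 * b)^-1 * (1 - a) ^+ 2.
    by field; rewrite !gt_eqF.
  have -> : b * (1 - (a * b)^-1) ^+ 2 = (a ^+ 2 * b)^-1 * (1 - a * b) ^+ 2.
    by field; rewrite !gt_eqF.
  have q0 : 0 <= (a ^+ 2 * b)^-1 by rewrite ltW// invr_gt0 mulr_gt0// exprn_gt0.
  apply: ler_wpM2l => //.
  have ab : a * b <= a by rewrite ler_piMr// ltW.
  by rewrite ler_sqr ?nnegrE ?subr_ge0 ?(le_trans ab)// lerD2l lerN2.
have [y0|y0] := leP 0 y; first by rewrite ger0_norm// H.
rewrite ltr0_norm// -(beta_kernelN y thp).
have := H (- y); rewrite mulrN opprK oppr_ge0 => /(_ (ltW y0)).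
by rewrite (addrC (expR (- _))).
Qed.

(** Both sides of the rotation formula degenerate as [th] tends to [pi], where
    [1 + z] vanishes on the ray. The integrals for [s] and for [2^-1] however
    differ by a bounded amount, as the symmetrized integrands agree to second
    order at the singularity; multiplied by [sin th], the difference tends to 0,
    and at [2^-1] the value is known. *)
Lemma betaE_sin (s : R) : 0 < s < 1 -> betaE s * sin (s * pi) = pi.
Proof.
move=> s01; have /andP[s0 s1] := s01.
have h01 : 0 < (2^-1 : R) < 1 by rewrite invr_gt0 ltr0n/= invf_lt1 ?ltr1n.
pose A (s th : R) := \int[leb]_y (expR (s * y) * beta_kernel th y).
have pipos := pi_gt0 R.
have thp (th : R) : 0 < th < pi -> - pi < th < pi by move=> /andP[]; lra.
have is1 : leb.-integrable setT (EFin \o (fun y : R => expR (- ((1 - s) * `|y|)))).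
  by apply: integrable_expabs; rewrite subr_gt0.
have ih1 : leb.-integrable setT (EFin \o (fun y : R => expR (- ((1 - 2^-1) * `|y|)))).
  by apply: integrable_expabs; lra.
pose g (y : R) := expR (- ((1 - s) * `|y|)) + expR (- ((1 - 2^-1) * `|y|)).
have ig : leb.-integrable setT (EFin \o g) by exact: (integrableD measurableT is1 ih1).
pose K := \int[leb]_y g y.
have bound (th : R) : 0 < th < pi -> `|A s th - A 2^-1 th| <= K.
  move=> th0; have tp := thp th th0.
  have i1 := integrable_beta_kernel s01 tp.
  have i2 := integrable_beta_kernel h01 tp.
  have i1N := integrable_opp i1; have i2N := integrable_opp i2.
  have AN (r : R) : 0 < r < 1 -> A r th = \int[leb]_y (expR (r * - y) * beta_kernel th (- y)).
    move=> r01; have ir := integrable_beta_kernel r01 tp.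
    by rewrite /A /Rintegral -(lebesgue_integral_opp (measurable_int _ ir)).
  have e : (A s th - A 2^-1 th) *+ 2 = \int[leb]_y
      ((expR (s * y) * beta_kernel th y - expR (2^-1 * y) * beta_kernel th y) +
       (expR (s * - y) * beta_kernel th (- y) -
        expR (2^-1 * - y) * beta_kernel th (- y))).
    have i3 := integrableB measurableT i1 i2.
    have i4 := integrableB measurableT i1N i2N.
    rewrite (RintegralD measurableT i3 i4) (RintegralB measurableT i1 i2).
    rewrite (RintegralB measurableT i1N i2N).
    by rewrite -(AN _ s01) -(AN _ h01) mulr2n.
  have : `|(A s th - A 2^-1 th) *+ 2| <= K.
    rewrite e; apply: le_trans (le_normr_Rintegral _ _) _ => //.
      have i3 := integrableB measurableT i1 i2.
      have i4 := integrableB measurableT i1N i2N.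
      exact: (integrableD measurableT i3 i4).
    apply: le_Rintegral => //.
      have i3 := integrableB measurableT i1 i2.
      have i4 := integrableB measurableT i1N i2N.
      by have := integrable_abse (integrableD measurableT i3 i4).
    move=> y _; rewrite beta_kernelN// !mulrN.
    have k0 := beta_kernel_ge0 y tp.
    have u1 := cosh_kernel_le y s01 tp; have u2 := cosh_kernel_le y h01 tp.
    have l1 := mulr_ge0 (cosh_kernel_ge0 s y) k0.
    have l2 := mulr_ge0 (cosh_kernel_ge0 2^-1 y) k0.
    rewrite /g ler_norml; move: u1 u2 l1 l2.
    set e1 := expR (s * y); set e2 := expR (- (s * y)).
    set e3 := expR (2^-1 * y); set e4 := expR (- (2^-1 * y)).
    set k := beta_kernel th y.
    set g1 := expR _; set g2 := expR _ => u1 u2 l1 l2.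
    by apply/andP; split; lra.
  rewrite normrMn mulr2n; apply: le_trans; rewrite lerDl//.
pose F (th : R) := betaE s * sin (s * th) - pi * sin (2^-1 * th).
have FK (th : R) : 0 < th < pi -> `|F th| <= sin th * K.
  move=> th0; rewrite /F -betaE_half !beta_rotation// -mulrBr normrM.
  have sp : 0 <= sin th.
    by apply: sin_ge0_pi; case/andP: th0 => a b; rewrite (ltW a) (ltW b).
  by rewrite (ger0_norm sp) ler_wpM2l// bound.
have csin (a : R) : continuous (fun th : R => sin (a * th)).
  move=> th; apply: (cvg_comp _ sin _ (@continuous_sin R _)).
  by apply: cvgM; [exact: cvg_cst|exact: cvg_id].
have cF : continuous F.
  by move=> th; apply: cvgB; apply: cvgM; try exact: cvg_cst; exact: csin.
have F0 : `|F th| @[th --> pi^'-] --> (0 : R).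
  apply: (@squeeze_cvgr _ _ _ _ (fun=> 0) (fun th => sin th * K)).
  - near=> th; rewrite normr_ge0/=; apply: FK; apply/andP; split; near: th.
      exact: nbhs_left_gt.
    exact: nbhs_left_lt.
  - exact: cvg_cst.
  - rewrite -(mul0r K) -(@sinpi R); apply: cvgM; last exact: cvg_cst.
    by apply: cvg_at_left_filter; exact: continuous_sin.
have F1 : `|F th| @[th --> pi^'-] --> `|F pi|.
  apply: cvg_at_left_filter; apply: cvg_norm; exact: cF.
have /normr0_eq0 : `|F pi| = 0 by exact: (cvg_unique _ F1 F0).
rewrite /F (mulrC 2^-1) sin_pihalf mulr1 => /eqP.
by rewrite subr_eq0 => /eqP.
Unshelve. all: end_near. Qed.

Lemma sin_pi_gt0 (s : R) : 0 < s < 1 -> 0 < sin (s * pi).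
Proof.
move=> /andP[s0 s1]; apply: sin_gt0_pi; rewrite mulr_gt0 ?pi_gt0//=.
by rewrite gtr_pMl ?pi_gt0.
Qed.

Lemma gammaE_reflection (s : R) : 0 < s < 1 ->
  gammaE s * gammaE (1 - s) = pi / sin (s * pi).
Proof.
move=> s01; apply: (mulIf (lt0r_neq0 (sin_pi_gt0 s01))).
by rewrite gammaE_betaE// betaE_sin// divfK// gt_eqF// sin_pi_gt0.
Qed.

End reflection_limit.

(** * Limits of complex sequences *)

Section complex_sequences.
Context {R : realType}.
Implicit Types (u v : nat -> R[i]) (l m : R[i]).

Definition ccvg u l :=
  (Re (u k) @[k --> \oo] --> Re l) /\ (Im (u k) @[k --> \oo] --> Im l).

Lemma ccvg_cst l : ccvg (fun=> l) l.
Proof. by split; exact: cvg_cst. Qed.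

Lemma ccvg_real (a : nat -> R) (b : R) : a k @[k --> \oo] --> b ->
  ccvg (fun k => (a k)%:C) b%:C.
Proof. by move=> ab; split => //=; exact: cvg_cst. Qed.

Lemma ccvgD u v l m : ccvg u l -> ccvg v m -> ccvg (fun k => u k + v k) (l + m).
Proof.
move=> [ru iu] [rv iv]; split.
  by rewrite ReD; under eq_fun do rewrite ReD; exact: cvgD.
by rewrite ImD; under eq_fun do rewrite ImD; exact: cvgD.
Qed.

Lemma ccvgM u v l m : ccvg u l -> ccvg v m -> ccvg (fun k => u k * v k) (l * m).
Proof.
move=> [ru iu] [rv iv]; split.
  by rewrite ReM; under eq_fun do rewrite ReM; apply: cvgB; exact: cvgM.
by rewrite ImM; under eq_fun do rewrite ImM; apply: cvgD; exact: cvgM.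
Qed.

Lemma ccvgN u l : ccvg u l -> ccvg (fun k => - u k) (- l).
Proof.
move=> hu; rewrite -mulN1r; under eq_fun do rewrite -mulN1r.
by apply: ccvgM => //; exact: ccvg_cst.
Qed.

Lemma ccvgB u v l m : ccvg u l -> ccvg v m -> ccvg (fun k => u k - v k) (l - m).
Proof. by move=> hu hv; apply: ccvgD => //; exact: ccvgN. Qed.

Lemma ccvg_cexp u l : ccvg u l -> ccvg (fun k => cexp (u k)) (cexp l).
Proof.
move=> [ru iu]; split.
  rewrite Re_cexp; under eq_fun do rewrite Re_cexp; apply: cvgM.
    exact: (cvg_comp _ _ ru (@continuous_expR R _)).
  exact: (cvg_comp _ _ iu (@continuous_cos R _)).
rewrite Im_cexp; under eq_fun do rewrite Im_cexp; apply: cvgM.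
  exact: (cvg_comp _ _ ru (@continuous_expR R _)).
exact: (cvg_comp _ _ iu (@continuous_sin R _)).
Qed.

Lemma ccvg_sum n (u : 'I_n -> nat -> R[i]) (l : 'I_n -> R[i]) :
  (forall i, ccvg (u i) (l i)) ->
  ccvg (fun k => \sum_(i < n) u i k) (\sum_(i < n) l i).
Proof.
move=> hu; elim: n u l hu => [|n IH] u l hu.
  by rewrite big_ord0; under eq_fun do rewrite big_ord0; exact: ccvg_cst.
rewrite big_ord_recr; under eq_fun do rewrite big_ord_recr.
by apply: ccvgD => //; exact: IH.
Qed.

Lemma ccvg_normc u l : ccvg u l -> normc (u k - l) @[k --> \oo] --> (0 : R).
Proof.
move=> [hr hi]; apply: (@squeeze_cvgr _ _ _ _ (fun=> 0)
  (fun k => `|Re (u k) - Re l| + `|Im (u k) - Im l|)).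
- apply: nearW => k; rewrite normc_ge0/= -ReN -ImN -ReD -ImD.
  exact: normc_le_parts.
- exact: cvg_cst.
- have := cvgD (cvg_norm (cvgB hr (cvg_cst (Re l))))
    (cvg_norm (cvgB hi (cvg_cst (Im l)))).
  by rewrite !subrr normr0 addr0; exact.
Qed.

Lemma normc_ccvg u l : normc (u k - l) @[k --> \oo] --> (0 : R) -> ccvg u l.
Proof.
move=> hn.
have H (p : R[i] -> R) : {morph p : x y / x + y} -> {morph p : x / - x} ->
    (forall z, `|p z| <= normc z) -> p (u k) @[k --> \oo] --> p l.
  move=> pD pN pn; apply/cvgrPdist_le => e e0.
  have /cvgrPdist_le/(_ e e0) := hn.
  apply: filterS => k; rewrite sub0r normrN ger0_norm ?normc_ge0// => h.
  by rewrite distrC -pN -pD (le_trans (pn _)).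
split; apply: H.
- exact: ReD.
- exact: ReN.
- exact: le_Re_normc.
- exact: ImD.
- exact: ImN.
- exact: le_Im_normc.
Qed.

Lemma ccvg_le u l (b : nat -> R) (B : R) : ccvg u l -> b k @[k --> \oo] --> B ->
  (forall k, normc (u k) <= b k) -> normc l <= B.
Proof.
move=> hu hb ub; have hn := ccvg_normc hu.
have h0 : b k + normc (u k - l) @[k --> \oo] --> B.
  by have := cvgD hb hn; rewrite addr0; exact.
apply: (ler_cvg_to (cvg_cst (normc l)) h0); apply: nearW => k.
rewrite -{1}(subKr (u k) l) (le_trans (le_normcD _ _))//.
by rewrite normcN lerD2r.
Qed.

End complex_sequences.

Section complex_dominated_convergence.
Context {R : realType} d (T : measurableType d) (mu : {measure set T -> \bar R}).

Lemma ccvg_dominated (D : set T) (f_ : nat -> T -> R[i]) (f : T -> R[i])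
    (g : T -> R) : measurable D ->
  (forall k, cmeasurable D (f_ k)) -> cmeasurable D f ->
  (forall x, D x -> ccvg (f_ ^~ x) (f x)) ->
  mu.-integrable D (EFin \o g) ->
  (forall k x, D x -> normc (f_ k x) <= g x) ->
  ccvg (fun k => cintegral mu D (f_ k)) (cintegral mu D f).
Proof.
move=> mD mf_ mf cf ig fg.
have dc (p : R[i] -> R) : (forall k, measurable_fun D (fun x => p (f_ k x))) ->
    measurable_fun D (fun x => p (f x)) ->
    (forall z, `|p z| <= normc z) ->
    (forall x, D x -> p (f_ k x) @[k --> \oo] --> p (f x)) ->
    \int[mu]_(x in D) p (f_ k x) @[k --> \oo] --> \int[mu]_(x in D) p (f x).
  move=> mp_ mp pn pc.
  have [] := @dominated_convergence _ _ _ mu D mD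
    (fun k x => (p (f_ k x))%:E) (fun x => (p (f x))%:E) (EFin \o g).
  - by move=> k; apply/measurable_EFinP; exact: mp_.
  - by apply/measurable_EFinP; exact: mp.
  - by apply: aeW => x Dx; apply/fine_cvgP; split; [exact: nearW|exact: pc].
  - exact: ig.
  - by apply: aeW => x k Dx; rewrite /= lee_fin (le_trans (pn _))// fg.
  move=> i0 _ hc; apply: fine_cvg; rewrite fineK//.
  exact: (integrable_fin_num mD i0).
split; apply: dc.
- by move=> k; case: (mf_ k).
- by case: mf.
- exact: le_Re_normc.
- by move=> x /cf[].
- by move=> k; case: (mf_ k).
- by case: mf.
- exact: le_Im_normc.
- by move=> x /cf[].
Qed.

End complex_dominated_convergence.

(** * The integral of the Bessel function on a rotated ray *)

Section bessel_integral.
Context {R : realType}.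
Local Notation leb := (@lebesgue_measure R).
Variable th : R.
Hypothesis th_bound : - (pi / 2) < th < pi / 2.

Let eta : R[i] := cexp ('i%C * th%:C).

Let cos_th_gt0 : 0 < cos th. Proof. exact: cos_gt0_pihalf. Qed.

Definition zint (u v a y : R) : R[i] :=
  cexp (- (cexp ('i%C * th%:C) * (u * expR (- y) + v * expR y)%:C)) *
  (expR (a * y))%:C.

(** Up to a power of [u / v], this is twice the Bessel function [K] of order [a]
    at [2 e ^ (i th) sqrt (u v)]. *)
Definition Zint (u v a : R) : R[i] := cintegral leb setT (zint u v a).

Lemma normc_zint u v a y : normc (zint u v a y) = ee (cos th * u) (cos th * v) a y.
Proof.
rewrite /zint normcM normc_real gtr0_norm ?expR_gt0// normc_cexp -expRD.
by rewrite ReN ReM Re_cis Re_real Im_real; congr expR; ring.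
Qed.

Lemma cmeasurable_zint u v a : cmeasurable setT (zint u v a).
Proof.
apply: cmeasurableM; last exact: cmeasurable_expRM.
apply: cmeasurable_cexp; under eq_fun do rewrite -mulNr.
apply: cmeasurableM; first exact: cmeasurable_cst.
apply: cmeasurable_real; apply: measurable_continuous => y.
by apply: cvgD; apply: cvgM; [exact: cvg_cst|exact: continuous_expRN|
  exact: cvg_cst|exact: continuous_expR].
Qed.

Lemma integrable_ee_th u v a : 0 <= u -> 0 <= v -> 0 < v \/ a < 0 -> 0 < u \/ 0 < a ->
  leb.-integrable setT (EFin \o ee (cos th * u) (cos th * v) a).
Proof.
move=> u0 v0 hv hu; have c0 := cos_th_gt0.
apply: integrable_ee; rewrite ?mulr_ge0 ?(ltW c0)//.
  by case: hv => h; [left; rewrite mulr_gt0|right].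
by case: hu => h; [left; rewrite mulr_gt0|right].
Qed.

Lemma cintegrable_zint u v a : 0 <= u -> 0 <= v -> 0 < v \/ a < 0 ->
  0 < u \/ 0 < a -> cintegrable leb setT (zint u v a).
Proof.
move=> u0 v0 hv hu; have i := integrable_ee_th u0 v0 hv hu.
apply: (le_cintegrable measurableT _ i); first exact: cmeasurable_zint.
by move=> y _; rewrite normc_zint.
Qed.

Lemma ZintN u v a : Zint u v a = Zint v u (- a).
Proof.
rewrite /Zint -(cintegral_opp (cmeasurable_zint u v a)).
apply: eq_cintegral => y _; rewrite /zint opprK mulrN mulNr.
by rewrite (addrC (u * _)).
Qed.

(** Translation by [ln r]. *)
Lemma Zint_scale u v a r : 0 <= u -> 0 <= v -> 0 < v \/ a < 0 -> 0 < u \/ 0 < a ->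
  0 < r -> Zint u v a = (r `^ a)%:C * Zint (u / r) (v * r) a.
Proof.
move=> u0 v0 hv hu r0.
have i : cintegrable leb setT (zint (u / r) (v * r) a).
  have r0' := ltW r0.
  apply: cintegrable_zint; [exact: divr_ge0|exact: mulr_ge0| |].
    by case: hv => h; [left; rewrite mulr_gt0|right].
  by case: hu => h; [left; rewrite divr_gt0|right].
rewrite /Zint -(cintegral_shift (ln r) (cmeasurable_zint u v a)).
rewrite -cintegralM//; apply: eq_cintegral => y _; rewrite /zint mulrCA.
congr (cexp (- (_ * _%:C)) * _).
  rewrite opprD !expRD expRN (expRN (ln r)) lnK ?posrE//; ring.
by rewrite -rmorphM/= {1}/powR gt_eqF// -expRD; congr (expR _)%:C; ring.
Qed.

Lemma is_cderive_Zint u v a : 0 <= u -> 0 < v -> 0 < u \/ 0 < a ->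
  is_cderive (fun w => Zint u w a) v (- eta * Zint u v (a + 1)).
Proof.
move=> u0 v0 hu; have c0 := cos_th_gt0.
have hu1 : 0 < u \/ 0 < a + 1.
  by case: hu => h; [left|right; rewrite addr_gt0].
have v20 : 0 < v / 2 by rewrite divr_gt0.
have iv : v / 2 < v < v * 2 by lra.
have ig : leb.-integrable setT (EFin \o ee (cos th * u) (cos th * (v / 2)) (a + 1)).
  by apply: integrable_ee_th; [by []|exact: ltW|left|].
have hi w : v / 2 < w < v * 2 -> cintegrable leb setT (zint u w a).
  move=> /andP[h _]; have w0 : 0 < w := lt_trans v20 h.
  by apply: cintegrable_zint; [by []|exact: ltW|left|].
have eE w y : - eta * zint u w (a + 1) y = - (eta * (expR y)%:C) * zint u w a y.
  rewrite /zint mulrDl mul1r expRD rmorphM/=; ring.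
have hd w y : v / 2 < w < v * 2 ->
    is_cderive (fun w => zint u w a y) w (- eta * zint u w (a + 1) y).
  move=> _; rewrite eE.
  have h : is_derive w 1 (fun w => u * expR (- y) + w * expR y) (expR y).
    by apply: is_derive_eq; rewrite /GRing.scale/=; ring.
  have h1 := is_cderive_cexp (is_cderiveN (is_cderiveZ eta (is_cderive_real h))).
  apply: is_cderive_ext (is_cderiveM h1 (is_cderive_cst _ w)) _.
  by rewrite mulr0 addr0 -mulrA.
have hb w y : v / 2 < w < v * 2 -> normc (- eta * zint u w (a + 1) y) <=
    ee (cos th * u) (cos th * (v / 2)) (a + 1) y.
  move=> /andP[h _]; rewrite normcM normcN normc_cis mul1r normc_zint.
  rewrite ler_expR lerD2l lerN2 lerD2l ler_wpM2r ?expR_ge0//.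
  by rewrite ler_wpM2l// ltW.
apply: is_cderive_ext (is_cderive_under_integral iv hi (fun w y => hd w y) ig
  (fun w y => hb w y)) _.
rewrite -cintegralM//; apply: cintegrable_zint; [by []|exact: ltW|by left|by []].
Qed.

Lemma ccvg_zint (u v : nat -> R) (u0 v0 a y : R) :
  u k @[k --> \oo] --> u0 -> v k @[k --> \oo] --> v0 ->
  ccvg (fun k => zint (u k) (v k) a y) (zint u0 v0 a y).
Proof.
move=> cu cv; apply: ccvgM (ccvg_cst _); apply/ccvg_cexp/ccvgN.
apply: ccvgM (ccvg_cst _) _; apply: ccvg_real.
by apply: cvgD; apply: cvgM => //; exact: cvg_cst.
Qed.

(** For [a < 0] the integrand is dominated by its modulus at [v = 0]. *)
Lemma cvg_Zint0 u (v : nat -> R) a : 0 < u -> a < 0 -> (forall k, 0 <= v k) ->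
  v k @[k --> \oo] --> (0 : R) -> ccvg (fun k => Zint u (v k) a) (Zint u 0 a).
Proof.
move=> u0 a0 v0 cv.
apply: (@ccvg_dominated _ _ _ leb setT _ _ (ee (cos th * u) (cos th * 0) a)) => //.
- by move=> k; exact: cmeasurable_zint.
- exact: cmeasurable_zint.
- by move=> y _; apply: ccvg_zint; [exact: cvg_cst|exact: cv].
- by apply: integrable_ee_th; [exact: ltW|by []|right|left].
- move=> k y _; rewrite normc_zint ler_expR lerD2l lerN2 lerD2l mulr0 mul0r.
  have c0 := cos_th_gt0.
  by rewrite mulr_ge0 ?expR_ge0// mulr_ge0// ltW.
Qed.

(** One of the two exponentials is gone: this is Euler's integral on a ray. *)
Lemma Zint0 v a : 0 < v -> 0 < a ->
  Zint 0 v a = (v `^ (- a))%:C * (cexp ('i%C * (- (a * th))%:C) * (gammaE a)%:C).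
Proof.
move=> v0 a0; rewrite (@Zint_scale 0 v a v^-1)//; [|exact: ltW|by left|by right|by rewrite invr_gt0].
congr (_%:C * _).
  by rewrite -powR_inv1 ?(ltW v0)// -powRrM mulN1r.
have [T T0 thT] : exists2 T, 0 < T < pi / 2 & - T < th < T.
  exists ((`|th| + pi / 2) / 2).
    have := normr_ge0 th; have : `|th| < pi / 2 by rewrite ltr_norml.
    by lra.
  have a1 := ler_norm th; have a2 := ler_norm (- th); rewrite normrN in a2.
  have : `|th| < pi / 2 by rewrite ltr_norml.
  by lra.
rewrite -(gamma_rotation a0 T0 thT) /Zint; apply: eq_cintegral => y _.
by rewrite /zint mul0r mul0r add0r divff ?gt_eqF// mul1r.
Qed.

End bessel_integral.

(** * Power series solution of the Bessel equation *)

Section comparison.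
Context {R : realType}.

Lemma ger0_derive_homo (G g : R -> R) (X : R) :
  (forall x : R, 0 < x < X -> is_derive x 1 G (g x)) ->
  (forall x, 0 < x < X -> 0 <= g x) ->
  forall x y, 0 < x -> x <= y -> y < X -> G x <= G y.
Proof.
move=> dG g0 x y x0; rewrite le_eqVlt => /predU1P[->//|xy] yX.
have sub r : r \in `[x, y] -> 0 < r < X.
  rewrite in_itv/= => /andP[xr ry].
  by rewrite (lt_le_trans x0)//= (le_lt_trans ry).
have cf : {within `[x, y], continuous G}.
  by apply: derivable_within_continuous => r /sub /dG [].
have [r hr E] := @MVT _ G g _ _ xy (fun r h => dG r (sub r (subset_itv_oo_cc h))) cf.
rewrite -subr_ge0 E mulr_ge0 ?subr_ge0 ?(ltW xy)// g0//.
exact: (sub r (subset_itv_oo_cc hr)).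
Qed.

(** Both [G - f] and [G + f] are nondecreasing, and their limits at 0 along [h]
    are nonnegative. *)
Lemma real_comparison (f f' G g : R -> R) (X : R) (h : nat -> R) :
  (forall x : R, 0 < x < X -> is_derive x 1 f (f' x)) ->
  (forall x : R, 0 < x < X -> is_derive x 1 G (g x)) ->
  (forall x, 0 < x < X -> `|f' x| <= g x) -> (forall x, 0 < x -> 0 <= G x) ->
  (forall k, 0 < h k) -> h k @[k --> \oo] --> (0 : R) ->
  f (h k) @[k --> \oo] --> (0 : R) ->
  forall x, 0 < x < X -> `|f x| <= G x.
Proof.
move=> df dG fg G0 h0 hc fc x /andP[x0 xX].
have nh : \forall k \near \oo, h k <= x.
  have := hc => /cvgrPdist_le/(_ x x0); apply: filterS => k.
  by rewrite sub0r normrN gtr0_norm.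
have m1 y : 0 < y -> y <= x -> G y - f y <= G x - f x.
  move=> y0 yx.
  apply: (@ger0_derive_homo (fun x => G x - f x) (fun x => g x - f' x) X) => //.
  - by move=> z hz; exact: (is_deriveB (dG z hz) (df z hz)).
  - move=> z hz; rewrite subr_ge0; exact: le_trans (ler_norm _) (fg z hz).
have m2 y : 0 < y -> y <= x -> G y + f y <= G x + f x.
  move=> y0 yx.
  apply: (@ger0_derive_homo (fun x => G x + f x) (fun x => g x + f' x) X) => //.
  - by move=> z hz; exact: (is_deriveD (dG z hz) (df z hz)).
  - move=> z hz; rewrite -[f' z]opprK subr_ge0.
    by apply: le_trans (ler_norm _) _; rewrite normrN fg.
have p1 : 0 <= G x + f x.
  apply: (ler_cvg_to fc (cvg_cst (G x + f x))).
  by move: nh; apply: filterS => k hk; rewrite (le_trans _ (m2 _ (h0 k) hk))// lerDr G0.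
have p2 : 0 <= G x - f x.
  have fN : - f (h k) @[k --> \oo] --> (0 : R).
    by have := cvgN fc; rewrite oppr0; exact.
  apply: (ler_cvg_to fN (cvg_cst (G x - f x))).
  by move: nh; apply: filterS => k hk; rewrite (le_trans _ (m1 _ (h0 k) hk))// lerDr G0.
by rewrite ler_norml; apply/andP; split; lra.
Qed.

(** The same for each part, hence the factor 2. *)
Lemma complex_comparison (f f' : R -> R[i]) (G g : R -> R) (X : R) (h : nat -> R) :
  (forall x : R, 0 < x < X -> is_cderive f x (f' x)) ->
  (forall x : R, 0 < x < X -> is_derive x 1 G (g x)) ->
  (forall x, 0 < x < X -> normc (f' x) <= g x) -> (forall x, 0 < x -> 0 <= G x) ->
  (forall k, 0 < h k) -> h k @[k --> \oo] --> (0 : R) ->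
  ccvg (fun k => f (h k)) 0 ->
  forall x, 0 < x < X -> normc (f x) <= 2 * G x.
Proof.
move=> df dG fg G0 h0 hc [rc ic] x hx.
rewrite (le_trans (normc_le_parts _))// mulr_natl mulr2n lerD//.
  apply: (@real_comparison (fun x => Re (f x)) (fun x => Re (f' x)) _ _ _ _ _ dG _ G0 h0 hc rc _ hx) => y hy.
    by case: (df y hy).
  by rewrite (le_trans (le_Re_normc _))// fg.
apply: (@real_comparison (fun x => Im (f x)) (fun x => Im (f' x)) _ _ _ _ _ dG _ G0 h0 hc ic _ hx) => y hy.
  by case: (df y hy).
by rewrite (le_trans (le_Im_normc _))// fg.
Qed.

Lemma is_cderive_sum n (F : nat -> R -> R[i]) (F' : nat -> R[i]) (x : R) :
  (forall k, is_cderive (F k) x (F' k)) ->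
  is_cderive (fun y => \sum_(k < n) F k y) x (\sum_(k < n) F' k).
Proof.
move=> dF; elim: n => [|n IH].
  by rewrite big_ord0; under eq_fun do rewrite big_ord0; exact: is_cderive_cst.
rewrite big_ord_recr; under eq_fun do rewrite big_ord_recr.
exact: is_cderiveD.
Qed.

Lemma is_derive_scale_powR (c a x : R) : 0 < x ->
  is_derive x 1 (fun y : R => c * y `^ a) (c * (a * x `^ (a - 1))).
Proof.
move=> x0; have h := is_derive1_powR a x0.
apply: is_derive_ext (is_deriveM (is_derive_cst c x 1) h) _.
by rewrite scaler0 addr0.
Qed.

Lemma is_cderive_powR (c : R[i]) (a x : R) : 0 < x ->
  is_cderive (fun y => c * (y `^ a)%:C) x (c * (a * x `^ (a - 1))%:C).
Proof.
by move=> x0; apply: is_cderiveZ; apply: is_cderive_real; exact: is_derive1_powR.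
Qed.

End comparison.

Section frobenius.
Context {R : realType}.
Variables (kappa : R[i]) (s : R).
Hypothesis s01 : 0 < s < 1.

(** Coefficients of the solution [\sum_k frob rho a0 k * x ^ k], up to a power of
    [x], of the equation [Y' = x ^ (s - 1) * V], [V' = kappa * x ^ (- s) * Y]; the
    exponents at 0 of this system are 0 and [s]. *)
Fixpoint frob (rho : R) (a0 : R[i]) (n : nat) : R[i] :=
  if n is k.+1 then
    kappa * frob rho a0 k / (k.+1%:R * (k.+1%:R + rho))%:C
  else a0.

Lemma frobS rho a0 k : frob rho a0 k.+1 =
  kappa * frob rho a0 k / (k.+1%:R * (k.+1%:R + rho))%:C.
Proof. by []. Qed.

Lemma frobM rho a0 k : 0 < k.+1%:R + rho ->
  frob rho a0 k.+1 * (k.+1%:R * (k.+1%:R + rho))%:C = kappa * frob rho a0 k.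
Proof.
move=> r0; rewrite frobS divfK// eq_complex/= eqxx andbT mulf_neq0//.
by rewrite gt_eqF.
Qed.

Variables (Y V : R -> R[i]) (a0 v0 : R[i]) (h : nat -> R) (X B : R).
Hypothesis dY : forall x, 0 < x -> is_cderive Y x ((x `^ (s - 1))%:C * V x).
Hypothesis dV : forall x, 0 < x -> is_cderive V x (kappa * (x `^ (- s))%:C * Y x).
Hypothesis h_gt0 : forall k, 0 < h k.
Hypothesis cvg_h : h k @[k --> \oo] --> (0 : R).
Hypothesis cvgY : ccvg (fun k => Y (h k)) a0.
Hypothesis cvgV : ccvg (fun k => V (h k)) v0.
Hypothesis boundY : forall x, 0 < x < X -> normc (Y x) <= B.

Let al := frob (- s) a0.
Let be := frob s (v0 / s%:C).

(** The remainders of the two partial expansions. Differentiating [Vn n.+1]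
    removes its leading terms and leaves [Yn n]. *)
Let Yn n x := Y x -
  \sum_(k < n) (al k * (x `^ k%:R)%:C + be k * (x `^ (k%:R + s))%:C).
Let Vn n x := V x -
  \sum_(k < n) (al k * (k%:R * x `^ (k%:R - s))%:C +
                be k * ((k%:R + s) * x `^ k%:R)%:C).

Lemma is_cderive_Yn n x : 0 < x -> is_cderive (Yn n) x ((x `^ (s - 1))%:C * Vn n x).
Proof.
move=> x0.
have := is_cderive_sum n (fun k => is_cderiveD (is_cderive_powR (al k) k%:R x0)
  (is_cderive_powR (be k) (k%:R + s) x0)).
move=> /is_cderiveN /(is_cderiveD (dY x0)) h1; apply: is_cderive_ext h1 _.
rewrite mulrBr; congr (_ - _); rewrite mulr_sumr; apply: eq_bigr => k _.
rewrite mulrDr; congr (_ + _); rewrite mulrCA; congr (_ * _); rewrite -rmorphM/=;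
  congr (_%:C); rewrite mulrCA; congr (_ * _); rewrite -powRD ?(gt_eqF x0) ?implybT//;
  congr (_ `^ _); ring.
Qed.

Lemma is_cderive_Vn n x : 0 < x ->
  is_cderive (Vn n.+1) x (kappa * (x `^ (- s))%:C * Yn n x).
Proof.
move=> x0; have s0 : 0 < s by case/andP: s01.
have s1 : s < 1 by case/andP: s01.
have d k : is_cderive (fun x => al k * (k%:R * x `^ (k%:R - s))%:C +
    be k * ((k%:R + s) * x `^ k%:R)%:C) x
    (al k * (k%:R * ((k%:R - s) * x `^ (k%:R - s - 1)))%:C +
     be k * ((k%:R + s) * (k%:R * x `^ (k%:R - 1)))%:C).
  have e1 := is_cderiveZ (k%:R)%:C (is_cderive_powR (al k) (k%:R - s) x0).
  have e2 := is_cderiveZ (k%:R + s)%:C (is_cderive_powR (be k) k%:R x0).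
  have := is_cderiveD e1 e2.
  under eq_fun do rewrite !(mulrCA _%:C) -!rmorphM/=.
  by rewrite !(mulrCA _%:C) -!rmorphM.
have := is_cderive_sum n.+1 d.
move=> /is_cderiveN /(is_cderiveD (dV x0)) h1; apply: is_cderive_ext h1 _.
rewrite mulrBr; congr (_ - _); rewrite big_ord_recl /= mul0r mulr0 mul0r !mulr0 !add0r.
rewrite mulr_sumr; apply: eq_bigr => k _.
have rp p q : p = q - s -> x `^ p = x `^ (- s) * x `^ q.
  by move=> ->; rewrite -powRD ?(gt_eqF x0) ?implybT// addrC.
have n0 : 0 < k.+1%:R :> R by rewrite ltr0n.
have n1 : 1 <= k.+1%:R :> R by rewrite ler1n.
have kE : k.+1%:R - 1 = k%:R :> R by rewrite -natr1 addrK.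
rewrite -[bump 0 k]/k.+1 (rp (k.+1%:R - s - 1) k%:R); last by rewrite addrAC kE.
rewrite (rp (k.+1%:R - 1) (k%:R + s)); last by rewrite kE addrK.
rewrite [RHS]mulrDr; congr (_ + _).
  rewrite [_ * (_ * (_ * _))]mulrA rmorphM/= mulrA frobM; last by lra.
  by rewrite rmorphM/= -/(al k); ring.
rewrite [(_ + s) * _]mulrCA mulrA rmorphM/= mulrA frobM; last by lra.
by rewrite rmorphM/= -/(be k); ring.
Qed.

Lemma cvg_powR_h a : 0 < a -> h k `^ a @[k --> \oo] --> (0 : R).
Proof.
move=> a_gt0; have := powR_cvg0 a_gt0 => /cvg_at_rightP; apply; split => //.
Qed.

Lemma ccvg_sum_head (u : nat -> nat -> R[i]) (l : R[i]) n :
  ccvg (u 0%N) l -> (forall k, ccvg (u k.+1) 0) ->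
  ccvg (fun j => \sum_(k < n.+1) u k j) l.
Proof.
move=> u0 uS; under eq_fun do rewrite big_ord_recl.
rewrite -[l]addr0; apply: ccvgD => //.
have := @ccvg_sum _ n (fun i j => u (lift ord0 i) j) (fun=> 0) (fun k => uS k).
by rewrite [X in ccvg _ X]big1.
Qed.

Lemma ccvg_Yn n : ccvg (fun j => Yn n.+1 (h j)) 0.
Proof.
have /andP[s0 s1] := s01.
rewrite -(subrr a0); apply: ccvgB => //.
apply: (@ccvg_sum_head (fun k j => al k * (h j `^ k%:R)%:C + be k * (h j `^ (k%:R + s))%:C)).
  rewrite -[a0]addr0; apply: ccvgD.
    rewrite -[a0]mulr1; apply: ccvgM; first exact: ccvg_cst.
    under eq_fun do rewrite powRr0.
    exact: ccvg_cst.
  rewrite -(mulr0 (be 0)); apply: ccvgM; first exact: ccvg_cst.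
  by apply: ccvg_real; apply: cvg_powR_h; rewrite add0r.
move=> k; rewrite -[0]addr0; apply: ccvgD.
  rewrite -(mulr0 (al k.+1)); apply: ccvgM; first exact: ccvg_cst.
  by apply: ccvg_real; apply: cvg_powR_h.
rewrite -(mulr0 (be k.+1)); apply: ccvgM; first exact: ccvg_cst.
by apply: ccvg_real; apply: cvg_powR_h; rewrite addr_gt0.
Qed.

Lemma ccvg_Vn n : ccvg (fun j => Vn n.+1 (h j)) 0.
Proof.
have /andP[s0 s1] := s01.
rewrite -(subrr v0); apply: ccvgB => //.
apply: (@ccvg_sum_head (fun k j => al k * (k%:R * h j `^ (k%:R - s))%:C +
  be k * ((k%:R + s) * h j `^ k%:R)%:C)).
  under eq_fun do rewrite mul0r mulr0 add0r powRr0 mulr1 add0r.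
  rewrite /be/= divfK; first exact: ccvg_cst.
  by rewrite eq_complex/= eqxx andbT gt_eqF.
move=> k; have k1 : 1 <= k.+1%:R :> R by rewrite ler1n.
rewrite -[0]addr0; apply: ccvgD.
  rewrite -(mulr0 (al k.+1)); apply: ccvgM; first exact: ccvg_cst.
  apply: (@ccvg_real _ _ 0); rewrite -(mulr0 k.+1%:R); apply: cvgM; first exact: cvg_cst.
  by apply: cvg_powR_h; lra.
rewrite -(mulr0 (be k.+1)); apply: ccvgM; first exact: ccvg_cst.
apply: (@ccvg_real _ _ 0); rewrite -(mulr0 (k.+1%:R + s)); apply: cvgM; first exact: cvg_cst.
by apply: cvg_powR_h; lra.
Qed.

(** The remainder vanishes at 0, and integrating the bound on the [n]-th one
    twice bounds the next one. *)
Lemma normc_Yn n x : 0 < x < X ->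
  normc (Yn n x) <= B * (4 * normc kappa / (1 - s)) ^+ n / n`!%:R * x `^ n%:R.
Proof.
have /andP[s0 s1] := s01.
elim: n x => [|n IH] x xX.
  by rewrite /Yn big_ord0 subr0 fact0 divr1 expr0 mulr1 powRr0 mulr1 boundY.
have B0 : 0 <= B.
  by have := boundY xX; apply: le_trans; exact: normc_ge0.
set Bn := B * _ / _ in IH.
have Bn0 : 0 <= Bn.
  have s1' : 0 <= 1 - s by rewrite subr_ge0 ltW.
  rewrite /Bn divr_ge0// mulr_ge0// exprn_ge0// divr_ge0//.
  by rewrite mulr_ge0// normc_ge0.
have [q qE] : exists q, q = n.+1%:R - s by exists (n.+1%:R - s).
pose K := normc kappa.
have K0 : 0 <= K by exact: normc_ge0.
have n1 : 1 <= n.+1%:R :> R by rewrite ler1n.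
have q1 : 1 - s <= q by rewrite qE lerD2r.
have q0 : 0 < q by rewrite (lt_le_trans _ q1)// subr_gt0.
have bV y : 0 < y < X -> normc (Vn n.+1 y) <= 2 * (K * Bn / q * y `^ q).
  move=> yX.
  apply: (@complex_comparison _ (Vn n.+1) (fun x => kappa * (x `^ (- s))%:C * Yn n x)
    (fun x => K * Bn / q * x `^ q) (fun x => K * Bn / q * (q * x `^ (q - 1))) X h
    _ _ _ _ h_gt0 cvg_h (ccvg_Vn n) y yX).
  - by move=> z /andP[z0 _]; exact: is_cderive_Vn.
  - move=> z /andP[z0 _].
    exact: is_derive_scale_powR.
  - move=> z zX; have /andP[z0 _] := zX.
    rewrite !normcM normc_real ger0_norm ?powR_ge0// -/K.
    rewrite (_ : K * Bn / q * _ = K * z `^ (- s) * (Bn * z `^ n%:R)).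
      by rewrite ler_wpM2l ?IH// mulr_ge0// powR_ge0.
    rewrite (_ : q - 1 = - s + n%:R); last by rewrite qE -natr1; ring.
    rewrite powRD; last by rewrite (gt_eqF z0) implybT.
    by rewrite mulrA (divfK (lt0r_neq0 q0)); ring.
  - move=> z z0; apply: mulr_ge0; last exact: powR_ge0.
    by rewrite divr_ge0 ?(ltW q0)// mulr_ge0.
pose M := 2 * (K * Bn / q) / n.+1%:R.
have q0' := ltW q0.
have M0 : 0 <= M by rewrite divr_ge0// mulr_ge0// divr_ge0// mulr_ge0.
have bY : normc (Yn n.+1 x) <= 2 * (M * x `^ n.+1%:R).
  apply: (@complex_comparison _ (Yn n.+1) (fun x => (x `^ (s - 1))%:C * Vn n.+1 x)
    (fun x => M * x `^ n.+1%:R) (fun x => M * (n.+1%:R * x `^ (n.+1%:R - 1))) X h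
    _ _ _ _ h_gt0 cvg_h (ccvg_Yn n) x xX).
  - by move=> z /andP[z0 _]; exact: is_cderive_Yn.
  - move=> z /andP[z0 _].
    exact: is_derive_scale_powR.
  - move=> z zX; have /andP[z0 _] := zX.
    rewrite normcM normc_real ger0_norm ?powR_ge0//.
    rewrite (_ : M * _ = z `^ (s - 1) * (2 * (K * Bn / q * z `^ q))).
      by rewrite ler_wpM2l ?bV// powR_ge0.
    rewrite (_ : n.+1%:R - 1 = s - 1 + q); last by rewrite qE; ring.
    rewrite powRD; last by rewrite (gt_eqF z0) implybT.
    have E (a m w u : R) : m != 0 -> 2 * a / m * (m * (u * w)) = u * (2 * (a * w)).
      by move=> m0; field.
    by rewrite /M E// pnatr_eq0.
  - by move=> z z0; rewrite mulr_ge0 ?powR_ge0.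
apply: (le_trans bY); rewrite mulrA ler_wpM2r ?powR_ge0//.
rewrite exprS factS natrM.
have E1 (b e k f m d : R) : f != 0 -> m != 0 -> d != 0 ->
    b * (4 * k / d * e) / (m * f) = 4 * k * (b * e / f) / m * d^-1.
  by move=> f0 m0 d0; field; rewrite ?f0 ?m0 ?d0.
have E2 (b k m d : R) : m != 0 -> d != 0 ->
    2 * (2 * (k * b / d) / m) = 4 * k * b / m * d^-1.
  by move=> m0 d0; field; rewrite ?m0 ?d0.
have s1' : 0 < 1 - s by rewrite subr_gt0.
rewrite E1 ?pnatr_eq0 -?lt0n ?fact_gt0// ?gt_eqF//.
rewrite /M E2 ?pnatr_eq0 ?gt_eqF// ler_wpM2l//.
  by rewrite divr_ge0// mulr_ge0// mulr_ge0.
by rewrite lef_pV2 ?posrE.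
Qed.

(** The expansion converges, at a rate that depends on [Y] and [V] through the
    bound [B] and on [kappa] through its modulus. *)
Theorem frobenius_remainder n x : 0 < x < X ->
  normc (Y x - \sum_(k < n) (frob (- s) a0 k * (x `^ k%:R)%:C +
    frob s (v0 / s%:C) k * (x `^ (k%:R + s))%:C)) <=
  B * (4 * normc kappa / (1 - s)) ^+ n / n`!%:R * x `^ n%:R.
Proof. exact: normc_Yn. Qed.

End frobenius.

(** * Truncated integrals *)

Section interval_calculus.
Context {R : realType}.
Local Notation leb := (@lebesgue_measure R).

Definition cdiff (f : R -> R[i]) (x : R) := exists l, is_cderive f x l.

Lemma cdiff_cst c x : cdiff (fun=> c) x.
Proof. by eexists; exact: is_cderive_cst. Qed.

Lemma cdiffD f g x : cdiff f x -> cdiff g x -> cdiff (fun y => f y + g y) x.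
Proof. by move=> [l df] [m dg]; eexists; exact: is_cderiveD df dg. Qed.

Lemma cdiffM f g x : cdiff f x -> cdiff g x -> cdiff (fun y => f y * g y) x.
Proof. by move=> [l df] [m dg]; eexists; exact: is_cderiveM df dg. Qed.

Lemma cdiff_powR a x : 0 < x -> cdiff (fun y => (y `^ a)%:C) x.
Proof.
by move=> x0; eexists; apply: is_cderive_real; exact: is_derive1_powR.
Qed.

Lemma cdiff_continuous f x : cdiff f x ->
  {for x, continuous (fun y => Re (f y))} /\ {for x, continuous (fun y => Im (f y))}.
Proof.
move=> [l [[dr _] [di _]]].
by split; apply/differentiable_continuous/derivable1_diffP.
Qed.

Lemma is_derive_continuous (f : R -> R) (x l : R) : is_derive x 1 f l ->
  {for x, continuous f}.
Proof. by move=> [h _]; apply/differentiable_continuous/derivable1_diffP. Qed.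

Lemma continuous_itv (f : R -> R) (a b : R) :
  (forall x, a <= x <= b -> {for x, continuous f}) ->
  {within `[a, b], continuous f}.
Proof.
by move=> cf; apply: continuous_in_subspaceT => x /set_mem/=; rewrite in_itv/=; exact: cf.
Qed.

Lemma integrable_itv (f : R -> R) (a b : R) :
  (forall x, a <= x <= b -> {for x, continuous f}) ->
  leb.-integrable `[a, b] (EFin \o f).
Proof.
move=> cf; apply: continuous_compact_integrable; first exact: segment_compact.
exact: continuous_itv.
Qed.

Lemma Rintegral_itv_cat (f : R -> R) (a b c : R) : a <= b -> b <= c ->
  (forall x, a <= x <= c -> {for x, continuous f}) ->
  \int[leb]_(x in `[a, c]) f x =
  \int[leb]_(x in `[a, b]) f x + \int[leb]_(x in `[b, c]) f x.
Proof.
move=> ab bc cf; have i := integrable_itv cf.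
rewrite -(@Rintegral_itv_obnd_cbnd _ b); last first.
  apply: (integrableS _ _ _ i) => //.
  by move=> x /=; rewrite !in_itv/= => /andP[h ->]; rewrite andbT (le_trans ab (ltW h)).
rewrite -(Rintegral_itvB i) ?bnd_simp//.
by rewrite addrC subrK.
Qed.

Lemma Rintegral_FTC (F f : R -> R) (a b : R) : a <= b ->
  (forall x : R, a <= x <= b -> is_derive x 1 F (f x)) ->
  (forall x, a <= x <= b -> {for x, continuous f}) ->
  \int[leb]_(x in `[a, b]) f x = F b - F a.
Proof.
rewrite le_eqVlt => /predU1P[<-|ab] dF cf.
  by rewrite set_itv1 /Rintegral integral_set1 subrr.
rewrite /Rintegral (@continuous_FTC2 _ f F a b)//.
- exact: continuous_itv.
- have ca : {for a, continuous F}.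
    by apply: is_derive_continuous (dF a _); rewrite lexx ltW.
  have cb : {for b, continuous F}.
    by apply: is_derive_continuous (dF b _); rewrite lexx ltW.
  split.
  + move=> x; rewrite in_itv/= => /andP[h1 h2].
    by case: (dF x); rewrite ?(ltW h1) ?(ltW h2).
  + exact: cvg_at_right_filter.
  + exact: cvg_at_left_filter.
- move=> x; rewrite in_itv/= => /andP[h1 h2]; rewrite derive1E.
  by case: (dF x); rewrite ?(ltW h1) ?(ltW h2).
Qed.

Variables (f : R -> R[i]) (a b : R).
Hypothesis ab : a <= b.
Hypothesis df : forall x, a <= x <= b -> cdiff f x.

Lemma cintegrable_itv : cintegrable leb `[a, b] f.
Proof. by split; apply: integrable_itv => x /df/cdiff_continuous[]. Qed.

Lemma cintegral_itv_cat c : a <= c -> c <= b ->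
  cintegral leb `[a, b] f = cintegral leb `[a, c] f + cintegral leb `[c, b] f.
Proof.
move=> ac cb; apply: complex_ext; rewrite ?ReD ?ImD;
  by apply: Rintegral_itv_cat => // x /df/cdiff_continuous[].
Qed.

Lemma cintegral_FTC F : (forall x, a <= x <= b -> is_cderive F x (f x)) ->
  cintegral leb `[a, b] f = F b - F a.
Proof.
move=> dF; apply: complex_ext; rewrite ?ReD ?ImD ?ReN ?ImN.
  apply: (Rintegral_FTC (F := fun x => Re (F x))) => // x hx; first by case: (dF x hx).
  by case: (cdiff_continuous (df hx)).
apply: (Rintegral_FTC (F := fun x => Im (F x))) => // x hx; first by case: (dF x hx).
by case: (cdiff_continuous (df hx)).
Qed.

Lemma normc_cintegral_itv (G g : R -> R) :
  (forall x : R, a <= x <= b -> is_derive x 1 G (g x)) ->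
  (forall x, a <= x <= b -> {for x, continuous g}) ->
  (forall x, a <= x <= b -> normc (f x) <= g x) ->
  normc (cintegral leb `[a, b] f) <= 2 * (G b - G a).
Proof.
move=> dG cg fg; rewrite -(Rintegral_FTC ab dG cg).
apply: normc_cintegral_le; [exact: measurable_itv|exact: cintegrable_itv|exact: integrable_itv|].
by move=> x /=; rewrite in_itv/=; exact: fg.
Qed.

End interval_calculus.

Section truncation.
Context {R : realType}.
Local Notation leb := (@lebesgue_measure R).
Variables (c sg x : R).
Hypothesis c_gt0 : 0 < c.
Hypothesis sg_gt0 : 0 < sg.
Hypothesis sg_lt1 : sg < 1.
Hypothesis x_gt0 : 0 < x.

Definition wave (th s : R) : R[i] := cexp (- (cexp ('i%C * th%:C) * (c / s + x * s)%:C)).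

(** At [th = pi / 2], and for [x = |xi| ^ 2], the symbol of the integral over
    [e <= s <= r] in the theorem; for smaller [th] the integral over the half-line
    converges absolutely. *)
Definition truncated (th e r : R) : R[i] :=
  cintegral leb `[e, r] (fun s => wave th s * (s `^ (- (1 + sg)))%:C).

Variable th : R.
Hypothesis th_bound : - (pi / 2) < th < pi / 2.
Let eta : R[i] := cexp ('i%C * th%:C).
Let h (s : R) := wave th s * (s `^ (- (1 + sg)))%:C.

Lemma normc_wave s : 0 < s -> normc (wave th s) <= 1.
Proof.
move=> s0; rewrite /wave normc_cexp -[leRHS]expR0 ler_expR ReN ReM Re_cis Re_real Im_real.
rewrite mulr0 subr0 oppr_le0 mulr_ge0 ?(ltW (cos_gt0_pihalf th_bound))//.
by rewrite addr_ge0// ltW// ?divr_gt0// mulr_gt0.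
Qed.

Lemma is_cderive_wave s : 0 < s ->
  is_cderive (wave th) s (eta * (c * s `^ (- 2) - x)%:C * wave th s).
Proof.
move=> s0.
have hv := @is_deriveV R (fun s : R => s) s 1 1 (lt0r_neq0 s0) (is_derive_id s 1).
have h1 := is_deriveD (is_deriveM (is_derive_cst c s 1) hv)
  (is_deriveM (is_derive_cst x s 1) (is_derive_id s 1)).
have h2 := is_cderive_cexp (is_cderiveN (is_cderiveZ eta (is_cderive_real h1))).
apply: is_cderive_ext h2 _; congr (_ * _); rewrite -mulrN -rmorphN/=; congr (_ * _%:C).
rewrite /GRing.scale/= powRN powR_mulrn ?(ltW s0)//; ring.
Qed.

Lemma cdiff_wave s : 0 < s -> cdiff (wave th) s.
Proof. by move=> s0; eexists; exact: is_cderive_wave. Qed.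

Lemma cdiff_h s : 0 < s -> cdiff h s.
Proof. by move=> s0; apply: cdiffM; [exact: cdiff_wave|exact: cdiff_powR]. Qed.

Lemma truncated_upper (r r' : R) : 1 <= r -> r <= r' ->
  normc (cintegral leb `[r, r'] h) <= 2 / sg * r `^ (- sg).
Proof.
move=> r1 rr.
have p s : r <= s <= r' -> 0 < s.
  by move=> /andP[h1 _]; rewrite (lt_le_trans _ h1)// (lt_le_trans _ r1).
have := @normc_cintegral_itv _ h r r' rr _ (fun s => (- sg^-1) * s `^ (- sg))
  (fun s => s `^ (- (1 + sg))) _ _ _.
move=> /(_ (fun s hs => cdiff_h (p s hs))) H.
apply: (le_trans (H _ _ _)).
- move=> s hs; apply: is_derive_ext (is_derive_scale_powR (- sg^-1) (- sg) (p s hs)) _.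
  by rewrite mulrA mulrNN mulVf ?gt_eqF// mul1r; congr (_ `^ _); ring.
- by move=> s hs; apply: continuous_powR; exact: p hs.
- move=> s hs; rewrite normcM normc_real ger0_norm ?powR_ge0//.
  by rewrite ler_piMl ?powR_ge0// normc_wave// (p s hs).
- rewrite -mulrA ler_pM2l// -mulrBr mulNr -mulrN opprB.
  by rewrite ler_pM2l ?invr_gt0// gerBl powR_ge0.
Qed.

(** Near 0 the integrand is not absolutely integrable uniformly in [th]. One
    integration by parts against the oscillation of [e ^ (- eta c / s)] gains a
    factor [s], with constants that do not depend on [th]. *)
Lemma truncated_lower (e' e : R) : 0 < e' -> e' <= e -> e <= 1 ->
  normc (cintegral leb `[e', e] h) <= (4 + 2 * x / (1 - sg)) / c * e `^ (1 - sg).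
Proof.
move=> e0 ee e1.
have s1 : 0 < 1 - sg by rewrite subr_gt0.
have p s : e' <= s <= e -> 0 < s by move=> /andP[/(lt_le_trans e0)].
have eta0 : eta != 0 by exact: cexp_neq0.
have c0 : c%:C != 0 :> R[i] by rewrite eq_complex/= eqxx andbT gt_eqF.
pose k := (eta * c%:C)^-1.
have nk : normc k = c^-1.
  by rewrite normcV normcM normc_cis mul1r normc_real gtr0_norm.
(* [P' = h - Q] with [Q] of order [s ^ (- sigma)] at 0 *)
pose P s := k * (wave th s * (s `^ (1 - sg))%:C).
pose Q s := (- k * ((1 - sg)%:C * (s `^ (- sg))%:C) + (x / c)%:C * (s `^ (1 - sg))%:C) * wave th s.
have dP s : 0 < s -> is_cderive P s (h s - Q s).
  move=> s0; have hp := is_cderive_real (is_derive1_powR (1 - sg) s0).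
  apply: is_cderive_ext (is_cderiveZ k (is_cderiveM (is_cderive_wave s0) hp)) _.
  have E1 : s `^ (1 - sg) * s `^ (- 2) = s `^ (- (1 + sg)).
    by rewrite -powRD ?(gt_eqF s0) ?implybT//; congr (_ `^ _); ring.
  have E2 : k * eta = (c%:C)^-1 by rewrite /k invfM mulrAC mulVf// mul1r.
  have E3 : (1 - sg - 1 = - sg :> R) by ring.
  have E4 : (s `^ (- (1 + sg)))%:C =
      k * eta * c%:C * ((s `^ (1 - sg))%:C * (s `^ (- 2))%:C).
    by rewrite E2 mulVf// mul1r -rmorphM/= E1.
  have E5 : (x / c)%:C = x%:C * (k * eta) by rewrite E2 rmorphM/= fmorphV.
  rewrite /h /Q E4 E5 E3 !rmorphB !rmorphM /= !rmorphB /=; ring.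
have dQ s : 0 < s -> cdiff Q s.
  move=> s0; apply: cdiffM; last exact: cdiff_wave.
  apply: cdiffD; apply: cdiffM; [exact: cdiff_cst| |exact: cdiff_cst|exact: cdiff_powR].
  by apply: cdiffM; [exact: cdiff_cst|exact: cdiff_powR].
have nP s : 0 < s -> normc (P s) <= c^-1 * s `^ (1 - sg).
  move=> s0; rewrite normcM nk ler_wpM2l// ?invr_ge0 ?(ltW c_gt0)//.
  rewrite normcM normc_real ger0_norm ?powR_ge0//.
  by rewrite ler_piMl ?powR_ge0// normc_wave.
have nQ s : e' <= s <= e -> normc (Q s) <= (1 - sg + x) / c * s `^ (- sg).
  move=> hs; have s0 := p s hs.
  have le1 : s <= 1 by case/andP: hs => _ /le_trans; exact.
  rewrite normcM (@le_trans _ _ (normc (- k * ((1 - sg)%:C * (s `^ (- sg))%:C) +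
    (x / c)%:C * (s `^ (1 - sg))%:C)))//.
    by rewrite ler_piMr ?normc_ge0// normc_wave.
  rewrite (le_trans (le_normcD _ _))// !normcM normcN nk !normc_real.
  rewrite !ger0_norm ?powR_ge0 ?(ltW s1)//; last by rewrite divr_ge0// ltW.
  rewrite (_ : (1 - sg + x) / c * _ = c^-1 * ((1 - sg) * s `^ (- sg)) +
    x / c * s `^ (- sg)); last by ring.
  rewrite lerD2l.
  rewrite ler_wpM2l//; first by rewrite divr_ge0// ltW.
  rewrite powRD ?(gt_eqF s0) ?implybT// powRr1 ?(ltW s0)//.
  by rewrite ler_piMl ?powR_ge0.
have E : cintegral leb `[e', e] h = P e - P e' + cintegral leb `[e', e] Q.
  have iQ := cintegrable_itv (fun s hs => dQ s (p s hs)).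
  have ih := cintegrable_itv (fun s hs => cdiff_h (p s hs)).
  rewrite -(@cintegral_FTC _ (fun s => h s - Q s) e' e ee _ P); last 2 first.
  - move=> s /p s0; apply: cdiffD; first exact: cdiff_h.
    have := cdiffM (cdiff_cst (-1) s) (dQ s s0).
    by under eq_fun do rewrite mulN1r.
  - by move=> s /p; exact: dP.
  by rewrite cintegralB ?subrK.
have e0' : 0 < e by exact: lt_le_trans ee.
rewrite E (le_trans (le_normcD _ _))//.
have B1 : normc (P e - P e') <= 2 / c * e `^ (1 - sg).
  rewrite (le_trans (le_normcD _ _))// normcN.
  rewrite (@le_trans _ _ (c^-1 * e `^ (1 - sg) + c^-1 * e' `^ (1 - sg)))//.
    by rewrite lerD// nP.
  rewrite (_ : 2 / c * _ = c^-1 * e `^ (1 - sg) + c^-1 * e `^ (1 - sg)); last by ring.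
  rewrite lerD2l ler_wpM2l ?invr_ge0 ?(ltW c_gt0)//.
  by apply: ge0_ler_powR; rewrite ?nnegrE ?(ltW s1) ?(ltW e0) ?(ltW e0').
have B2 : normc (cintegral leb `[e', e] Q) <=
    2 * ((1 - sg + x) / c / (1 - sg) * e `^ (1 - sg)).
  have := @normc_cintegral_itv _ Q e' e ee _
    (fun s => (1 - sg + x) / c / (1 - sg) * s `^ (1 - sg))
    (fun s => (1 - sg + x) / c * s `^ (- sg)) _ _ nQ.
  move=> /(_ (fun s hs => dQ s (p s hs))) H; apply: (le_trans (H _ _)).
  - move=> s hs; apply: is_derive_ext (is_derive_scale_powR _ (1 - sg) (p s hs)) _.
    rewrite mulrA divfK ?gt_eqF//; congr (_ * _ `^ _); ring.
  - move=> s hs; apply: cvgM; first exact: cvg_cst.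
    by apply: continuous_powR; exact: p hs.
  - rewrite ler_pM2l// gerBl mulr_ge0 ?powR_ge0// divr_ge0 ?(ltW s1)//.
    by rewrite divr_ge0 ?(ltW c_gt0)// addr_ge0 ?(ltW s1) ?(ltW x_gt0).
apply: (le_trans (lerD B1 B2)); rewrite le_eqVlt; apply/orP; left; apply/eqP.
by field; rewrite !gt_eqF.
Qed.

(** The substitution [s = e ^ y]. *)
Lemma truncated_expR (n : nat) : truncated th (expR (- n%:R)) (expR n%:R) =
  cintegral leb `[- n%:R, n%:R] (zint th c x (- sg)).
Proof.
have nn : - n%:R <= n%:R :> R by rewrite ge0_cp.
have hE y : h (expR y) * (expR y)%:C = zint th c x (- sg) y.
  rewrite /h /wave /zint -expRN -mulrA; congr (_ * _).
  by rewrite -expRM -rmorphM/= -expRD; congr (expR _)%:C; ring.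
have E (p : R[i] -> R) : (forall z (r : R), p (z * r%:C) = p z * r) ->
    (forall s, 0 < s -> {for s, continuous (fun s => p (h s))}) ->
    \int[leb]_(s in `[expR (- n%:R), expR n%:R]) p (h s) =
    \int[leb]_(y in `[- n%:R, n%:R]) p (zint th c x (- sg) y).
  move=> pM pc; rewrite /Rintegral (integral_exp_itv pc nn); congr fine.
  by apply: eq_integral => y _; rewrite -pM hE.
apply: complex_ext; apply: E.
- exact: ReMr.
- by move=> s /cdiff_h/cdiff_continuous[].
- exact: ImMr.
- by move=> s /cdiff_h/cdiff_continuous[].
Qed.

Lemma ccvg_truncated : ccvg (fun n => truncated th (expR (- n%:R)) (expR n%:R))
  (Zint th c x (- sg)).
Proof.
have cth := cos_gt0_pihalf th_bound.
pose z := zint th c x (- sg).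
pose ind (n : nat) (y : R) : R := \1_`[- n%:R, n%:R]%classic y.
have -> : (fun n => truncated th (expR (- n%:R)) (expR n%:R)) =
    (fun n => cintegral leb setT (fun y => z y * (ind n y)%:C)).
  by apply/funext => n; rewrite truncated_expR cintegral_mkcond.
apply: (@ccvg_dominated _ _ _ leb setT _ z (ee (cos th * c) (cos th * x) (- sg))) => //.
- move=> n; apply: cmeasurableM; first exact: cmeasurable_zint.
  by apply: cmeasurable_real; exact: measurable_indic.
- exact: cmeasurable_zint.
- move=> y _; rewrite -[X in ccvg _ X]mulr1; apply: ccvgM; first exact: ccvg_cst.
  apply: ccvg_real; apply: cvg_near_cst.
  exists (Num.trunc `|y|).+1 => // n /= hn; rewrite /ind indicE mem_set//= in_itv/= -ler_norml.
  apply/ltW/(lt_le_trans (truncnS_gt _)); rewrite ler_nat//.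
- by apply: integrable_ee_th => //; [exact: ltW|exact: ltW|left|left].
- move=> n y _; rewrite normcM normc_zint normc_real /ind indicE.
  by case: (y \in _); rewrite ?normr1 ?normr0 ?mulr1 ?mulr0// ltW// ee_gt0.
Qed.

Definition trunc_cst := (4 + 2 / (1 - sg)) / c + 2 / sg.

(** The constant is uniform in [th], which may therefore tend to [pi / 2]. *)
Lemma truncated_dist e r : 0 < e -> e <= 1 -> 1 <= r ->
  normc (Zint th c x (- sg) - truncated th e r) <=
  trunc_cst * (1 + x) * (e `^ (1 - sg) + r `^ (- sg)).
Proof.
move=> e0 e1 r1; have s1 : 0 < 1 - sg by rewrite subr_gt0.
have er : e <= r by exact: le_trans r1.
have hl := ccvg_normc (ccvgB ccvg_truncated (ccvg_cst (truncated th e r))).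
have near1 : \forall n \near \oo, expR (- n%:R) <= e /\ r <= expR n%:R.
  exists (Num.trunc (`|ln e| + `|ln r|)).+1 => // n /= hn.
  have := truncnS_gt (`|ln e| + `|ln r|).
  have : (Num.trunc (`|ln e| + `|ln r|)).+1%:R <= n%:R :> R by rewrite ler_nat.
  have := ler_norm (- ln e); have := ler_norm (ln r); rewrite normrN.
  have := normr_ge0 (ln e); have := normr_ge0 (ln r).
  move=> p1 p2 p3 p4 p5 p6.
  have r0 : 0 < r by exact: lt_le_trans r1.
  by split; rewrite -ler_ln ?posrE ?expR_gt0// expRK; lra.
set K := (trunc_cst * _ * _).
have dist n : expR (- n%:R) <= e -> r <= expR n%:R ->
    normc (truncated th (expR (- n%:R)) (expR n%:R) - truncated th e r) <= K.
  move=> he hr; have r0 : 0 < r by exact: lt_le_trans r1.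
  have d s : expR (- n%:R) <= s <= expR n%:R -> cdiff h s.
    by move=> /andP[h1 _]; apply: cdiff_h; exact: lt_le_trans (expR_gt0 _) h1.
  have d' s : e <= s <= expR n%:R -> cdiff h s.
    by move=> /andP[h1 h2]; apply: d; rewrite h2 (le_trans he h1).
  rewrite /truncated -/h (cintegral_itv_cat d he); last exact: le_trans hr.
  rewrite (cintegral_itv_cat d' er hr) addrA [_ + _ + _]addrAC addrK.
  have b1 := truncated_lower (expR_gt0 _) he e1; have b2 := truncated_upper r1 hr.
  apply: (le_trans (le_normcD _ _)); apply: (le_trans (lerD b1 b2)).
  have pe := powR_ge0 e (1 - sg); have pr := powR_ge0 r (- sg).
  rewrite /K mulrDr lerD// ler_wpM2r//.
    rewrite (@le_trans _ _ ((4 + 2 / (1 - sg)) / c * (1 + x)))//.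
      rewrite [leRHS]mulrAC ler_wpM2r ?invr_ge0 ?(ltW c_gt0)//.
      rewrite [leRHS](_ : _ = 4 + 2 * x / (1 - sg) + (4 * x + 2 / (1 - sg))); last by ring.
      by rewrite lerDl addr_ge0 ?mulr_ge0 ?invr_ge0 ?(ltW x_gt0) ?(ltW s1).
    rewrite ler_wpM2r ?addr_ge0 ?(ltW x_gt0)// /trunc_cst lerDl.
    by rewrite divr_ge0 ?(ltW sg_gt0).
  rewrite (@le_trans _ _ trunc_cst)//.
    rewrite /trunc_cst lerDr divr_ge0 ?(ltW c_gt0)//.
    by rewrite addr_ge0 ?divr_ge0 ?(ltW s1).
  rewrite ler_peMr ?lerDl ?(ltW x_gt0)// /trunc_cst addr_ge0// ?divr_ge0 ?(ltW c_gt0) ?(ltW sg_gt0)//.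
  by rewrite addr_ge0 ?divr_ge0 ?(ltW s1).
have hK : K + normc (truncated th (expR (- n%:R)) (expR n%:R) - truncated th e r -
    (Zint th c x (- sg) - truncated th e r)) @[n --> \oo] --> K.
  by have := cvgD (cvg_cst K) hl; rewrite addr0; exact.
apply: (ler_cvg_to (cvg_cst (normc (Zint th c x (- sg) - truncated th e r))) hK).
move: near1; apply: filterS => n [h1 h2].
set t := truncated th (expR _) _; set M := truncated th e r; set Z := Zint _ _ _ _.
have E (u v w : R[i]) : w - v = (u - v) + - (u - v - (w - v)) by ring.
rewrite [leLHS](congr1 (@normc R) (E t M Z)) (le_trans (le_normcD _ _))//.
by rewrite normcN lerD2r dist.
Qed.

End truncation.

(** * The oscillatory integral *)

Section bessel_ode.
Context {R : realType}.
Variables (c sg th : R).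
Hypothesis c_gt0 : 0 < c.
Hypothesis sg_gt0 : 0 < sg.
Hypothesis sg_lt1 : sg < 1.
Hypothesis th_bound : - (pi / 2) < th < pi / 2.
Let eta : R[i] := cexp ('i%C * th%:C).

Definition frob_kappa : R[i] := c%:C * (cexp ('i%C * th%:C)) ^+ 2.

Definition frob_a0 : R[i] :=
  (c `^ (- sg))%:C * (cexp ('i%C * (- (sg * th))%:C) * (gammaE sg)%:C).

Definition frob_v0 : R[i] :=
  - (cexp ('i%C * (sg * th)%:C) * (gammaE (1 - sg))%:C).

Definition frob_sum (x : R) (n : nat) : R[i] :=
  \sum_(k < n) (frob frob_kappa (- sg) frob_a0 k * (x `^ k%:R)%:C +
    frob frob_kappa sg (frob_v0 / sg%:C) k * (x `^ (k%:R + sg))%:C).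

(** [Y] is the integral of interest, as a function of [x = |xi| ^ 2], and [V] is
    [x ^ (1 - sg)] times its derivative; this pair solves Bessel's equation in
    the form used for [frob]. *)
Let Y x := Zint th c x (- sg).
Let V x := - eta * Zint th 1 (c * x) (sg - 1).

Lemma is_cderive_scale (f : R -> R[i]) (k x : R) l : is_cderive f (k * x) l ->
  is_cderive (fun y => f (k * y)) x (k%:C * l).
Proof.
have hk : is_derive x 1 (fun y : R => k * y) k.
  by apply: is_derive_ext (is_deriveM (is_derive_cst k x 1) (is_derive_id x 1)) _;
    rewrite /GRing.scale/= mulr0 addr0 mulr1.
move=> [rf jf]; split.
  apply: is_derive_ext (@is_derive1_comp R (fun y => Re (f y)) _ x _ _ rf hk) _.
  by rewrite ReM Re_real Im_real mul0r subr0 mulrC.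
apply: is_derive_ext (@is_derive1_comp R (fun y => Im (f y)) _ x _ _ jf hk) _.
by rewrite ImM Re_real Im_real mul0r addr0 mulrC.
Qed.

Lemma powRV x a : 0 < x -> x^-1 `^ a = x `^ (- a) :> R.
Proof. by move=> x0; rewrite -powR_inv1 ?(ltW x0)// -powRrM mulN1r. Qed.

Lemma is_cderive_Y x : 0 < x -> is_cderive Y x ((x `^ (sg - 1))%:C * V x).
Proof.
move=> x0; have c0' := ltW c_gt0; have x0' := ltW x0.
apply: is_cderive_ext (is_cderive_Zint th_bound c0' x0 (or_introl c_gt0)) _.
rewrite /V mulrCA -/eta; congr (_ * _).
have xi : 0 < x^-1 by rewrite invr_gt0.
rewrite (Zint_scale th_bound c0' x0' _ _ xi); [|by left|by left].
have e1 : c / x^-1 = c * x by rewrite invrK.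
rewrite e1 (divff (lt0r_neq0 x0)) ZintN (powRV _ x0).
by congr ((_ `^ _)%:C * Zint _ _ _ _); ring.
Qed.

Lemma is_cderive_V x : 0 < x ->
  is_cderive V x (frob_kappa * (x `^ (- sg))%:C * Y x).
Proof.
move=> x0; have c0' := ltW c_gt0; have x0' := ltW x0.
have cx : 0 < c * x by rewrite mulr_gt0.
have h1 := is_cderive_scale (@is_cderive_Zint _ _ th_bound 1 (c * x) (sg - 1) ler01 cx (or_introl ltr01)).
apply: is_cderive_ext (is_cderiveZ (- eta) h1) _.
have xi : 0 < x^-1 by rewrite invr_gt0.
rewrite /Y (Zint_scale th_bound c0' x0' _ _ xi); [|by left|by left].
rewrite invrK (divff (lt0r_neq0 x0)) powRV// opprK subrK ZintN.
have E : (x `^ (- sg))%:C * (x `^ sg)%:C = 1 :> R[i].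
  by rewrite -rmorphM/= -powRD ?(gt_eqF x0) ?implybT// addNr powRr0.
set z := Zint _ _ _ _.
rewrite -[RHS]mulrA [_ * (_ * z)]mulrA E mul1r /frob_kappa -/eta; ring.
Qed.

Let h (k : nat) : R := k.+1%:R^-1.

Let h_gt0 k : 0 < h k. Proof. by rewrite invr_gt0. Qed.

Let cvg_h : h k @[k --> \oo] --> (0 : R). Proof. exact: cvg_harmonic. Qed.

(** The two initial values are Gamma integrals on a ray. *)
Lemma ccvg_Y : ccvg (fun k => Y (h k)) frob_a0.
Proof.
rewrite /frob_a0 -(Zint0 th_bound c_gt0 sg_gt0) ZintN.
apply: (cvg_Zint0 th_bound c_gt0); last exact: cvg_h.
- by rewrite oppr_lt0.
- by move=> k; exact: ltW.
Qed.

Lemma ccvg_V : ccvg (fun k => V (h k)) frob_v0.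
Proof.
have s1 : 0 < 1 - sg by rewrite subr_gt0.
have <- : - eta * Zint th 1 0 (sg - 1) = frob_v0.
  rewrite ZintN opprB (Zint0 th_bound ltr01 s1) powR1 mul1r /frob_v0 mulNr mulrA -cisD.
  by congr (- (cexp (_ * _%:C) * _)); ring.
apply: ccvgM (ccvg_cst _) _.
have ch : c * h k @[k --> \oo] --> (0 : R).
  by rewrite -(mulr0 c); apply: cvgM => //; exact: cvg_cst.
apply: (cvg_Zint0 th_bound ltr01 _ _ ch).
- by rewrite subr_lt0.
- by move=> k; apply: ltW; rewrite mulr_gt0.
Qed.

Lemma truncated_refl x e : truncated c sg x th e e = 0.
Proof.
by apply: complex_ext; rewrite /= set_itv1 /Rintegral integral_set1.
Qed.

Definition frob_bound (x : R) (n : nat) : R :=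
  trunc_cst c sg * (2 + x) * 2 * (4 * c / (1 - sg)) ^+ n / n`!%:R * x ^+ n.

Lemma normc_frob_kappa : normc frob_kappa = c.
Proof. by rewrite normcM normc_real normcX normc_cis expr1n mulr1 gtr0_norm. Qed.

(** The bound on [Y] is [truncated_dist] for the interval reduced to the point 1,
    on which the truncated integral vanishes. *)
Lemma frob_sum_dist x n : 0 < x -> normc (Y x - frob_sum x n) <= frob_bound x n.
Proof.
move=> x0; have s01 : 0 < sg < 1 by rewrite sg_gt0.
have T0 : 0 <= trunc_cst c sg.
  have s1 : 0 <= 1 - sg by rewrite subr_ge0 ltW.
  by rewrite addr_ge0 ?divr_ge0 ?addr_ge0 ?divr_ge0 ?(ltW c_gt0) ?(ltW sg_gt0).
have bY y : 0 < y < x + 1 -> normc (Y y) <= trunc_cst c sg * (2 + x) * 2.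
  move=> /andP[y0 yx].
  have := truncated_dist c_gt0 sg_gt0 sg_lt1 y0 th_bound ltr01 (lexx 1) (lexx 1).
  rewrite truncated_refl subr0 !powR1 => hY; apply: (le_trans hY).
  rewrite ler_wpM2r// ler_wpM2l//.
  by rewrite [leRHS](_ : _ = 1 + (x + 1)) ?lerD2l ?ltW//; ring.
have xX : 0 < x < x + 1 by rewrite x0 ltrDl ltr01.
have := frobenius_remainder s01 is_cderive_Y is_cderive_V h_gt0 cvg_h ccvg_Y ccvg_V bY n xX.
by rewrite normc_frob_kappa powR_mulrn ?(ltW x0).
Qed.

Lemma truncated_frob_sum x n e r : 0 < x -> 0 < e -> e <= 1 -> 1 <= r ->
  normc (truncated c sg x th e r - frob_sum x n) <=
  trunc_cst c sg * (1 + x) * (e `^ (1 - sg) + r `^ (- sg)) + frob_bound x n.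
Proof.
move=> x0 e0 e1 r1.
have h1 := truncated_dist c_gt0 sg_gt0 sg_lt1 x0 th_bound e0 e1 r1.
have h2 := frob_sum_dist n x0.
have E (u v w : R[i]) : v - w = - (u - v) + (u - w) by ring.
rewrite (E (Y x)) (le_trans (le_normcD _ _))// normcN.
exact: lerD.
Qed.

End bessel_ode.

(** * Rotation up to the imaginary axis *)

Section half_pi.
Context {R : realType}.
Local Notation leb := (@lebesgue_measure R).
Variables (c sg x : R).
Hypothesis c_gt0 : 0 < c.
Hypothesis sg_gt0 : 0 < sg.
Hypothesis sg_lt1 : sg < 1.
Hypothesis x_gt0 : 0 < x.

Let th (j : nat) : R := pi / 2 - pi / 2 * j.+1%:R^-1.

Let th_bound j : - (pi / 2) < th j < pi / 2.
Proof.
have p0 := pi_gt0 R; have j0 : 0 < j.+1%:R^-1 :> R by rewrite invr_gt0.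
have j1 : j.+1%:R^-1 <= 1 :> R by rewrite invf_le1// ler1n.
have p2 : 0 < pi / 2 :> R by rewrite divr_gt0.
have h1 : pi / 2 * j.+1%:R^-1 <= pi / 2 :> R by rewrite ler_piMr// ltW.
have h2 : 0 < pi / 2 * j.+1%:R^-1 :> R by rewrite mulr_gt0.
rewrite /th gtrBl h2 andbT (@lt_le_trans _ _ 0)//; first by rewrite oppr_lt0.
by rewrite subr_ge0.
Qed.

Let cvg_th : th j @[j --> \oo] --> pi / 2.
Proof.
rewrite -[X in _ --> X]subr0; apply: cvgB; first exact: cvg_cst.
rewrite -(mulr0 (pi / 2)); apply: cvgM; first exact: cvg_cst.
exact: cvg_harmonic.
Qed.

Let ccvg_cis (a : nat -> R) (b : R) : a j @[j --> \oo] --> b ->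
  ccvg (fun j => cexp ('i%C * (a j)%:C)) (cexp ('i%C * b%:C)).
Proof.
by move=> ab; apply: ccvg_cexp; apply: ccvgM; [exact: ccvg_cst|exact: ccvg_real].
Qed.

Let ccvg_cis_th := ccvg_cis cvg_th.

Lemma cdiff_truncated (e r t s : R) : 0 < e -> e <= s <= r ->
  cdiff (fun s => wave c x t s * (s `^ (- (1 + sg)))%:C) s.
Proof.
move=> e0 /andP[es _]; have s0 := lt_le_trans e0 es.
by apply: cdiffM; [apply: cdiff_wave|exact: cdiff_powR].
Qed.

Lemma cmeasurable_truncated (e r t : R) : 0 < e ->
  cmeasurable `[e, r] (fun s => wave c x t s * (s `^ (- (1 + sg)))%:C).
Proof.
move=> e0; have [h1 h2] := cintegrable_itv (fun s => @cdiff_truncated e r t s e0).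
by split; apply/measurable_EFinP; [exact: (measurable_int leb h1)|exact: (measurable_int leb h2)].
Qed.

Lemma ccvg_truncated_th (e r : R) : 0 < e ->
  ccvg (fun j => truncated c sg x (th j) e r) (truncated c sg x (pi / 2) e r).
Proof.
move=> e0.
apply: (@ccvg_dominated _ _ _ leb `[e, r] _ _ (fun s => s `^ (- (1 + sg)))).
- exact: measurable_itv.
- by move=> k; exact: cmeasurable_truncated.
- exact: cmeasurable_truncated.
- move=> s _; apply: ccvgM (ccvg_cst _); apply: ccvg_cexp; apply: ccvgN.
  by apply: ccvgM (ccvg_cst _).
- apply: integrable_itv => s /andP[es _]; apply: continuous_powR.
  exact: lt_le_trans es.
- move=> k s hs; have es : e <= s by move: hs; rewrite /= in_itv => /andP[].
  rewrite normcM normc_real ger0_norm ?powR_ge0// ler_piMl ?powR_ge0//.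
  by apply: normc_wave => //; exact: lt_le_trans es.
Qed.

Lemma ccvg_frob (kappa a : nat -> R[i]) (k0 a0 : R[i]) (rho : R) n :
  ccvg kappa k0 -> ccvg a a0 ->
  ccvg (fun j => frob (kappa j) rho (a j) n) (frob k0 rho a0 n).
Proof.
move=> hk ha; elim: n => [//|n IH] /=.
by apply: ccvgM (ccvg_cst _); exact: ccvgM.
Qed.

Lemma ccvg_frob_sum n :
  ccvg (fun j => frob_sum c sg (th j) x n) (frob_sum c sg (pi / 2) x n).
Proof.
have hk : ccvg (fun j => frob_kappa c (th j)) (frob_kappa c (pi / 2)).
  by apply: ccvgM (ccvg_cst _) _; apply: ccvgM.
apply: ccvg_sum => k; apply: ccvgD; apply: ccvgM (ccvg_cst _); apply: ccvg_frob => //.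
  apply: ccvgM (ccvg_cst _) _; apply: ccvgM (ccvg_cst _); apply: ccvg_cis.
  by apply: cvgN; apply: cvgM; [exact: cvg_cst|exact: cvg_th].
apply: ccvgM (ccvg_cst _); apply: ccvgN; apply: ccvgM (ccvg_cst _); apply: ccvg_cis.
by apply: cvgM; [exact: cvg_cst|exact: cvg_th].
Qed.

(** A compact integral and a finite sum are continuous in [th], unlike, a priori,
    the integral over the half-line and the whole series. *)
Lemma truncated_frob_sum_half n (e r : R) : 0 < e -> e <= 1 -> 1 <= r ->
  normc (truncated c sg x (pi / 2) e r - frob_sum c sg (pi / 2) x n) <=
  trunc_cst c sg * (1 + x) * (e `^ (1 - sg) + r `^ (- sg)) + frob_bound c sg x n.
Proof.
move=> e0 e1 r1.
apply: (ccvg_le (ccvgB (ccvg_truncated_th r e0) (ccvg_frob_sum n)) (cvg_cst _)) => j.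
exact: truncated_frob_sum.
Qed.

Lemma cvg_frob_bound : frob_bound c sg x n @[n --> \oo] --> (0 : R).
Proof.
have s1 : 0 < 1 - sg by rewrite subr_gt0.
pose y := 4 * c / (1 - sg) * x.
have -> : (fun n => frob_bound c sg x n) =
    (fun n => trunc_cst c sg * (2 + x) * 2 * exp_coeff y n).
  apply/funext => n; rewrite /frob_bound /exp_coeff/= /y.
  by move: (4 * c / (1 - sg)) => z; rewrite exprMn; ring.
rewrite -(mulr0 (trunc_cst c sg * (2 + x) * 2)); apply: cvgM; first exact: cvg_cst.
by apply: cvg_series_cvg_0; exact: is_cvg_series_exp_coeff.
Qed.

(** Euler's reflection formula excludes zeros on [0 < a < 1]. *)
Lemma gammaE_gt0 (a : R) : 0 < a -> a < 2 -> 0 < gammaE a :> R.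
Proof.
have ge0 b : 0 <= gammaE b :> R.
  by apply: Rintegral_ge0 => y _; rewrite ltW// ee_gt0.
have H b : 0 < b < 1 -> 0 < gammaE b :> R.
  move=> /andP[b0 b1]; rewrite lt_neqAle ge0 andbT.
  have b01 : 0 < b < 1 by rewrite b0.
  apply/eqP => e; have := gammaE_reflection b01; rewrite -e mul0r => /esym/eqP.
  rewrite mulf_eq0 invr_eq0 !gt_eqF ?pi_gt0//.
  by rewrite sin_pi_gt0.
move=> a0 a2; have [a1|a1] := ltP a 1; first by rewrite H// a0.
have [->|a1'] := eqVneq a 1; first by rewrite gammaE1.
have p : 0 < a - 1 by rewrite subr_gt0 lt_neqAle eq_sym a1'.
rewrite -(subrK 1 a) gammaE_succ// mulr_gt0// H// p/=; lra.
Qed.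

Lemma gammaE_gt0_nat (rho : R) k : -1 < rho -> rho < 1 -> 0 < gammaE (k%:R + rho + 1) :> R.
Proof.
move=> r0 r1; elim: k => [|k IH]; first by rewrite add0r gammaE_gt0//; lra.
have k0 : 0 <= k%:R :> R by [].
rewrite -natr1 (_ : k%:R + 1 + rho + 1 = k%:R + rho + 1 + 1); last by ring.
by rewrite gammaE_succ ?mulr_gt0//; lra.
Qed.

Definition bessel_coef (rho : R) (k : nat) : R :=
  (- (c * x)) ^+ k / (k`!%:R * gammaE (k%:R + rho + 1)).

Lemma frob_closed (rho : R) (a : R[i]) k : -1 < rho -> rho < 1 ->
  frob (- c)%:C rho a k * (x `^ k%:R)%:C =
  a * (gammaE (rho + 1))%:C * (bessel_coef rho k)%:C.
Proof.
move=> r0 r1; rewrite powR_mulrn ?(ltW x_gt0)//.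
have g0 := @gammaE_gt0_nat rho 0 r0 r1; rewrite add0r in g0.
elim: k => [|k IH].
  have -> : bessel_coef rho 0 = (gammaE (rho + 1))^-1.
    by rewrite /bessel_coef expr0 fact0 add0r !mul1r.
  by rewrite /= expr0 mulr1 -mulrA -rmorphM/= mulfV ?mulr1// gt_eqF.
have E (a1 a2 a3 a4 a5 : R[i]) : a1 * a2 / a3 * (a4 * a5) = a1 * a4 / a3 * (a2 * a5).
  by ring.
rewrite frobS exprS [(x * _)%:C]rmorphM/= E.
rewrite IH mulrCA; congr (_ * _).
rewrite -fmorphV -!rmorphM/=; congr (_%:C).
have k1 : 0 <= k%:R :> R by [].
rewrite /bessel_coef exprS factS natrM -natr1.
rewrite (_ : k%:R + 1 + rho + 1 = k%:R + rho + 1 + 1); last by ring.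
rewrite (@gammaE_succ _ (k%:R + rho + 1)); last by lra.
have gk := gammaE_gt0_nat k r0 r1.
field.
by rewrite (gt_eqF gk) pnatr_eq0 -lt0n fact_gt0 !gt_eqF//=; lra.
Qed.

(** The recursion of the Gamma function compares the series with that of the
    exponential. *)
Lemma cvg_bessel_series (rho : R) : -1 < rho -> rho < 1 ->
  cvgn (series (bessel_coef rho)).
Proof.
move=> r0 r1; have rho0 : 0 < rho + 1 by lra.
have g0 := @gammaE_gt0_nat rho 0 r0 r1; rewrite add0r in g0.
have ge k : gammaE (rho + 1) * (rho + 1) ^+ k <= gammaE (k%:R + rho + 1).
  elim: k => [|k IH]; first by rewrite expr0 mulr1 add0r.
  have gk := gammaE_gt0_nat k r0 r1; have k1 : 0 <= k%:R :> R by [].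
  rewrite -natr1 (_ : k%:R + 1 + rho + 1 = k%:R + rho + 1 + 1); last by ring.
  rewrite (@gammaE_succ _ (k%:R + rho + 1)); last by lra.
  rewrite exprSr mulrA mulrC; apply: ler_pM => //; [exact: ltW| |lra].
  by rewrite mulr_ge0 ?exprn_ge0 ?(ltW g0) ?(ltW rho0).
have cx0 : 0 <= c * x by rewrite mulr_ge0 ?(ltW c_gt0) ?(ltW x_gt0).
pose y := c * x / (rho + 1).
apply: normed_cvg.
apply: (@series_le_cvg _ _ (fun k => (gammaE (rho + 1))^-1 * exp_coeff y k)).
- by move=> k /=.
- move=> k; rewrite mulr_ge0 ?invr_ge0 ?(ltW g0)// /exp_coeff/= divr_ge0//.
  by rewrite exprn_ge0// divr_ge0// ltW.
- move=> k /=; have gk := gammaE_gt0_nat k r0 r1.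
  have f0 : 0 < k`!%:R :> R by rewrite ltr0n fact_gt0.
  rewrite /bessel_coef normrM normrX normrN (ger0_norm cx0) normfV.
  rewrite (gtr0_norm (mulr_gt0 f0 gk)) /exp_coeff/= /y expr_div_n.
  have p0 : 0 < (rho + 1) ^+ k by rewrite exprn_gt0.
  rewrite (_ : _^-1 * _ = (c * x) ^+ k / (k`!%:R * (gammaE (rho + 1) * (rho + 1) ^+ k))).
    by rewrite ler_wpM2l ?exprn_ge0// lef_pV2 ?posrE ?mulr_gt0// ler_pM2l.
  by field; rewrite !gt_eqF.
- exact: (@is_cvg_seriesZ _ _ (gammaE (rho + 1))^-1 (@is_cvg_series_exp_coeff R y)).
Qed.

(** The symbol of the integral over the whole half-line. The factor
    [pi / sin (sg * pi)] is [gammaE sg * gammaE (1 - sg)]. *)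
Definition wave_limit : R[i] := (pi / sin (sg * pi))%:C *
  ((c `^ (- sg))%:C * cexp ('i%C * (- (sg * (pi / 2)))%:C) *
     (limn (series (bessel_coef (- sg))))%:C -
   (x `^ sg)%:C * cexp ('i%C * (sg * (pi / 2))%:C) *
     (limn (series (bessel_coef sg)))%:C).

Lemma frob_kappa_half : frob_kappa c (pi / 2) = (- c)%:C.
Proof.
rewrite /frob_kappa expr2 -cisD -splitr.
have -> : cexp ('i%C * pi%:C) = (-1)%:C :> R[i].
  by apply: complex_ext; rewrite ?Re_cis ?Im_cis ?cospi ?sinpi.
by rewrite -rmorphM/= mulrN1.
Qed.

Lemma ccvg_frob_sum_half : ccvg (frob_sum c sg (pi / 2) x) wave_limit.
Proof.
have s0 : 0 < sg < 1 by rewrite sg_gt0.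
have m1 : -1 < - sg by rewrite ltrN2.
have m2 : - sg < 1 by rewrite (lt_trans _ ltr01)// oppr_lt0.
have m3 : -1 < sg by rewrite (lt_trans _ sg_gt0)// ltrN10.
have E n : frob_sum c sg (pi / 2) x n =
    (pi / sin (sg * pi))%:C * ((c `^ (- sg))%:C *
      cexp ('i%C * (- (sg * (pi / 2)))%:C) * (series (bessel_coef (- sg)) n)%:C -
    (x `^ sg)%:C * cexp ('i%C * (sg * (pi / 2))%:C) *
      (series (bessel_coef sg) n)%:C).
  rewrite /frob_sum frob_kappa_half big_split/=.
  under eq_bigr do rewrite frob_closed//.
  have P k : (x `^ (k%:R + sg))%:C = (x `^ k%:R)%:C * (x `^ sg)%:C.
    by rewrite -rmorphM/= -powRD// (gt_eqF x_gt0) implybT.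
  under [X in _ + X]eq_bigr do rewrite P mulrA frob_closed// mulrAC.
  rewrite -!mulr_sumr /series/= !big_mkord !rmorph_sum/=.
  have -> : (gammaE (sg + 1))%:C = sg%:C * (gammaE sg)%:C :> R[i].
    by rewrite gammaE_succ// rmorphM.
  have sC : sg%:C != 0 :> R[i] by rewrite eq_complex/= eqxx andbT gt_eqF.
  rewrite -(gammaE_reflection s0) rmorphM/= /frob_a0 /frob_v0 (addrC (- sg) 1).
  set S1 := \sum_(_ < _) _; set S2 := \sum_(_ < _) _.
  by field.
have -> : frob_sum c sg (pi / 2) x = (fun n =>
    (pi / sin (sg * pi))%:C * ((c `^ (- sg))%:C *
      cexp ('i%C * (- (sg * (pi / 2)))%:C) * (series (bessel_coef (- sg)) n)%:C -
    (x `^ sg)%:C * cexp ('i%C * (sg * (pi / 2))%:C) *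
      (series (bessel_coef sg) n)%:C)) by apply/funext => n; rewrite E.
apply: ccvgM (ccvg_cst _) _; apply: ccvgB; apply: ccvgM (ccvg_cst _) _;
  apply: ccvg_real; exact: cvg_bessel_series.
Qed.

(** At [th = pi / 2] the number of terms can now tend to infinity. *)
Theorem truncated_wave_limit (e r : R) : 0 < e -> e <= 1 -> 1 <= r ->
  normc (truncated c sg x (pi / 2) e r - wave_limit) <=
  trunc_cst c sg * (1 + x) * (e `^ (1 - sg) + r `^ (- sg)).
Proof.
move=> e0 e1 r1; set K := leRHS.
have cK : K + frob_bound c sg x n @[n --> \oo] --> K.
  by have := cvgD (cvg_cst K) cvg_frob_bound; rewrite addr0; exact.
apply: (ccvg_le (ccvgB (ccvg_cst (truncated c sg x (pi / 2) e r)) ccvg_frob_sum_half) cK).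
by move=> n; exact: truncated_frob_sum_half.
Qed.

End half_pi.

(** * The Bessel function on the imaginary axis *)

Section identification.
Context {R : realType}.
Variables (sg t r : R).
Hypothesis sg_gt0 : 0 < sg.
Hypothesis sg_lt1 : sg < 1.
Hypothesis t_gt0 : 0 < t.
Hypothesis r_gt0 : 0 < r.

Let c := t ^+ 2 / 4.
Let x := r ^+ 2.

Lemma cseries_real (u : nat -> R) : cseries (fun k => (u k)%:C) = (limn (series u))%:C.
Proof.
rewrite /cseries; apply: complex_ext => /=; first by [].
rewrite (_ : series (fun k : nat => 0) = fun=> 0) ?lim_cst//.
by apply/funext => n; rewrite /series/= big1.
Qed.

Lemma besselI_imag (nu : R) : besselI nu ('i%C * (t * r)%:C) =
  cexp ('i%C * (pi * nu / 2)%:C) * ((t * r / 2) `^ nu)%:C *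
  (limn (series (bessel_coef c x nu)))%:C.
Proof.
have n2 (n : nat) : n%:R = (n%:R)%:C :> R[i] by rewrite rmorph_nat.
rewrite /besselI; congr (_ * _).
  rewrite (_ : 'i%C * _ / 2 = 'i%C * (t * r / 2)%:C) ?cpow_imag ?divr_gt0 ?mulr_gt0//.
  by rewrite -mulrA; congr (_ * _); rewrite n2 -fmorphV -rmorphM.
rewrite -cseries_real; congr (cseries _); apply/funext => k.
have -> : ('i%C * (t * r)%:C) ^+ 2 / 4 = (- (c * x))%:C.
  rewrite exprMn sqr_i mulN1r -rmorphXn/= n2 mulNr -fmorphV -rmorphM -rmorphN/=.
  by congr (_%:C); rewrite /c /x; field.
by rewrite /bessel_coef Gamma_gammaE -rmorphXn -fmorphV -rmorphM.
Qed.

(** The phases and the two series agree, and there remain two identities between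
    powers of [t], [r] and 2, which are checked on logarithms. *)
Lemma bessel_multiplier :
  cpow ('i%C * (t * r)%:C) sg * besselK sg ('i%C * (t * r)%:C) =
  cpow 'i%C sg * (t `^ (2 * sg))%:C / (2 `^ (1 + sg))%:C * wave_limit c sg x.
Proof.
have tr : 0 < t * r by rewrite mulr_gt0.
have -> : cpow 'i%C sg = cexp ('i%C * (sg * (pi / 2))%:C) :> R[i].
  have := @cpow_imag R 1 sg ltr01; rewrite !mulr1 powR1 mulr1 => ->.
  by congr (cexp (_ * _%:C)); ring.
rewrite cpow_imag// /besselK !besselI_imag /wave_limit.
have -> : pi * sg / 2 = sg * (pi / 2) by ring.
have -> : pi * - sg / 2 = - (sg * (pi / 2)) by ring.
set A := limn (series (bessel_coef c x (- sg))).
set B := limn (series (bessel_coef c x sg)); set e1 := cexp _; set e2 := cexp _.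
have [c0 x0] : 0 < c /\ 0 < x by rewrite /c /x divr_gt0 ?exprn_gt0.
have P a b : 0 < a -> a `^ b = expR (b * ln a) :> R.
  by move=> a0; rewrite /powR gt_eqF.
have ln4 : ln 4 = 2 * ln 2 :> R.
  have -> : 4 = 2 ^+ 2 :> R by ring.
  by rewrite lnXn// -[ln _ *+ _]mulr_natl.
have lnc : ln c = 2 * ln t - 2 * ln 2.
  by rewrite /c ln_div ?posrE ?exprn_gt0// lnXn// ln4 -[ln _ *+ _]mulr_natl.
have lnx : ln x = 2 * ln r by rewrite /x lnXn// -[ln _ *+ _]mulr_natl.
have lntr2 : ln (t * r / 2) = ln t + ln r - ln 2.
  by rewrite ln_div ?posrE// lnM ?posrE.
have lntr : ln (t * r) = ln t + ln r by rewrite lnM ?posrE.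
have two : 2 = expR (ln 2) :> R by rewrite lnK ?posrE.
have tr2 : 0 < t * r / 2 by rewrite divr_gt0.
have E1 : (t * r) `^ sg * (t * r / 2) `^ (- sg) / 2 =
    t `^ (2 * sg) / 2 `^ (1 + sg) * c `^ (- sg).
  rewrite (P _ _ tr) (P _ _ tr2) (P _ _ c0) (P _ _ t_gt0) (P 2 _)//.
  rewrite lntr lntr2 lnc [X in _ / X]two -!expRN -!expRD; congr expR; ring.
have E2 : (t * r) `^ sg * (t * r / 2) `^ sg / 2 =
    t `^ (2 * sg) / 2 `^ (1 + sg) * x `^ sg.
  rewrite (P _ _ tr) (P _ _ tr2) (P _ _ x0) (P _ _ t_gt0) (P 2 _)//.
  rewrite lntr lntr2 lnx [X in _ / X]two -!expRN -!expRD; congr expR; ring.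
set S := sin (sg * pi); clearbody A B e1 e2 S.
transitivity (e1 * (pi / S)%:C *
    (((t * r) `^ sg * (t * r / 2) `^ (- sg) / 2)%:C * e2 * A%:C -
     ((t * r) `^ sg * (t * r / 2) `^ sg / 2)%:C * e1 * B%:C)).
  by rewrite !(rmorphM, fmorphV)/=; ring.
by rewrite E1 E2 !(rmorphM, fmorphV)/=; ring.
Qed.

End identification.

(** * Functions on R^d up to the origin, and L^2 *)

Section off_origin.
Context {R : realType} (n : nat).
Local Notation V := 'rV[R]_n.+1.
Local Notation lebn := (@lebesgue_rV R n.+1).

(** The estimates on the symbols hold for [xi <> 0] only. In positive dimension
    the origin is a null set, and the symbols are set to 0 there. *)
Definition off0 (u : V -> R[i]) (x : V) : R[i] := if x == 0 then 0 else u x.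

Lemma cmeasurable_off0 (f g : V -> R[i]) : cmeasurable setT f ->
  (forall x, x != 0 -> g x = f x) -> cmeasurable setT g.
Proof.
move=> mf fg.
have mi : cmeasurable setT (fun x : V => (\1_[set 0] x : R)%:C).
  by apply: cmeasurable_real; apply: measurable_indic; exact: measurable_rV_0.
rewrite (_ : g = fun x => f x + (\1_[set 0] x : R)%:C * (g 0 - f 0)).
  by apply: cmeasurableD => //; apply: cmeasurableM => //; exact: cmeasurable_cst.
apply/funext => x; rewrite indicE; have [->|x0] := eqVneq x 0.
  by rewrite mem_set// mul1r addrC subrK.
rewrite memNset ?mul0r ?addr0 ?fg//.
by apply/eqP.
Qed.

Lemma Rintegral_off0 (f g : V -> R) : measurable_fun setT f -> measurable_fun setT g ->
  (forall x, x != 0 -> g x = f x) -> \int[lebn]_x f x = \int[lebn]_x g x.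
Proof.
move=> mf mg fg; rewrite /Rintegral; congr fine.
apply: ae_eq_integral => //; [exact/measurable_EFinP|exact/measurable_EFinP|].
exists [set 0 : V]; split; [exact: measurable_rV_0|exact: lebesgue_rV_set0|].
move=> x /= hx; apply: contrapT => x0; apply: hx => _; rewrite fg//.
by apply/eqP.
Qed.

Lemma cintegral_off0 (f g : V -> R[i]) : cmeasurable setT f ->
  (forall x, x != 0 -> g x = f x) -> cintegral lebn setT f = cintegral lebn setT g.
Proof.
move=> mf fg; have [rg ig] := cmeasurable_off0 mf fg; have [rf jf] := mf.
by apply: complex_ext; apply: Rintegral_off0 => // x x0; rewrite fg.
Qed.

Lemma cmeasurable_cis_edot (x : V) :
  cmeasurable setT (fun xi => cexp ('i%C * (edot x xi)%:C)).
Proof.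
apply: cmeasurable_cexp; apply: cmeasurableM; first exact: cmeasurable_cst.
by apply: cmeasurable_real; exact: measurable_edot2.
Qed.

Lemma inv_fourier_off0 (f g : V -> R[i]) : cmeasurable setT f ->
  (forall x, x != 0 -> g x = f x) -> inv_fourier f = inv_fourier g.
Proof.
move=> mf fg; apply/funext => x; congr (_ * _); apply: cintegral_off0.
  by apply: cmeasurableM => //; exact: cmeasurable_cis_edot.
by move=> xi xi0; rewrite fg.
Qed.

End off_origin.

Section complex_fubini.
Context {R : realType}.

Lemma cintegral_swap d1 d2 (T1 : measurableType d1) (T2 : measurableType d2)
    (m1 : {sigma_finite_measure set T1 -> \bar R})
    (m2 : {sigma_finite_measure set T2 -> \bar R})
    (F : T1 * T2 -> R[i]) (u : T1 -> R) (v : T2 -> R) :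
  cmeasurable setT F ->
  m1.-integrable setT (EFin \o u) -> m2.-integrable setT (EFin \o v) ->
  (forall x y, normc (F (x, y)) <= u x * v y) ->
  cintegral m1 setT (fun x => cintegral m2 setT (fun y => F (x, y))) =
  cintegral m2 setT (fun y => cintegral m1 setT (fun x => F (x, y))).
Proof.
move=> [mr mi] iu iv Fuv.
have H (p : R[i] -> R) : measurable_fun setT (fun z => p (F z)) ->
    (forall z, `|p z| <= normc z) ->
    \int[m1]_x \int[m2]_y p (F (x, y)) = \int[m2]_y \int[m1]_x p (F (x, y)).
  move=> mp pn.
  have pb x y : `|p (F (x, y))| <= u x * v y := le_trans (pn _) (Fuv x y).
  apply: (@Rintegral_swap _ _ _ _ _ m1 m2 (fun z => p (F z))).
  - exact: (@Rintegral_prod_bounded _ _ _ _ _ m1 m2 _ u v).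
  - move=> x; apply: (le_integrable _ _ _ (integrableZl measurableT (u x) iv)) => //.
      by apply/measurable_EFinP; exact: measurableT_comp mp (pair1_measurable x).
    by move=> y _; rewrite /= lee_fin (le_trans (pb x y))// ler_norm.
  - move=> y; apply: (le_integrable _ _ _ (integrableZr measurableT (v y) iu)) => //.
      by apply/measurable_EFinP; exact: measurableT_comp mp (pair2_measurable y).
    by move=> x _; rewrite /= lee_fin (le_trans (pb x y))// ler_norm.
apply: complex_ext; apply: H => //.
- exact: le_Re_normc.
- exact: le_Im_normc.
Qed.

End complex_fubini.

Section L2_tools.
Context {R : realType} {n : nat}.
Local Notation lebn := (@lebesgue_rV R n).

Lemma L2normE (f : 'rV[R]_n -> R[i]) :
  L2norm f = ((\int[lebn]_x (normc (f x) ^+ 2)%:E) `^ 2^-1)%E.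
Proof.
rewrite /L2norm unlock; congr (_ `^ _)%E; apply: eq_integral => x _.
rewrite abse_EFin ger0_norm ?normc_ge0//.
by rewrite poweR_EFin powR_mulrn// normc_ge0.
Qed.

Lemma L2norm_le (f : 'rV[R]_n -> R[i]) (a : R) : 0 <= a ->
  (\int[lebn]_x (normc (f x) ^+ 2)%:E <= (a ^+ 2)%:E)%E -> (L2norm f <= a%:E)%E.
Proof.
move=> a0 fa; rewrite L2normE.
have -> : a%:E = ((a ^+ 2)%:E `^ 2^-1)%E.
  by rewrite poweR_EFin powR12_sqrt ?sqr_ge0// sqrtr_sqr ger0_norm.
apply: gt0_ler_poweR => //.
- by rewrite in_itv/= leey andbT integral_ge0// => x _; rewrite lee_fin sqr_ge0.
- by rewrite in_itv/= leey andbT lee_fin sqr_ge0.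
Qed.

Lemma Lfun2 (u : 'rV[R]_n -> R) : measurable_fun setT u ->
  (\int[lebn]_x (u x ^+ 2)%:E < +oo)%E -> u \in Lfun lebn 2%:E.
Proof.
move=> mu fu; apply/andP; split; first by rewrite inE/=.
rewrite inE/= /finite_norm unlock.
apply: poweR_lty.
rewrite (_ : (\int[lebn]_x _)%E = \int[lebn]_x (u x ^+ 2)%:E)%E//.
apply: eq_integral => x _.
by rewrite abse_EFin poweR_EFin powR_mulrn// real_normK// num_real.
Qed.

Lemma L2_inv_fourier (h : 'rV[R]_n -> R[i]) : cwbounded h -> L2 (inv_fourier h).
Proof.
move=> bh; have [mr mi] := cmeasurable_inv_fourier bh.
have fin : (\int[lebn]_x (normc (inv_fourier h x) ^+ 2)%:E < +oo)%E.
  exact: le_lt_trans (inv_fourier_L2 bh) (ltry _).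
have H (u : 'rV[R]_n -> R) : measurable_fun setT u ->
    (forall x, u x ^+ 2 <= normc (inv_fourier h x) ^+ 2) ->
    (\int[lebn]_x (u x ^+ 2)%:E < +oo)%E.
  move=> mu ub; apply: le_lt_trans fin; apply: ge0_le_integral => //.
  - by move=> x _; rewrite lee_fin sqr_ge0.
  - by apply/measurable_EFinP; exact: measurable_funX.
  - apply/measurable_EFinP; apply: measurable_funX; apply: cmeasurable_normc.
    exact: cmeasurable_inv_fourier.
  - by move=> x _; rewrite lee_fin.
by split; apply: Lfun2 => //; apply: H => // x; rewrite normc_sqr ?lerDl ?lerDr sqr_ge0.
Qed.

End L2_tools.

Section weight_edot.
Context {R : realType} {n : nat}.
Implicit Types xi : 'rV[R]_n.

Lemma edot_ge0 xi : 0 <= edot xi xi.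
Proof. by apply: sumr_ge0 => j _; rewrite -expr2 sqr_ge0. Qed.

Lemma edot_gt0 xi : xi != 0 -> 0 < edot xi xi.
Proof.
move=> x0; rewrite lt_neqAle edot_ge0 andbT; apply: contra x0 => /eqP/esym h.
apply/eqP/rowP => j; rewrite mxE; have := h => /eqP.
rewrite psumr_eq0; last by move=> i _; rewrite -expr2 sqr_ge0.
by move=> /allP/(_ j (mem_index_enum _)) /=; rewrite mulf_eq0 orbb => /eqP.
Qed.

Lemma enorm_sqr xi : enorm xi ^+ 2 = edot xi xi.
Proof. by rewrite /enorm sqr_sqrtr// edot_ge0. Qed.

(** Trades the growth [1 + |xi| ^ 2] of the symbols for one power of the
    weight. *)
Lemma edot_weight xi : (1 + edot xi xi) * weight xi <= 1.
Proof.
have w0 := weight_gt0 xi.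
rewrite -[leRHS](mulVf (lt0r_neq0 w0)) ler_pM2r// -prodfV.
under eq_bigr do rewrite invrK.
have H (r : seq 'I_n) : 1 + \sum_(j <- r) xi ord0 j * xi ord0 j <=
    \prod_(j <- r) (1 + xi ord0 j ^+ 2).
  elim: r => [|j r IH]; first by rewrite !big_nil addr0.
  rewrite !big_cons mulrDl mul1r -expr2 addrCA addrC lerD//.
  rewrite ler_peMr ?sqr_ge0// (le_trans _ IH)// lerDl.
  by apply: sumr_ge0 => i _; rewrite -expr2 sqr_ge0.
exact: H.
Qed.

End weight_edot.

(** * The truncated integrals as Fourier multipliers *)

Section multiplier.
Context {R : realType} (n : nat).
Local Notation V := 'rV[R]_n.+1.
Local Notation lebn := (@lebesgue_rV R n.+1).
Local Notation leb := (@lebesgue_measure R).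
Variables (c sg : R).
Hypothesis c_gt0 : 0 < c.
Hypothesis sg_gt0 : 0 < sg.
Hypothesis sg_lt1 : sg < 1.
Variables (F : V -> R[i]) (K : R).
Hypothesis mF : cmeasurable setT F.
Hypothesis FK : forall xi, normc (F xi) <= K * weight xi ^+ 2.

Let K_ge0 : 0 <= K.
Proof.
have w0 := weight_gt0 (0 : V).
have := le_trans (normc_ge0 _) (FK 0).
by rewrite pmulr_lge0// exprn_gt0.
Qed.

Let FK1 xi : normc (F xi) <= K * weight xi.
Proof.
rewrite (le_trans (FK xi))// ler_wpM2l// expr2 ler_piMl ?weight_le1//.
by rewrite ltW// weight_gt0.
Qed.

Lemma normc_wave_half x s : normc (wave c x (pi / 2) s) = 1.
Proof.
by rewrite /wave normc_cexp ReN ReM Re_cis Im_real cos_pihalf mul0r mulr0 subr0 oppr0 expR0.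
Qed.

Section fixed_interval.
Variables (e r : R).
Hypothesis e_gt0 : 0 < e.

(** The power [s ^ (-1)] replaces [1 / s] to make measurability on the whole
    line immediate; the indicator restricts to [s > 0]. *)
Let kern (p : R * V) : R[i] :=
  cexp (- (cexp ('i%C * (pi / 2)%:C) *
      (c * p.1 `^ (- 1) + edot p.2 p.2 * p.1)%:C)) * (p.1 `^ (- (1 + sg)))%:C *
  (\1_`[e, r]%classic p.1 : R)%:C.

Let kernE s xi : kern (s, xi) = wave c (edot xi xi) (pi / 2) s *
  (s `^ (- (1 + sg)))%:C * (\1_`[e, r]%classic s : R)%:C.
Proof.
rewrite /kern /= indicE; have [/set_mem/=|_] := boolP (s \in _); last by rewrite !mulr0.
rewrite in_itv/= => /andP[es _]; rewrite /wave powR_inv1//.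
by rewrite (le_trans _ es)// ltW.
Qed.

Let bound (s : R) := s `^ (- (1 + sg)) * \1_`[e, r]%classic s.

Let integrable_bound : leb.-integrable setT (EFin \o bound).
Proof.
have i : leb.-integrable `[e, r] (EFin \o (fun s : R => s `^ (- (1 + sg)))).
  apply: integrable_itv => s /andP[es _]; apply: continuous_powR.
  exact: lt_le_trans es.
rewrite (_ : EFin \o bound = (EFin \o (fun s : R => s `^ (- (1 + sg)))) \_ `[e, r]).
  by apply: (iffLR (integrable_mkcond _ _) i); exact: measurable_itv.
by rewrite restrict_EFin patch_indic.
Qed.

Let bound_ge0 s : 0 <= bound s.
Proof. by rewrite mulr_ge0 ?powR_ge0// indicE. Qed.

Let normc_kern p : normc (kern p) <= bound p.1.
Proof.
case: p => s xi; rewrite kernE normcM normcM normc_wave_half mul1r !normc_real.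
by rewrite !ger0_norm ?powR_ge0 ?indicE.
Qed.

Let cmeasurable_kern : cmeasurable setT kern.
Proof.
apply: cmeasurableM; last first.
  apply: cmeasurable_real; apply: measurableT_comp (measurable_fst).
  exact: measurable_indic.
apply: cmeasurableM; last first.
  by apply: cmeasurable_real; exact: measurableT_comp (measurable_powR _) measurable_fst.
apply: cmeasurable_cexp; under eq_fun do rewrite -mulNr.
apply: cmeasurableM; first exact: cmeasurable_cst.
apply: cmeasurable_real; apply: measurable_funD.
  by apply: measurable_funM => //; exact: measurableT_comp (measurable_powR _) measurable_fst.
apply: measurable_funM; last exact: measurable_fst.
by apply: measurable_edot2; exact: measurable_snd.
Qed.

Let cintegral_kern xi :
  cintegral leb setT (fun s => kern (s, xi)) = truncated c sg (edot xi xi) (pi / 2) e r.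
Proof.
rewrite /truncated [RHS]cintegral_mkcond; apply: eq_cintegral => s _.
by rewrite kernE.
Qed.

Let cintegrable_kern xi : cintegrable leb setT (fun s => kern (s, xi)).
Proof.
apply: (le_cintegrable measurableT _ integrable_bound); last first.
  by move=> s _; exact: normc_kern.
exact: (cmeasurable_comp cmeasurable_kern (pair2_measurable xi)).
Qed.

Lemma cmeasurable_truncated_xi :
  cmeasurable setT (fun xi : V => truncated c sg (edot xi xi) (pi / 2) e r).
Proof.
have [mr mi] := cmeasurable_kern.
under eq_fun do rewrite -cintegral_kern.
split.
  apply: (@measurable_Rintegral_rV R n.+1 _ _ leb (fun p => Re (kern (p.2, p.1))) bound).
  - exact: measurableT_comp mr (@measurable_swap _ _ _ _).
  - exact: integrable_bound.
  - by move=> xi s /=; exact: le_trans (le_Re_normc _) (normc_kern (s, xi)).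
apply: (@measurable_Rintegral_rV R n.+1 _ _ leb (fun p => Im (kern (p.2, p.1))) bound).
- exact: measurableT_comp mi (@measurable_swap _ _ _ _).
- exact: integrable_bound.
- by move=> xi s /=; exact: le_trans (le_Im_normc _) (normc_kern (s, xi)).
Qed.

Lemma normc_truncated (xi : V) :
  normc (truncated c sg (edot xi xi) (pi / 2) e r) <= 2 * \int[leb]_s bound s.
Proof.
rewrite -cintegral_kern; apply: (normc_cintegral_le measurableT).
- exact: cintegrable_kern.
- exact: integrable_bound.
- by move=> s _; exact: normc_kern.
Qed.

Lemma cwbounded_truncated :
  cwbounded (fun xi => truncated c sg (edot xi xi) (pi / 2) e r * F xi).
Proof.
apply: (@cwboundedP _ _ _ (2 * \int[leb]_s bound s * K)).
  exact: cmeasurableM cmeasurable_truncated_xi mF.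
move=> xi; rewrite normcM -[leRHS]mulrA; apply: ler_pM; rewrite ?normc_ge0//.
exact: normc_truncated.
Qed.

Lemma cwbounded_cis (x : V) (h : V -> R[i]) : cwbounded h ->
  cwbounded (fun xi => cexp ('i%C * (edot x xi)%:C) * h xi).
Proof.
move=> [[mr [M1 h1]] [mi [M2 h2]]].
apply: (@cwboundedP _ _ _ (M1 + M2)).
  by apply: cmeasurableM; [exact: cmeasurable_cis_edot|split].
move=> xi; rewrite normcM normc_cis mul1r (le_trans (normc_le_parts _))//.
by rewrite mulrDl lerD.
Qed.

(** Fubini's theorem: on a compact interval the kernel is dominated by the
    product of an integrable function of [s] and the weight. *)
Lemma truncated_inv_fourier (x : V) :
  cintegral leb `[e, r] (fun s => (s `^ (- (1 + sg)))%:C *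
    inv_fourier (fun xi => wave c (edot xi xi) (pi / 2) s * F xi) x) =
  inv_fourier (fun xi => truncated c sg (edot xi xi) (pi / 2) e r * F xi) x.
Proof.
pose kd : R[i] := (((2 * pi) ^+ n.+1)^-1)%:C.
pose w (xi : V) := kd * (cexp ('i%C * (edot x xi)%:C) * F xi).
have mw : cmeasurable setT w.
  apply: cmeasurableM; first exact: cmeasurable_cst.
  by apply: cmeasurableM => //; exact: cmeasurable_cis_edot.
have wK xi : normc (w xi) <= normc kd * (K * weight xi).
  by rewrite normcM normcM normc_cis mul1r ler_wpM2l ?normc_ge0.
have iK : lebn.-integrable setT (EFin \o (fun xi => normc kd * (K * weight xi))).
  have := integrableZl measurableT (normc kd * K) (integrable_weight n.+1).
  by apply: eq_integrable => // xi _; rewrite /= -EFinM mulrA.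
have S := @cintegral_swap R _ _ _ _ leb lebn (fun p => kern p * w p.2) bound _
  (cmeasurableM cmeasurable_kern (cmeasurable_comp mw measurable_snd)) integrable_bound iK.
have bJ s xi : normc (kern (s, xi) * w xi) <= bound s * (normc kd * (K * weight xi)).
  by rewrite normcM ler_pM ?normc_ge0 ?normc_kern.
have {}S := S bJ.
transitivity (cintegral leb setT (fun s =>
    cintegral lebn setT (fun xi => kern (s, xi) * w xi))).
  rewrite cintegral_mkcond; apply: eq_cintegral => s _.
  rewrite /inv_fourier -/kd.
  have bW : cwbounded (fun xi => wave c (edot xi xi) (pi / 2) s * F xi).
    apply: (@cwboundedP _ _ _ K); last first.
      by move=> xi; rewrite normcM normc_wave_half mul1r.
    apply: cmeasurableM => //; apply: cmeasurable_cexp; under eq_fun do rewrite -mulNr.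
    apply: cmeasurableM; first exact: cmeasurable_cst.
    apply: cmeasurable_real; apply: measurable_funD => //.
    by apply: measurable_funM => //; exact: measurable_edot2.
  have iW := cwbounded_cintegrable (cwbounded_cis x bW).
  rewrite -(cintegralM measurableT kd iW).
  have iW2 := cintegrableM measurableT kd iW.
  rewrite mulrAC -(cintegralM measurableT _ iW2); apply: eq_cintegral => xi _.
  by rewrite kernE /w; ring.
rewrite [LHS]S.
have iT := cwbounded_cintegrable (cwbounded_cis x cwbounded_truncated).
rewrite /inv_fourier -/kd -(cintegralM measurableT kd iT).
apply: eq_cintegral => xi _ /=.
under eq_cintegral do rewrite mulrC.
rewrite (cintegralM measurableT _ (cintegrable_kern xi)) cintegral_kern /w; ring.
Qed.

End fixed_interval.

Let delta (e r : R) := e `^ (1 - sg) + r `^ (- sg).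

Let delta_ge0 e r : 0 <= delta e r.
Proof. by rewrite addr_ge0 ?powR_ge0. Qed.

Let T := trunc_cst c sg.

Let T_ge0 : 0 <= T.
Proof.
have s1 : 0 <= 1 - sg by rewrite subr_ge0 ltW.
by rewrite addr_ge0 ?divr_ge0 ?addr_ge0 ?divr_ge0 ?(ltW c_gt0) ?(ltW sg_gt0).
Qed.

Definition limit_symbol : V -> R[i] :=
  off0 (fun xi => wave_limit c sg (edot xi xi) * F xi).

Definition truncated_symbol (e r : R) : V -> R[i] :=
  off0 (fun xi => truncated c sg (edot xi xi) (pi / 2) e r * F xi).

(** Of the two powers of the weight that bound [F], one pays for the growth of
    the symbols and the other is left for integrability. *)
Lemma truncated_symbol_dist e r xi : 0 < e -> e <= 1 -> 1 <= r ->
  normc (truncated_symbol e r xi - limit_symbol xi) <= T * K * delta e r * weight xi.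
Proof.
move=> e0 e1 r1; have w0 := weight_gt0 xi.
rewrite /truncated_symbol /limit_symbol /off0; have [_|x0] := eqVneq xi 0.
  by rewrite subrr normc0 !mulr_ge0// ltW.
rewrite -mulrBl normcM.
have h1 := truncated_wave_limit c_gt0 sg_gt0 sg_lt1 (edot_gt0 x0) e0 e1 r1.
rewrite (@le_trans _ _ (T * (1 + edot xi xi) * delta e r * (K * weight xi ^+ 2)))//.
  by rewrite ler_pM ?normc_ge0.
rewrite (_ : T * (1 + edot xi xi) * delta e r * (K * weight xi ^+ 2) =
  T * K * delta e r * weight xi * ((1 + edot xi xi) * weight xi)); last by ring.
by rewrite ler_piMr ?edot_weight// !mulr_ge0// ltW.
Qed.

Lemma cmeasurable_truncated_symbol e r : 0 < e ->
  cmeasurable setT (truncated_symbol e r).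
Proof.
move=> e0; apply: (@cmeasurable_off0 _ _
  (fun xi => truncated c sg (edot xi xi) (pi / 2) e r * F xi)).
  exact: cmeasurableM (cmeasurable_truncated_xi _ e0) mF.
by move=> xi x0; rewrite /truncated_symbol /off0 (negbTE x0).
Qed.

Lemma cwbounded_truncated_symbol e r : 0 < e -> cwbounded (truncated_symbol e r).
Proof.
move=> e0; have [[_ [M1 h1]] [_ [M2 h2]]] := @cwbounded_truncated e r e0.
apply: (@cwboundedP _ _ _ (M1 + M2)); first exact: cmeasurable_truncated_symbol.
have H xi : normc (truncated c sg (edot xi xi) (pi / 2) e r * F xi) <= (M1 + M2) * weight xi.
  by rewrite (le_trans (normc_le_parts _))// [leRHS]mulrDl lerD.
move=> xi; rewrite /truncated_symbol /off0; case: ifP => // _.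
by rewrite normc0 (le_trans _ (H xi))// normc_ge0.
Qed.

(** Measurability as a limit of truncated symbols, and the bound by comparison
    with the empty truncation [e = r = 1]. *)
Lemma cwbounded_limit_symbol : cwbounded limit_symbol.
Proof.
have h0 k : 0 < k.+1%:R^-1 :> R by rewrite invr_gt0.
have h1 k : k.+1%:R^-1 <= 1 :> R by rewrite invf_le1// ler1n.
have s1 : 0 < 1 - sg by rewrite subr_gt0.
have cd : delta k.+1%:R^-1 k.+1%:R @[k --> \oo] --> (0 : R).
  rewrite -(addr0 0); apply: cvgD.
    exact: (cvg_powR_h h0 (@cvg_harmonic R) s1).
  under eq_fun do rewrite -powRV//.
  exact: (cvg_powR_h h0 (@cvg_harmonic R) sg_gt0).
have cs xi : ccvg (fun k => truncated_symbol k.+1%:R^-1 k.+1%:R xi) (limit_symbol xi).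
  apply: normc_ccvg; apply: (@squeeze_cvgr _ _ _ _ (fun=> 0)
    (fun k => T * K * weight xi * delta k.+1%:R^-1 k.+1%:R)).
  - apply: nearW => k; apply/andP; split; first exact: normc_ge0.
    rewrite [leRHS]mulrAC.
    have k1 : 1 <= k.+1%:R :> R by rewrite ler1n.
    exact: truncated_symbol_dist (h0 k) (h1 k) k1.
  - exact: cvg_cst.
  - rewrite -(mulr0 (T * K * weight xi)); apply: cvgM => //; exact: cvg_cst.
apply: (@cwboundedP _ _ _ (T * K * delta 1 1)).
  split.
    apply: (@measurable_fun_cvg _ _ _ _
      (fun k xi => Re (truncated_symbol k.+1%:R^-1 k.+1%:R xi))).
      by move=> k; have [] := cmeasurable_truncated_symbol k.+1%:R (h0 k).
    by move=> xi _; have [] := cs xi.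
  apply: (@measurable_fun_cvg _ _ _ _
    (fun k xi => Im (truncated_symbol k.+1%:R^-1 k.+1%:R xi))).
    by move=> k; have [] := cmeasurable_truncated_symbol k.+1%:R (h0 k).
  by move=> xi _; have [] := cs xi.
move=> xi; have := @truncated_symbol_dist 1 1 xi ltr01 (lexx 1) (lexx 1).
rewrite /truncated_symbol /off0; case: ifP => x0.
  by rewrite sub0r normcN.
rewrite (_ : truncated _ _ _ _ _ _ = 0) ?mul0r ?sub0r ?normcN//.
exact: truncated_refl.
Qed.

Lemma inv_fourierB (h1 h2 : V -> R[i]) x : cwbounded h1 -> cwbounded h2 ->
  inv_fourier h1 x - inv_fourier h2 x = inv_fourier (fun xi => h1 xi - h2 xi) x.
Proof.
move=> b1 b2; have i1 := cwbounded_cintegrable (cwbounded_cis x b1).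
have i2 := cwbounded_cintegrable (cwbounded_cis x b2).
rewrite /inv_fourier -mulrBr -(cintegralB measurableT i1 i2); congr (_ * _).
by apply: eq_cintegral => xi _; rewrite mulrBr.
Qed.

Lemma truncated_inv_fourier_symbol e r : 0 < e ->
  inv_fourier (fun xi => truncated c sg (edot xi xi) (pi / 2) e r * F xi) =
  inv_fourier (truncated_symbol e r).
Proof.
move=> e0; apply: inv_fourier_off0.
  exact: cmeasurableM (cmeasurable_truncated_xi _ e0) mF.
by move=> xi x0; rewrite /truncated_symbol /off0 (negbTE x0).
Qed.

Let A := Num.sqrt (2 * (2 * pi) ^+ n.+1 * \int[lebn]_x (weight x ^+ 2)) * (T * K).

Lemma L2norm_truncated e r : 0 < e -> e <= 1 -> 1 <= r ->
  (L2norm (fun x => inv_fourier (truncated_symbol e r) x - inv_fourier limit_symbol x)%R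
    <= (A * delta e r)%:E)%E.
Proof.
move=> e0 e1 r1.
have b1 := cwbounded_truncated_symbol r e0; have b2 := cwbounded_limit_symbol.
under [X in L2norm X]eq_fun do rewrite inv_fourierB//.
pose h xi := truncated_symbol e r xi - limit_symbol xi.
have mh : cmeasurable setT h.
  have m2 : cmeasurable setT limit_symbol by case: b2 => [[? _] [? _]].
  have m1 := @cmeasurable_truncated_symbol e r e0.
  have [m3 m4] := cmeasurableM (cmeasurable_cst setT (-1)) m2.
  apply: cmeasurableD => //; split.
    by move: m3; under eq_fun do rewrite mulN1r.
  by move: m4; under eq_fun do rewrite mulN1r.
have hb xi : normc (h xi) <= T * K * delta e r * weight xi by exact: truncated_symbol_dist.
have bh : cwbounded h := cwboundedP mh hb.
have A0 : 0 <= A by rewrite !mulr_ge0 ?sqrtr_ge0.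
apply: L2norm_le; first by rewrite mulr_ge0.
have bw : wbounded (@weight R n.+1).
  split; first exact: measurable_weight.
  by exists 1 => xi; rewrite mul1r gtr0_norm// weight_gt0.
have iw := integrableZl measurableT ((T * K * delta e r) ^+ 2) (wbounded_sqr_integrable bw).
have hb2 xi : normc (h xi) ^+ 2 <= (T * K * delta e r) ^+ 2 * weight xi ^+ 2.
  by rewrite -exprMn ler_sqr ?nnegrE ?hb ?normc_ge0// (le_trans _ (hb xi))// normc_ge0.
have ih : lebn.-integrable setT (EFin \o (fun xi => normc (h xi) ^+ 2)).
  apply: (le_integrable _ _ _ iw) => //.
    by apply/measurable_EFinP; apply: measurable_funX; exact: cmeasurable_normc.
  move=> xi _; rewrite /= lee_fin ger0_norm ?sqr_ge0//.
  exact: le_trans (hb2 xi) (ler_norm _).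
have I : \int[lebn]_x (normc (h x) ^+ 2) <=
    (T * K * delta e r) ^+ 2 * \int[lebn]_x (weight x ^+ 2).
  rewrite -(RintegralZl _ measurableT (wbounded_sqr_integrable bw)).
  by apply: le_Rintegral => // xi _; exact: hb2.
have P0 : 0 <= 2 * (2 * pi) ^+ n.+1 :> R.
  by rewrite mulr_ge0// exprn_ge0// mulr_ge0// pi_ge0.
have W0 : 0 <= \int[lebn]_x (weight x ^+ 2).
  by apply: Rintegral_ge0 => x _; rewrite sqr_ge0.
apply: (le_trans (inv_fourier_L2 bh)); rewrite lee_fin.
apply: (le_trans (ler_wpM2l P0 I)).
have E (a b u v : R) : 0 <= a * b -> (Num.sqrt (a * b) * u * v) ^+ 2 = a * ((u * v) ^+ 2 * b).
  by move=> ab0; rewrite 2!exprMn sqr_sqrtr//; ring.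
by rewrite /A (E _ _ _ _ (mulr_ge0 P0 W0)).
Qed.

Lemma cvg_powRN_pinfty (a : R) : 0 < a -> r `^ (- a) @[r --> +oo] --> (0 : R).
Proof.
move=> a0; apply/cvgrPdist_le => eps eps0.
have e0 : 0 < eps `^ (- a^-1) by rewrite powR_gt0.
near=> r; have re : eps `^ (- a^-1) <= r.
  by near: r; exact: nbhs_pinfty_ge (num_real _).
have r0 : 0 < r by exact: lt_le_trans re.
rewrite sub0r normrN ger0_norm ?powR_ge0// powRN invf_ple ?posrE ?powR_gt0//.
have := ge0_ler_powR (ltW a0) _ _ re; rewrite -powRrM mulNr mulVf ?gt_eqF//.
rewrite powR_inv1 ?(ltW eps0)//; apply; rewrite nnegrE; exact: ltW.
Unshelve. all: by end_near. Qed.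

(** The pointwise estimate on symbols becomes an estimate in L^2 through
    [inv_fourier_L2]. *)
Theorem cvg_L2norm_truncated :
  (L2norm (fun x => inv_fourier (truncated_symbol p.1 p.2) x - inv_fourier limit_symbol x)%R
    @[p --> filter_prod 0%R^'+ (pinfty_nbhs R)] --> 0)%E.
Proof.
have s1 : 0 < 1 - sg by rewrite subr_gt0.
apply: (@squeeze_cvge _ _ _ _ (fun=> 0%E) _ (fun p => (A * delta p.1 p.2)%:E)).
- exists (`]0, 1[%classic, `[1, +oo[%classic) => /=.
    split.
      apply: filterS2 (nbhs_right_gt (0 : R)) (nbhs_right_lt (ltr01 : 0 < 1 :> R)) => e h1 h2.
      by rewrite /= in_itv/= h1 h2.
    apply: filterS (nbhs_pinfty_ge (num_real (1 : R))) => r h1.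
    by rewrite /= in_itv/= h1.
  move=> -[e r] /= []; rewrite !in_itv/= andbT => /andP[e0 e1] r1.
  rewrite L2norm_truncated ?(ltW e1)// andbT L2normE.
  exact: poweR_ge0.
- exact: cvg_cst.
- apply: cvg_EFin; first exact: nearW.
  rewrite -[X in _ --> X](mulr0 A); apply: cvgM; first exact: cvg_cst.
  rewrite -[X in _ --> X](addr0 0); apply: cvgD.
    exact: (cvg_comp (fun p : R * R => p.1) (fun x : R => x `^ (1 - sg)) cvg_fst (powR_cvg0 s1)).
  exact: (cvg_comp (fun p : R * R => p.2) (fun x : R => x `^ (- sg)) cvg_snd
    (cvg_powRN_pinfty sg_gt0)).
Qed.

End multiplier.

Section constants.
Context {R : realType} (n : nat).
Local Notation V := 'rV[R]_n.+1.

Lemma inv_fourierZ (a : R[i]) (h : V -> R[i]) (x : V) : cwbounded h ->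
  inv_fourier (fun xi => a * h xi) x = a * inv_fourier h x.
Proof.
move=> bh; rewrite /inv_fourier mulrCA; congr (_ * _).
rewrite -(cintegralM measurableT a (cwbounded_cintegrable (cwbounded_cis x bh))).
by apply: eq_cintegral => xi _; rewrite mulrCA.
Qed.

Lemma wave_factor (t s : R) (xi : V) :
  cexp (- 'i%C * (t ^+ 2 / (4 * s))%:C) * cexp (- 'i%C * (s * enorm xi ^+ 2)%:C) =
  wave (t ^+ 2 / 4) (edot xi xi) (pi / 2) s.
Proof.
have ei : cexp ('i%C * (pi / 2)%:C) = 'i%C :> R[i].
  by apply: complex_ext; rewrite ?Re_cis ?Im_cis ?cos_pihalf ?sin_pihalf.
rewrite /wave ei -cexpD enorm_sqr -mulrDr mulNr -rmorphD/=.
by rewrite invfM mulrA (mulrC s).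
Qed.

Lemma cwbounded_schrodinger (s : R) (h : V -> R[i]) : cwbounded h ->
  cwbounded (fun xi => cexp (- 'i%C * (s * enorm xi ^+ 2)%:C) * h xi).
Proof.
move=> [[mr [M1 h1]] [mi [M2 h2]]].
apply: (@cwboundedP _ _ _ (M1 + M2)).
  apply: cmeasurableM; last by split.
  apply: cmeasurable_cexp; apply: cmeasurableM; first exact: cmeasurable_cst.
  apply: cmeasurable_real; under eq_fun do rewrite enorm_sqr.
  by apply: measurable_funM => //; exact: measurable_edot2.
move=> xi; rewrite Nimul normcM normc_cis mul1r (le_trans (normc_le_parts _))//.
by rewrite [leRHS]mulrDl lerD.
Qed.

End constants.

Theorem proposition2 (R : realType) (d : nat) (d_gt0 : (0 < d)%N)
    (sigma t : R) (sigma_gt0 : 0 < sigma) (sigma_lt1 : sigma < 1)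
    (t_gt0 : 0 < t) (f : 'rV[R]_d -> R[i]) (f_schwartz : schwartz f) :
  exists2 g : 'rV[R]_d -> R[i],
    is_L2_integral (fun s x =>
      cexp (- 'i%C * (t ^+ 2 / (4 * s))%:C) * schrodinger s f x /
        (s `^ (1 + sigma))%:C) g &
    {ae lebesgue_rV d, forall x,
      bessel_operator sigma t f x =
        cpow 'i%C sigma * (t `^ (2 * sigma))%:C / (2 `^ (1 + sigma))%:C * g x}.
Proof.
case: d d_gt0 f f_schwartz => // n _ f fS.
pose c := t ^+ 2 / 4; pose F := fourier f.
have c0 : 0 < c by rewrite divr_gt0 ?exprn_gt0.
have mF : cmeasurable setT F := cmeasurable_fourier (schwartz_cwbounded fS).
have [K FK] := fourier_schwartz_decay fS.
have K0 : 0 <= K.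
  have := le_trans (normc_ge0 _) (FK 0).
  by rewrite pmulr_lge0// exprn_gt0// weight_gt0.
have bL := cwbounded_limit_symbol c0 sigma_gt0 sigma_lt1 mF FK.
have IE e r x : 0 < e -> cintegral lebesgue_measure `[e, r] (fun s =>
    cexp (- 'i%C * (t ^+ 2 / (4 * s))%:C) * schrodinger s f x /
      (s `^ (1 + sigma))%:C) = inv_fourier (truncated_symbol c sigma F e r) x.
  move=> e0; rewrite -(truncated_inv_fourier_symbol _ _ mF r e0).
  rewrite -(truncated_inv_fourier c sigma mF FK r e0); apply: eq_cintegral => s.
  rewrite /= in_itv/= => /andP[es _]; have s0 : 0 < s := lt_le_trans e0 es.
  rewrite mulrC powRN fmorphV; congr (_ * _).
  rewrite /schrodinger /fourier_multiplier -inv_fourierZ.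
    by congr (inv_fourier _ x); apply/funext => xi; rewrite mulrA wave_factor.
  apply: cwbounded_schrodinger; apply: (cwboundedP (M := K) mF) => xi.
  rewrite (le_trans (FK xi))// expr2 mulrA ler_piMr ?weight_le1//.
  by rewrite mulr_ge0// ltW// weight_gt0.
exists (inv_fourier (limit_symbol c sigma F)).
  split.
  - move=> e r e0 _.
    rewrite [X in L2 X](_ : _ = inv_fourier (truncated_symbol c sigma F e r)).
      exact: L2_inv_fourier (cwbounded_truncated_symbol c sigma mF FK r e0).
    by apply/funext => x; exact: IE.
  - exact: L2_inv_fourier.
  - apply: cvg_trans (cvg_L2norm_truncated c0 sigma_gt0 sigma_lt1 mF FK).
    apply: near_eq_cvg.
    exists (`]0, +oo[%classic, setT) => /=.
      split; last exact: filterT.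
      by apply: filterS (nbhs_right_gt (0 : R)) => e e0; rewrite /= in_itv/= e0.
    move=> -[e r] /= [+ _]; rewrite in_itv/= andbT => e0.
    by congr (L2norm _); apply/funext => x; rewrite IE.
apply: aeW => x; rewrite -inv_fourierZ//.
have mL : cmeasurable setT (limit_symbol c sigma F) by case: bL => [[? _] [? _]].
rewrite /bessel_operator /fourier_multiplier.
have mcL := cmeasurableM (cmeasurable_cst setT (cpow 'i%C sigma *
  (t `^ (2 * sigma))%:C / (2 `^ (1 + sigma))%:C)) mL.
rewrite (inv_fourier_off0 mcL (g := fun xi => cpow ('i%C * (t * enorm xi)%:C) sigma *
  besselK sigma ('i%C * (t * enorm xi)%:C) * fourier f xi))//.
move=> xi x0; have n0 : 0 < enorm xi by rewrite sqrtr_gt0 edot_gt0.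
rewrite (bessel_multiplier sigma t_gt0 n0) enorm_sqr /limit_symbol /off0 (negbTE x0).
by rewrite -/c mulrA.
Qed.
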